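(* Let $\alpha>-1$, let $M>0$ be a constant, and let $f\in\mathcal{C}^2(\mathbb{D})$ be a solution of the Dirichlet problem $T_\alpha(f)=0$ in $\mathbb{D}$, $f=f^{*}$ on $\partial\mathbb{D}$ (in the distributional sense), with $\sup_{z\in\mathbb{D}}|f(z)|\le M$. Then, for every $z\in\mathbb{D}$, $$\left|f(z)-\frac{(1-|z|)^{\alpha+1}}{1+|z|}f(0)\right|\le M\left[\frac{1}{2\pi}\int_0^{2\pi}K_\alpha(ze^{-it})\,dt-\frac{(1-|z|)^{\alpha+1}}{1+|z|}K_\alpha(0)\right]$$ and $$\|D_f(z)\|\le\frac{M\,\mathcal{M}_\alpha(|z|)\,\big[2+\alpha+(4+3\alpha)|z|\big]}{1-|z|^2}\le\frac{M\big[2+\alpha+(4+3\alpha)|z|\big]}{1-|z|^2},$$ where, for $r\in[0,1)$, $$\mathcal{M}_\alpha(r)=\frac{1}{2\pi}\int_0^{2\pi}K_\alpha(re^{i\epsilon})\,d\epsilon=\frac{\left[\Gamma\left(1+\frac{\alpha}{2}\right)\right]^2}{\Gamma(1+\alpha)}\,F\left(-\frac{\alpha}{2},-\frac{\alpha}{2};1;r^2\right).$$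
   Context: $\mathbb{D}$ is the open unit disk in $\mathbb{C}$; $\mathcal{C}^2(\mathbb{D})$ is the set of twice continuously differentiable complex-valued functions on $\mathbb{D}$. With $\frac{\partial}{\partial z}=\frac12(\frac{\partial}{\partial x}-i\frac{\partial}{\partial y})$, $\frac{\partial}{\partial\bar z}=\frac12(\frac{\partial}{\partial x}+i\frac{\partial}{\partial y})$ and $\Delta=4\frac{\partial^2}{\partial z\partial\bar z}$, for $\alpha\in\mathbb{R}$ the operator $T_\alpha$ is $$T_{\alpha}=-\frac{\alpha^{2}}{4}(1-|z|^{2})^{-\alpha-1}+\frac{\alpha}{2}(1-|z|^{2})^{-\alpha-1}\left(z\frac{\partial}{\partial z}+\bar z\frac{\partial}{\partial\bar z}\right)+\frac14(1-|z|^2)^{-\alpha}\Delta .$$ The Dirichlet problem means: $T_\alpha(f)=0$ in $\mathbb{D}$, and for a distribution $f^*\in\mathfrak{D}'(\partial\mathbb{D})$ the functions $f_r(e^{i\theta})=f(re^{i\theta})$, $r\in[0,1)$, converge to $f^*$ in $\mathfrak{D}'(\partial\mathbb{D})$ as $r\to1^-$. The kernel is $K_\alpha(z)=c_\alpha\frac{(1-|z|^2)^{\alpha+1}}{|1-z|^{\alpha+2}}$ with $c_\alpha=\frac{(\Gamma(\alpha/2+1))^2}{\Gamma(1+\alpha)}$, $\Gamma$ the Gamma function. $\|D_f(z)\|=|f_z(z)|+|f_{\bar z}(z)|$ (the operator norm of the real Jacobian matrix of $f$). The hypergeometric function is $F(a,b;c;x)=\sum_{n=0}^\infty\frac{(a)_n(b)_n}{(c)_n}\frac{x^n}{n!}$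 for $|x|<1$, with $(a)_0=1$, $(a)_n=a(a+1)\cdots(a+n-1)$. *)

(* Defs.v *)
From Stdlib Require Import Reals Factorial.
From Coquelicot Require Import Coquelicot.
Open Scope R_scope.

(** ** Partial and Wirtinger derivatives of [f : C -> C]

    Coquelicot's [Derive] is real-valued, so the real partial derivatives of a
    complex-valued function are taken on its real and imaginary parts. *)

Definition ex_partial_x (f : C -> C) (z : C) : Prop :=
  ex_derive (fun t => Re (f (t, Im z))) (Re z) /\
  ex_derive (fun t => Im (f (t, Im z))) (Re z).

Definition ex_partial_y (f : C -> C) (z : C) : Prop :=
  ex_derive (fun t => Re (f (Re z, t))) (Im z) /\
  ex_derive (fun t => Im (f (Re z, t))) (Im z).

Definition partial_x (f : C -> C) (z : C) : C :=
  (Derive (fun t => Re (f (t, Im z))) (Re z),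
   Derive (fun t => Im (f (t, Im z))) (Re z)).

Definition partial_y (f : C -> C) (z : C) : C :=
  (Derive (fun t => Re (f (Re z, t))) (Im z),
   Derive (fun t => Im (f (Re z, t))) (Im z)).

Definition d_z (f : C -> C) (z : C) : C :=
  (RtoC (1 / 2) * (partial_x f z - Ci * partial_y f z))%C.

Definition d_zbar (f : C -> C) (z : C) : C :=
  (RtoC (1 / 2) * (partial_x f z + Ci * partial_y f z))%C.

Definition laplacian (f : C -> C) (z : C) : C :=
  (RtoC 4 * d_z (d_zbar f) z)%C.

Definition in_disk (z : C) : Prop := Cmod z < 1.

(** Functions are total on [C], but only their values on the (open) disk are
    constrained. *)
Fixpoint Ck_disk (k : nat) (f : C -> C) : Prop :=
  (forall z : C, in_disk z -> continuous f z) /\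
  match k with
  | O => True
  | S k' =>
      (forall z : C, in_disk z -> ex_partial_x f z /\ ex_partial_y f z) /\
      Ck_disk k' (partial_x f) /\ Ck_disk k' (partial_y f)
  end.

Definition norm_D (f : C -> C) (z : C) : R :=
  Cmod (d_z f z) + Cmod (d_zbar f z).

Definition T_op (alpha : R) (f : C -> C) (z : C) : C :=
  let w := 1 - Cmod z ^ 2 in
  (RtoC (- (alpha ^ 2 / 4) * Rpower w (- alpha - 1)) * f z
   + RtoC (alpha / 2 * Rpower w (- alpha - 1))
     * (z * d_z f z + Cconj z * d_zbar f z)
   + RtoC (1 / 4 * Rpower w (- alpha)) * laplacian f z)%C.

(** ** Distributions on the unit circle

    A function on the circle is represented by the function of the angle, so
    that test functions are the smooth [2 * PI]-periodic ones. *)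

Definition cis (t : R) : C := (cos t, sin t).

Definition CDerive_n (phi : R -> C) (n : nat) (t : R) : C :=
  (Derive_n (fun s => Re (phi s)) n t, Derive_n (fun s => Im (phi s)) n t).

Definition test_function (phi : R -> C) : Prop :=
  (forall t : R, phi (t + 2 * PI) = phi t) /\
  (forall (n : nat) (t : R),
     ex_derive_n (fun s => Re (phi s)) n t /\
     ex_derive_n (fun s => Im (phi s)) n t).

(** Continuity is for the Frechet topology given by the seminorms
    [max_(k <= N) sup_t |phi^(k) t|]; [B] below is any bound of that seminorm. *)
Definition is_distribution (u : (R -> C) -> C) : Prop :=
  (forall phi psi : R -> C, test_function phi -> test_function psi ->
     u (fun t => (phi t + psi t)%C) = (u phi + u psi)%C) /\
  (forall (c : C) (phi : R -> C), test_function phi ->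
     u (fun t => (c * phi t)%C) = (c * u phi)%C) /\
  (exists (N : nat) (A : R), forall (phi : R -> C) (B : R),
     test_function phi ->
     (forall (k : nat) (t : R), (k <= N)%nat -> Cmod (CDerive_n phi k t) <= B) ->
     Cmod (u phi) <= A * B).

(** A continuous function on the circle acts as a distribution by integration
    against the normalized arc length. *)
Definition pairing (g phi : R -> C) : C :=
  (RtoC (1 / (2 * PI)) *
   RInt (V := C_R_CompleteNormedModule) (fun t => g t * phi t) 0 (2 * PI))%C.

Definition has_boundary_distribution (f : C -> C) (u : (R -> C) -> C) : Prop :=
  forall phi : R -> C, test_function phi ->
    filterlim (fun r : R => pairing (fun t => f (RtoC r * cis t)%C) phi)
      (at_left 1) (locally (u phi)).

Definition dirichlet_solution (alpha : R) (f : C -> C) (fstar : (R -> C) -> C)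
  : Prop :=
  (forall z : C, in_disk z -> T_op alpha f z = RtoC 0) /\
  has_boundary_distribution f fstar.

(** ** Special functions and the kernel *)

(** Euler's integral, convergent for [0 < x]; under [-1 < alpha] it is only
    evaluated there. *)
Definition Gamma (x : R) : R :=
  RInt_gen (fun t => Rpower t (x - 1) * exp (- t))
    (at_right 0) (Rbar_locally p_infty).

Fixpoint pochhammer (a : R) (n : nat) : R :=
  match n with
  | O => 1
  | S m => pochhammer a m * (a + INR m)
  end.

Definition hypergeom (a b c x : R) : R :=
  Series (fun n => pochhammer a n * pochhammer b n / pochhammer c n
                   * (x ^ n / INR (fact n))).

Definition c_const (alpha : R) : R :=
  Gamma (alpha / 2 + 1) ^ 2 / Gamma (1 + alpha).

Definition K_kernel (alpha : R) (z : C) : R :=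
  c_const alpha * (Rpower (1 - Cmod z ^ 2) (alpha + 1)
                   / Rpower (Cmod (1 - z)%C) (alpha + 2)).

Definition M_mean (alpha r : R) : R :=
  1 / (2 * PI) * RInt (fun e => K_kernel alpha (RtoC r * cis e)%C) 0 (2 * PI).

(* Main.v *)
(* Multiplying [f] by a unimodular constant and taking real parts reduces
   everything to a bounded real solution [u] of
   [(1-|z|^2) Lap u + 2 alpha (x u_x + y u_y) - alpha^2 u = 0].

   Poisson representation.  For [rho < 1] the functions
   [z |-> int K(e^{-it} z) u(rho e^{it}) dt] and
   [z |-> int u(e^{-it} z) K(rho e^{it}) dt] both solve the equation and agree
   for [|z| = rho] by the change of variable [t -> arg z - t], so they agree for
   [|z| <= rho] by the maximum principle.  The second one tends to a constant
   times [u z] as [rho -> 1] because [K(rho e^{it})] is an approximate identity.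
   Thus [u] is a limit of Poisson integrals of functions bounded by [M]; the
   boundary distribution itself plays no role.

   Mean of the kernel.  By the same uniqueness the rotation average of [K] is
   [c F(-alpha/2,-alpha/2;1;|z|^2)].  Its limit at [|z| = 1] is [1] by Gauss's
   theorem, proved by iterating the contiguous relation [c -> c+1] and comparing
   with the functional equation of Gamma.

   Estimates.  The first one follows from the pointwise lower bound of [K] on
   circles, the gradient estimate from the Harnack inequality for [K] applied to
   difference quotients, which avoids differentiating the representation. *)
Require Import Defs.
From Stdlib Require Import Reals Lra Lia Psatz Factorial IndefiniteDescription.
From Coquelicot Require Import Coquelicot.
Open Scope R_scope.

(** * Closed disks, rotations and uniform continuity *)


(** The equation is not invariant under dilations: [u (rho z)] need not be a solution, so no
    explicit Poisson kernel is at hand for a smaller disk, and on the unit circle [u] has no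
    pointwise values to integrate. Rotations are the symmetry that remains. This is why everything
    passes through [circ_int], and why uniqueness is applied to two convolutions rather than to [u]
    itself. The price is that the kernel has a total mass depending on the radius; Gauss's theorem
    identifies the limit mass [2 * PI * Series (radial_coef alpha)] with [2 * PI / c_const alpha],
    and this also gives [M_mean <= 1]. The factor [(1-r)^(alpha+1) / (1+r)] of the first estimate is
    the minimum of the unnormalised kernel on the circle of radius [r], attained at [-r]. The
    bracket [2 + alpha + (4 + 3 alpha) r] is [1 - r^2] times the bound [log_slope] of the
    logarithmic gradient of the kernel. Both estimates come from one inequality between two points,
    [two_point_bound], with different weights [l]. *)

Definition disk (x y : R) : Prop := x * x + y * y < 1.
(* [rot_x x y t + i rot_y x y t = e^{-it} (x + iy)]. *)
Definition rot_x (x y t : R) : R := x * cos t + y * sin t.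
Definition rot_y (x y t : R) : R := y * cos t - x * sin t.

Lemma rot_sq (x y t : R) :
  rot_x x y t * rot_x x y t + rot_y x y t * rot_y x y t = x * x + y * y.
Proof.
  unfold rot_x, rot_y.
  assert (H := sin2_cos2 t); unfold Rsqr in H.
  transitivity ((x * x + y * y) * (sin t * sin t + cos t * cos t)); [ring|].
  rewrite H; ring.
Qed.

Lemma disk_rot (x y t : R) : disk x y -> disk (rot_x x y t) (rot_y x y t).
Proof. unfold disk; now rewrite rot_sq. Qed.

Lemma cont_cos (t : R) : continuous cos t.
Proof. apply continuity_pt_filterlim, continuity_cos. Qed.

Lemma cont_sin (t : R) : continuous sin t.
Proof. apply continuity_pt_filterlim, continuity_sin. Qed.

Lemma cont_scal_cos (a t : R) : continuous (fun t => a * cos t) t.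
Proof. apply (continuous_mult (K := R_AbsRing)); [apply continuous_const | apply cont_cos]. Qed.

Lemma cont_scal_sin (a t : R) : continuous (fun t => a * sin t) t.
Proof. apply (continuous_mult (K := R_AbsRing)); [apply continuous_const | apply cont_sin]. Qed.

Lemma disk_locally (x y : R) :
  disk x y -> exists d : posreal, forall u v : R,
    Rabs (u - x) < d -> Rabs (v - y) < d -> disk u v.
Proof.
  intros H.
  assert (Hc : continuity_2d_pt (fun u v => u * u + v * v) x y).
  { apply continuity_2d_pt_plus; apply continuity_2d_pt_mult;
      first [apply continuity_2d_pt_id1 | apply continuity_2d_pt_id2]. }
  assert (He : 0 < 1 - (x * x + y * y)) by (unfold disk in H; lra).
  destruct (Hc (mkposreal _ He)) as [d Hd].
  exists d; intros u v Hu Hv.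
  specialize (Hd u v Hu Hv); simpl in Hd.
  apply Rabs_def2 in Hd; unfold disk; lra.
Qed.

Lemma disk_locally_x (x y : R) : disk x y -> locally x (fun u => disk u y).
Proof.
  intros H; destruct (disk_locally x y H) as [d Hd].
  exists d; intros u Hu; apply Hd; [exact Hu|].
  replace (y - y) with 0 by ring; rewrite Rabs_R0; apply cond_pos.
Qed.

Definition cont_disk (g : R -> R -> R) : Prop :=
  forall x y : R, disk x y -> continuity_2d_pt g x y.

Lemma continuous_comp_2d {U : UniformSpace} (g : R -> R -> R) (a b : U -> R) (p : U) :
  continuity_2d_pt g (a p) (b p) -> continuous a p -> continuous b p ->
  continuous (fun q => g (a q) (b q)) p.
Proof.
  intros Hg Ha Hb.
  apply (continuous_comp_2 a b g p Ha Hb).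
  apply continuity_2d_pt_filterlim in Hg; exact Hg.
Qed.

Lemma continuous_2d (h : R * R -> R) (x y : R) :
  continuous h (x, y) -> continuity_2d_pt (fun u v => h (u, v)) x y.
Proof.
  intros H; apply continuity_2d_pt_filterlim.
  apply filterlim_ext with (2 := H); now intros [u v].
Qed.

Lemma cont_disk_rot (g : R -> R -> R) (x y t : R) :
  cont_disk g -> disk x y ->
  continuous (fun t => g (rot_x x y t) (rot_y x y t)) t.
Proof.
  intros Hg Hd.
  apply (continuous_comp_2d g (fun t => rot_x x y t) (fun t => rot_y x y t)).
  - apply Hg, disk_rot, Hd.
  - unfold rot_x. apply (continuous_plus (V := R_NormedModule)); [apply cont_scal_cos | apply cont_scal_sin].
  - unfold rot_y. apply (continuous_minus (V := R_NormedModule)); [apply cont_scal_cos | apply cont_scal_sin].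
Qed.

Lemma disk_of_radius (x y rho : R) :
  0 <= rho < 1 -> x * x + y * y <= rho * rho -> disk x y.
Proof. intros H1 H2; unfold disk; nra. Qed.

(* The radial retraction onto the closed disk of radius [rho] transports the
   compactness of rectangles to closed disks. *)
Lemma disk_retraction (rho : R) : 0 < rho ->
  exists k : R -> R -> R,
    (forall x y, continuity_2d_pt k x y) /\
    (forall x y, (x * k x y) * (x * k x y) + (y * k x y) * (y * k x y) <= rho * rho) /\
    (forall x y, x * x + y * y <= rho * rho -> k x y = 1).
Proof.
  intros Hr.
  exists (fun x y => rho / Rmax rho (sqrt (x * x + y * y))).
  assert (Hm : forall x y, 0 < Rmax rho (sqrt (x * x + y * y)))
    by (intros; apply Rlt_le_trans with (1 := Hr), Rmax_l).
  split; [|split].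
  - intros x y; unfold Rdiv.
    apply continuity_2d_pt_mult; [apply continuity_2d_pt_const|].
    apply continuity_2d_pt_inv; [|apply Rgt_not_eq, Hm].
    apply continuity_2d_pt_ext
      with (fun u v => (rho + sqrt (u * u + v * v) + Rabs (rho - sqrt (u * u + v * v))) * / 2).
    { intros u v; unfold Rmax, Rabs; destruct Rle_dec; destruct Rcase_abs; lra. }
    assert (Hs : continuity_2d_pt (fun u v => sqrt (u * u + v * v)) x y).
    { apply (continuity_1d_2d_pt_comp sqrt (fun u v => u * u + v * v)).
      - apply continuity_pt_sqrt; nra.
      - apply continuity_2d_pt_plus; apply continuity_2d_pt_mult;
          first [apply continuity_2d_pt_id1 | apply continuity_2d_pt_id2]. }
    apply continuity_2d_pt_mult; [|apply continuity_2d_pt_const].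
    apply continuity_2d_pt_plus.
    + apply continuity_2d_pt_plus; [apply continuity_2d_pt_const | exact Hs].
    + apply (continuity_1d_2d_pt_comp Rabs (fun u v => rho - sqrt (u * u + v * v))).
      * apply Rcontinuity_abs.
      * apply continuity_2d_pt_minus; [apply continuity_2d_pt_const | exact Hs].
  - intros x y. specialize (Hm x y).
    set (m := Rmax _ _) in *.
    assert (Hq : x * x + y * y <= m * m).
    { rewrite <- (sqrt_sqrt (x * x + y * y)) by nra.
      assert (sqrt (x * x + y * y) <= m) by apply Rmax_r.
      assert (0 <= sqrt (x * x + y * y)) by apply sqrt_pos. nra. }
    replace (x * (rho / m) * (x * (rho / m)) + y * (rho / m) * (y * (rho / m)))
      with (rho * rho * ((x * x + y * y) / (m * m))) by (field; lra).
    rewrite <- (Rmult_1_r (rho * rho)) at 2.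
    apply Rmult_le_compat_l; [nra|].
    apply Rle_div_l; nra.
  - intros x y H.
    rewrite Rmax_left; [field; lra|].
    rewrite <- (sqrt_square rho) by lra. now apply sqrt_le_1_alt.
Qed.

Lemma cont_retract (g : R -> R -> R) (rho : R) (k : R -> R -> R) :
  0 < rho < 1 -> cont_disk g ->
  (forall x y, continuity_2d_pt k x y) ->
  (forall x y, (x * k x y) * (x * k x y) + (y * k x y) * (y * k x y) <= rho * rho) ->
  forall x y, continuity_2d_pt (fun x y => g (x * k x y) (y * k x y)) x y.
Proof.
  intros Hr Hg Hk Hk2 x y.
  apply (continuous_2d (fun p => g (fst p * k (fst p) (snd p)) (snd p * k (fst p) (snd p)))).
  assert (Hkc : continuous (fun p : R * R => k (fst p) (snd p)) (x, y)).
  { apply continuity_2d_pt_filterlim with (f := k), Hk. }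
  apply continuous_comp_2d.
  - simpl. apply Hg, (disk_of_radius _ _ rho); [lra | apply Hk2].
  - apply (continuous_mult (K := R_AbsRing)); [apply continuous_fst | exact Hkc].
  - apply (continuous_mult (K := R_AbsRing)); [apply continuous_snd | exact Hkc].
Qed.

(** After composition with the radial retraction, [g] is continuous on the whole plane and agrees
    with itself on the closed disk, so uniform continuity on the square of half-side 1 applies. *)
Lemma heine_disk (g : R -> R -> R) (rho : R) :
  0 < rho < 1 -> cont_disk g ->
  forall eps : posreal, exists d : posreal, forall x y u v,
    x * x + y * y <= rho * rho -> u * u + v * v <= rho * rho ->
    Rabs (u - x) < d -> Rabs (v - y) < d -> Rabs (g u v - g x y) < eps.
Proof.
  intros Hr Hg eps.
  destruct (disk_retraction rho) as [k [Hk [Hk2 Hk1]]]; [lra|].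
  destruct (uniform_continuity_2d (fun x y => g (x * k x y) (y * k x y)) (-1) 1 (-1) 1) with eps
    as [d Hd].
  { intros; now apply (cont_retract g rho). }
  exists d; intros x y u v H1 H2 H3 H4.
  specialize (Hd x y u v).
  rewrite (Hk1 x y H1), (Hk1 u v H2), !Rmult_1_r in Hd.
  assert (rho * rho <= 1) by nra.
  apply Hd; (assumption || nra).
Qed.

Lemma max_disk (g : R -> R -> R) (rho : R) :
  0 < rho < 1 -> cont_disk g ->
  exists x0 y0, x0 * x0 + y0 * y0 <= rho * rho /\
    forall x y, x * x + y * y <= rho * rho -> g x y <= g x0 y0.
Proof.
  intros Hr Hg.
  destruct (disk_retraction rho) as [k [Hk [Hk2 Hk1]]]; [lra|].
  set (h := fun x y => g (x * k x y) (y * k x y)).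
  assert (Hh : forall x y, continuity_2d_pt h x y) by (intros; now apply (cont_retract g rho)).
  assert (Hin : exists x0 y0, forall x y, -1 <= x <= 1 -> -1 <= y <= 1 -> h x y <= h x0 y0).
  { assert (Hsec : forall x, exists y0, -1 <= y0 <= 1 /\ forall y, -1 <= y <= 1 -> h x y <= h x y0).
    { intros x.
      destruct (continuity_ab_maj (h x) (-1) 1) as [y0 [H1 H2]]; [lra| |].
      - intros c _. apply continuity_pt_filterlim.
        apply (continuous_comp_2d h (fun _ => x) (fun y => y));
          [apply Hh | apply continuous_const | apply continuous_id].
      - exists y0; split; [exact H2 | exact H1]. }
    (* The square is maximised one variable at a time. The maximising ordinate [Y x] may jump; only
       the partial maximum [h x (Y x)] is continuous in [x], by uniform continuity of [h]. *)
    set (Y := fun x => proj1_sig (constructive_indefinite_description _ (Hsec x))).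
    assert (HY : forall x, -1 <= Y x <= 1 /\ forall y, -1 <= y <= 1 -> h x y <= h x (Y x))
      by (intros x; exact (proj2_sig (constructive_indefinite_description _ (Hsec x)))).
    clearbody Y.
    destruct (continuity_ab_maj (fun x => h x (Y x)) (-1) 1) as [x0 [H1 H2]]; [lra| |].
    - intros c Hc. apply continuity_pt_locally. intros eps.
      destruct (uniform_continuity_2d h (c - 1) (c + 1) (-1) 1) with eps as [d Hd].
      { intros; apply Hh. }
      assert (Hd1 : 0 < Rmin d 1) by (apply Rmin_glb_lt; [apply cond_pos | lra]).
      exists (mkposreal _ Hd1). intros u Hu.
      change (Rabs (u - c) < Rmin d 1) in Hu.
      assert (Hu1 := Rlt_le_trans _ _ _ Hu (Rmin_l _ _)).
      assert (Hu2 := Rlt_le_trans _ _ _ Hu (Rmin_r _ _)).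
      apply Rabs_def2 in Hu2.
      assert (Hz : forall y, Rabs (y - y) < d)
        by (intros; replace (y - y) with 0 by ring; rewrite Rabs_R0; apply cond_pos).
      destruct (HY u) as [Yu1 Yu2]. destruct (HY c) as [Yc1 Yc2].
      assert (A1 := Hd c (Y u) u (Y u) ltac:(lra) Yu1 ltac:(lra) Yu1 Hu1 (Hz _)).
      assert (A2 := Hd c (Y c) u (Y c) ltac:(lra) Yc1 ltac:(lra) Yc1 Hu1 (Hz _)).
      specialize (Yu2 (Y c) Yc1). specialize (Yc2 (Y u) Yu1).
      apply Rabs_def2 in A1. apply Rabs_def2 in A2. apply Rabs_def1; lra.
    - exists x0, (Y x0). intros x y Hx Hy.
      apply Rle_trans with (h x (Y x)); [now apply HY | now apply H1]. }
  destruct Hin as [x0 [y0 Hmax]].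
  exists (x0 * k x0 y0), (y0 * k x0 y0). split; [apply Hk2|].
  intros x y H. change (g x y <= h x0 y0).
  replace (g x y) with (h x y).
  - assert (rho * rho <= 1) by nra. apply Hmax; nra.
  - unfold h. now rewrite (Hk1 x y H), !Rmult_1_r.
Qed.

(** * Integrals over rotations of a point *)


(** The partial derivatives are arguments rather than values of [Derive], so that explicit formulas
    and integrals can be supplied for them and nothing is said outside the disk. *)
Definition C1d (g gx gy : R -> R -> R) : Prop :=
  forall x y, disk x y ->
    is_derive (fun t => g t y) x (gx x y) /\ is_derive (fun t => g x t) y (gy x y) /\
    continuity_2d_pt gx x y /\ continuity_2d_pt gy x y.

Lemma C1d_differentiable (g gx gy : R -> R -> R) (x y : R) :
  C1d g gx gy -> disk x y -> differentiable_pt_lim g x y (gx x y) (gy x y).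
Proof.
  intros H Hd. apply filterdiff_differentiable_pt_lim.
  apply (is_derive_filterdiff g x y gx (gy x y)).
  - destruct (disk_locally x y Hd) as [d Hl].
    exists d; intros [u v] [H1 H2]. simpl. apply H, Hl; assumption.
  - now apply H.
  - apply continuity_2d_pt_filterlim with (f := gx). now apply H.
Qed.

Lemma C1d_cont (g gx gy : R -> R -> R) : C1d g gx gy -> cont_disk g.
Proof.
  intros H x y Hd. apply differentiable_continuity_pt.
  exists (gx x y), (gy x y). now apply C1d_differentiable.
Qed.

Lemma C1d_cont_x (g gx gy : R -> R -> R) : C1d g gx gy -> cont_disk gx.
Proof. intros H x y Hd. now apply H. Qed.

Lemma C1d_cont_y (g gx gy : R -> R -> R) : C1d g gx gy -> cont_disk gy.
Proof. intros H x y Hd. now apply H. Qed.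

(** Chain rule along a line. General directions are needed twice: rotations turn the coordinate
    directions, and the gradient bound is proved direction by direction. *)
Lemma C1d_derive_line (g gx gy : R -> R -> R) (p1 p2 e1 e2 s : R) :
  C1d g gx gy -> disk (p1 + s * e1) (p2 + s * e2) ->
  is_derive (fun s => g (p1 + s * e1) (p2 + s * e2)) s
    (gx (p1 + s * e1) (p2 + s * e2) * e1 + gy (p1 + s * e1) (p2 + s * e2) * e2).
Proof.
  intros H Hd. apply is_derive_Reals.
  apply (derivable_pt_lim_comp_2d g (fun s => p1 + s * e1) (fun s => p2 + s * e2)).
  - now apply C1d_differentiable.
  - apply is_derive_Reals. auto_derive; [trivial | ring].
  - apply is_derive_Reals. auto_derive; [trivial | ring].
Qed.

Lemma C1d_lin (a b : R) (g gx gy h hx hy : R -> R -> R) :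
  C1d g gx gy -> C1d h hx hy ->
  C1d (fun x y => a * g x y + b * h x y) (fun x y => a * gx x y + b * hx x y)
      (fun x y => a * gy x y + b * hy x y).
Proof.
  intros Hg Hh x y Hd.
  destruct (Hg x y Hd) as [G1 [G2 [G3 G4]]]. destruct (Hh x y Hd) as [H1 [H2 [H3 H4]]].
  split; [|split; [|split]].
  - apply (is_derive_plus (V := R_NormedModule)); apply (is_derive_scal (fun t => _)); assumption.
  - apply (is_derive_plus (V := R_NormedModule)); apply (is_derive_scal (fun t => _)); assumption.
  - apply continuity_2d_pt_plus; (apply continuity_2d_pt_mult; [apply continuity_2d_pt_const|assumption]).
  - apply continuity_2d_pt_plus; (apply continuity_2d_pt_mult; [apply continuity_2d_pt_const|assumption]).
Qed.

Lemma C1d_ext (g gx gy h hx hy : R -> R -> R) :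
  (forall x y, g x y = h x y) -> (forall x y, gx x y = hx x y) -> (forall x y, gy x y = hy x y) ->
  C1d g gx gy -> C1d h hx hy.
Proof.
  intros E Ex Ey H x y Hd. destruct (H x y Hd) as [H1 [H2 [H3 H4]]].
  rewrite <- Ex, <- Ey. split; [|split; [|split]].
  - now apply is_derive_ext with (2 := H1).
  - now apply is_derive_ext with (2 := H2).
  - now apply continuity_2d_pt_ext with (2 := H3).
  - now apply continuity_2d_pt_ext with (2 := H4).
Qed.

(** A superposition of rotated copies of [g] with weight [phi]: a convolution over the rotation
    group, read as a function of the point. *)
Definition circ_int (g : R -> R -> R) (phi : R -> R) (x y : R) : R :=
  RInt (fun t => g (rot_x x y t) (rot_y x y t) * phi t) 0 (2 * PI).

Lemma circ_int_cont1 (g : R -> R -> R) (phi : R -> R) (x y t : R) :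
  cont_disk g -> (forall t, continuous phi t) -> disk x y ->
  continuous (fun t => g (rot_x x y t) (rot_y x y t) * phi t) t.
Proof.
  intros Hg Hp Hd. apply (continuous_mult (K := R_AbsRing)); [|apply Hp].
  now apply cont_disk_rot.
Qed.

Lemma circ_int_ex (g : R -> R -> R) (phi : R -> R) (x y : R) :
  cont_disk g -> (forall t, continuous phi t) -> disk x y ->
  ex_RInt (fun t => g (rot_x x y t) (rot_y x y t) * phi t) 0 (2 * PI).
Proof.
  intros. apply (ex_RInt_continuous (V := R_CompleteNormedModule)). intros. now apply circ_int_cont1.
Qed.

Lemma two_PI_pos : 0 < 2 * PI.
Proof. assert (H := PI_RGT_0). lra. Qed.

Lemma continuous_bounded (phi : R -> R) (a b : R) :
  a <= b -> (forall t, continuous phi t) ->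
  exists B, 0 < B /\ forall t, a <= t <= b -> Rabs (phi t) <= B.
Proof.
  intros Hab Hp.
  destruct (continuity_ab_maj (fun t => Rabs (phi t)) a b Hab) as [m [Hm _]].
  { intros c _. apply (continuity_pt_comp phi Rabs).
    - apply continuity_pt_filterlim, Hp.
    - apply Rcontinuity_abs. }
  exists (Rabs (phi m) + 1). split; [assert (H := Rabs_pos (phi m)); lra|].
  intros t Ht. specialize (Hm t Ht). lra.
Qed.

Lemma rot_diff (x y u v t d : R) :
  Rabs (u - x) < d / 2 -> Rabs (v - y) < d / 2 ->
  Rabs (rot_x u v t - rot_x x y t) < d /\ Rabs (rot_y u v t - rot_y x y t) < d.
Proof.
  intros H1 H2. unfold rot_x, rot_y.
  assert (Hc := COS_bound t). assert (Hs := SIN_bound t).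
  assert (P : forall a c, Rabs a < d / 2 -> -1 <= c <= 1 -> Rabs (a * c) < d / 2).
  { intros a c Ha Hc'. rewrite Rabs_mult. apply Rle_lt_trans with (2 := Ha).
    assert (Rabs c <= 1) by (apply Rabs_le; exact Hc').
    assert (Ha0 := Rabs_pos a). nra. }
  assert (A1 := Rabs_def2 _ _ (P _ _ H1 Hc)). assert (A2 := Rabs_def2 _ _ (P _ _ H1 Hs)).
  assert (A3 := Rabs_def2 _ _ (P _ _ H2 Hc)). assert (A4 := Rabs_def2 _ _ (P _ _ H2 Hs)).
  split; apply Rabs_def1; lra.
Qed.

Lemma circ_int_cont (g : R -> R -> R) (phi : R -> R) :
  cont_disk g -> (forall t, continuous phi t) -> cont_disk (circ_int g phi).
Proof.
  intros Hg Hp x y Hd eps.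
  assert (Hpi := two_PI_pos).
  destruct (continuous_bounded phi 0 (2 * PI)) as [B [HB0 HB]]; [lra|exact Hp|].
  set (q := x * x + y * y).
  assert (Hq : 0 <= q < 1) by (unfold q, disk in *; split; [nra|lra]).
  (* The squared radius is the midpoint of [q] and 1, so a neighbourhood of the point stays in a
     closed disk where uniform continuity holds; rotations preserve that disk. *)
  set (rho := sqrt ((1 + q) / 2)).
  assert (Hrr : rho * rho = (1 + q) / 2) by (apply sqrt_sqrt; lra).
  assert (Hr0 : 0 < rho) by (apply sqrt_lt_R0; lra).
  assert (Hr : 0 < rho < 1) by nra.
  assert (He : 0 < eps / (2 * (2 * PI * B))).
  { apply Rdiv_lt_0_compat; [apply cond_pos|].
    apply Rmult_lt_0_compat; [lra | now apply Rmult_lt_0_compat]. }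
  destruct (heine_disk g rho Hr Hg (mkposreal _ He)) as [d1 Hd1].
  assert (Hloc : locally_2d (fun u v => u * u + v * v < rho * rho) x y).
  { assert (Hc : continuity_2d_pt (fun u v => u * u + v * v) x y).
    { apply continuity_2d_pt_plus; apply continuity_2d_pt_mult;
        first [apply continuity_2d_pt_id1 | apply continuity_2d_pt_id2]. }
    assert (He2 : 0 < rho * rho - q) by lra.
    destruct (Hc (mkposreal _ He2)) as [d Hdd].
    exists d; intros u v Hu Hv. specialize (Hdd u v Hu Hv); simpl in Hdd.
    apply Rabs_def2 in Hdd. unfold q in Hdd. lra. }
  destruct Hloc as [d2 Hd2].
  assert (Hdd : 0 < Rmin (d1 / 2) d2).
  { assert (H1 := cond_pos d1). apply Rmin_glb_lt; [lra | apply cond_pos]. }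
  exists (mkposreal _ Hdd); simpl. intros u v Hu Hv.
  assert (Huv : u * u + v * v < rho * rho)
    by (apply Hd2; eapply Rlt_le_trans; eauto; apply Rmin_r).
  assert (Hu' : Rabs (u - x) < d1 / 2) by (eapply Rlt_le_trans; eauto; apply Rmin_l).
  assert (Hv' : Rabs (v - y) < d1 / 2) by (eapply Rlt_le_trans; eauto; apply Rmin_l).
  assert (Hduv : disk u v) by (apply (disk_of_radius _ _ rho); lra).
  unfold circ_int.
  rewrite <- (RInt_minus (V := R_CompleteNormedModule)) by now apply circ_int_ex.
  eapply Rle_lt_trans.
  - apply (abs_RInt_le_const _ 0 (2 * PI) (eps / (2 * (2 * PI * B)) * B)); [lra| |].
    + apply (ex_RInt_minus (V := R_NormedModule)); now apply circ_int_ex.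
    + intros t Ht. unfold minus, plus, opp; simpl.
      replace (_ + - _) with
        ((g (rot_x u v t) (rot_y u v t) - g (rot_x x y t) (rot_y x y t)) * phi t) by ring.
      rewrite Rabs_mult. apply Rmult_le_compat; [apply Rabs_pos|apply Rabs_pos| |now apply HB].
      apply Rlt_le.
      destruct (rot_diff x y u v t d1 Hu' Hv') as [K1 K2].
      apply (Hd1 (rot_x x y t) (rot_y x y t)); [| |exact K1|exact K2]; rewrite rot_sq; unfold q in *; lra.
  - rewrite Rminus_0_r. replace (2 * PI * (eps / (2 * (2 * PI * B)) * B)) with (eps / 2).
    + assert (H1 := cond_pos eps). lra.
    + field. split; [lra|]. assert (H1 := PI_RGT_0). lra.
Qed.

Lemma rot_line (p1 p2 e1 e2 s t : R) :
  rot_x (p1 + s * e1) (p2 + s * e2) t = rot_x p1 p2 t + s * rot_x e1 e2 t /\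
  rot_y (p1 + s * e1) (p2 + s * e2) t = rot_y p1 p2 t + s * rot_y e1 e2 t.
Proof. unfold rot_x, rot_y; split; ring. Qed.

Lemma cont_rot_x (e1 e2 t : R) : continuous (rot_x e1 e2) t.
Proof.
  unfold rot_x. apply (continuous_plus (V := R_NormedModule)); [apply cont_scal_cos | apply cont_scal_sin].
Qed.

Lemma cont_rot_y (e1 e2 t : R) : continuous (rot_y e1 e2) t.
Proof.
  unfold rot_y. apply (continuous_minus (V := R_NormedModule)); [apply cont_scal_cos | apply cont_scal_sin].
Qed.

Lemma cont_mul_rot_x (phi : R -> R) (e1 e2 : R) : (forall t, continuous phi t) ->
  forall t, continuous (fun t => phi t * rot_x e1 e2 t) t.
Proof. intros H t. apply (continuous_mult (K := R_AbsRing)); [apply H | apply cont_rot_x]. Qed.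

Lemma cont_mul_rot_y (phi : R -> R) (e1 e2 : R) : (forall t, continuous phi t) ->
  forall t, continuous (fun t => phi t * rot_y e1 e2 t) t.
Proof. intros H t. apply (continuous_mult (K := R_AbsRing)); [apply H | apply cont_rot_y]. Qed.

Lemma cont_line_rot_2d (g : R -> R -> R) (p1 p2 e1 e2 s t : R) :
  cont_disk g -> disk (p1 + s * e1) (p2 + s * e2) ->
  continuous (fun q : R * R => g (rot_x p1 p2 (snd q) + fst q * rot_x e1 e2 (snd q))
                                 (rot_y p1 p2 (snd q) + fst q * rot_y e1 e2 (snd q))) (s, t).
Proof.
  intros Hg Hd.
  assert (X : forall a b, continuous (fun q : R * R => rot_x a b (snd q)) (s, t))
    by (intros; apply (continuous_comp snd (rot_x a b)); [apply continuous_snd | apply cont_rot_x]).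
  assert (Y : forall a b, continuous (fun q : R * R => rot_y a b (snd q)) (s, t))
    by (intros; apply (continuous_comp snd (rot_y a b)); [apply continuous_snd | apply cont_rot_y]).
  apply (continuous_comp_2d g).
  - simpl. destruct (rot_line p1 p2 e1 e2 s t) as [<- <-]. apply Hg, disk_rot, Hd.
  - apply (continuous_plus (V := R_NormedModule)); [apply X|].
    apply (continuous_mult (K := R_AbsRing)); [apply continuous_fst | apply X].
  - apply (continuous_plus (V := R_NormedModule)); [apply Y|].
    apply (continuous_mult (K := R_AbsRing)); [apply continuous_fst | apply Y].
Qed.

Lemma disk_line_locally (p1 p2 e1 e2 s : R) :
  disk (p1 + s * e1) (p2 + s * e2) -> locally s (fun s => disk (p1 + s * e1) (p2 + s * e2)).
Proof.
  intros Hd. destruct (disk_locally _ _ Hd) as [d Hl].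
  set (m := Rabs e1 + Rabs e2 + 1).
  assert (Hm : 0 < m) by (unfold m; assert (H1 := Rabs_pos e1); assert (H2 := Rabs_pos e2); lra).
  assert (He : 0 < d / m) by (apply Rdiv_lt_0_compat; [apply cond_pos | exact Hm]).
  exists (mkposreal _ He). intros u Hu. change (Rabs (u - s) < d / m) in Hu.
  apply Rlt_div_r in Hu; [|exact Hm].
  assert (H0 := Rabs_pos (u - s)).
  assert (H1 := Rabs_pos e1). assert (H2 := Rabs_pos e2).
  unfold m in Hu.
  apply Hl.
  - replace (p1 + u * e1 - (p1 + s * e1)) with ((u - s) * e1) by ring. rewrite Rabs_mult. nra.
  - replace (p2 + u * e2 - (p2 + s * e2)) with ((u - s) * e2) by ring. rewrite Rabs_mult. nra.
Qed.

(** Rotating a line rotates its direction, so the derivative pairs the gradient at the rotated point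
    with the rotated direction. Absorbing that direction into the weight gives [circ_int]s again,
    and the differentiation can be iterated. *)
Lemma circ_int_derive_line (g gx gy : R -> R -> R) (phi : R -> R) (p1 p2 e1 e2 s : R) :
  C1d g gx gy -> (forall t, continuous phi t) -> disk (p1 + s * e1) (p2 + s * e2) ->
  is_derive (fun s => circ_int g phi (p1 + s * e1) (p2 + s * e2)) s
    (circ_int gx (fun t => phi t * rot_x e1 e2 t) (p1 + s * e1) (p2 + s * e2)
     + circ_int gy (fun t => phi t * rot_y e1 e2 t) (p1 + s * e1) (p2 + s * e2)).
Proof.
  intros Hg Hp Hd.
  (* Rewritten along the rotated line, the integrand's derivative is visibly continuous in both
     variables jointly, as differentiation under the integral requires. *)
  set (D := fun u t : R =>
    (gx (rot_x p1 p2 t + u * rot_x e1 e2 t) (rot_y p1 p2 t + u * rot_y e1 e2 t) * rot_x e1 e2 t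
     + gy (rot_x p1 p2 t + u * rot_x e1 e2 t) (rot_y p1 p2 t + u * rot_y e1 e2 t) * rot_y e1 e2 t)
    * phi t).
  assert (HD : forall u t, disk (p1 + u * e1) (p2 + u * e2) ->
    is_derive (fun u => g (rot_x (p1 + u * e1) (p2 + u * e2) t)
                          (rot_y (p1 + u * e1) (p2 + u * e2) t) * phi t) u (D u t)).
  { intros u t Hu.
    apply is_derive_ext with (fun u => phi t *
      g (rot_x p1 p2 t + u * rot_x e1 e2 t) (rot_y p1 p2 t + u * rot_y e1 e2 t)).
    { intros w. destruct (rot_line p1 p2 e1 e2 w t) as [-> ->]. apply Rmult_comm. }
    unfold D. rewrite Rmult_comm.
    apply (is_derive_scal (fun u => g (rot_x p1 p2 t + u * rot_x e1 e2 t) (rot_y p1 p2 t + u * rot_y e1 e2 t))).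
    apply C1d_derive_line; [exact Hg|].
    destruct (rot_line p1 p2 e1 e2 u t) as [<- <-]. now apply disk_rot. }
  assert (Hloc := disk_line_locally p1 p2 e1 e2 s Hd).
  assert (Hgc := C1d_cont _ _ _ Hg).
  assert (Hgx := C1d_cont_x _ _ _ Hg). assert (Hgy := C1d_cont_y _ _ _ Hg).
  assert (HI : is_derive (fun s => circ_int g phi (p1 + s * e1) (p2 + s * e2)) s
    (RInt (fun t => Derive (fun u => g (rot_x (p1 + u * e1) (p2 + u * e2) t)
                          (rot_y (p1 + u * e1) (p2 + u * e2) t) * phi t) s) 0 (2 * PI))).
  { apply (is_derive_RInt_param (fun s t => g (rot_x (p1 + s * e1) (p2 + s * e2) t)
                          (rot_y (p1 + s * e1) (p2 + s * e2) t) * phi t)).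
    - apply filter_imp with (2 := Hloc). intros u Hu t _. exists (D u t). now apply HD.
    - intros t _.
      apply continuity_2d_pt_ext_loc with D.
      + destruct Hloc as [d Hl]. exists d. intros u v Hu _. symmetry.
        apply is_derive_unique, HD, Hl. exact Hu.
      + apply (continuous_2d (fun q => D (fst q) (snd q))). unfold D.
        assert (X : forall a b, continuous (fun q : R * R => rot_x a b (snd q)) (s, t))
          by (intros; apply (continuous_comp snd (rot_x a b)); [apply continuous_snd | apply cont_rot_x]).
        assert (Y : forall a b, continuous (fun q : R * R => rot_y a b (snd q)) (s, t))
          by (intros; apply (continuous_comp snd (rot_y a b)); [apply continuous_snd | apply cont_rot_y]).
        apply (continuous_mult (K := R_AbsRing)).
        * apply (continuous_plus (V := R_NormedModule)); apply (continuous_mult (K := R_AbsRing));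
            [now apply cont_line_rot_2d | apply X | now apply cont_line_rot_2d | apply Y].
        * apply (continuous_comp snd phi); [apply continuous_snd | apply Hp].
    - apply filter_imp with (2 := Hloc). intros u Hu. now apply circ_int_ex. }
  replace (circ_int gx _ _ _ + circ_int gy _ _ _) with
    (RInt (fun t => Derive (fun u => g (rot_x (p1 + u * e1) (p2 + u * e2) t)
                          (rot_y (p1 + u * e1) (p2 + u * e2) t) * phi t) s) 0 (2 * PI)); [exact HI|].
  unfold circ_int.
  rewrite <- (RInt_plus (V := R_CompleteNormedModule));
    [|apply circ_int_ex; auto using cont_mul_rot_x, cont_mul_rot_y
     |apply circ_int_ex; auto using cont_mul_rot_x, cont_mul_rot_y].
  apply RInt_ext. intros t _. apply eq_trans with (1 := is_derive_unique _ _ _ (HD s t Hd)).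
  unfold D, plus; simpl. destruct (rot_line p1 p2 e1 e2 s t) as [-> ->]. ring.
Qed.

Lemma circ_int_C1d (g gx gy : R -> R -> R) (phi : R -> R) :
  C1d g gx gy -> (forall t, continuous phi t) ->
  C1d (circ_int g phi)
    (fun x y => circ_int gx (fun t => phi t * rot_x 1 0 t) x y
                + circ_int gy (fun t => phi t * rot_y 1 0 t) x y)
    (fun x y => circ_int gx (fun t => phi t * rot_x 0 1 t) x y
                + circ_int gy (fun t => phi t * rot_y 0 1 t) x y).
Proof.
  intros Hg Hp x y Hd.
  assert (Hgx := C1d_cont_x _ _ _ Hg). assert (Hgy := C1d_cont_y _ _ _ Hg).
  assert (Ex : forall s, 0 + s * 1 = s) by (intros; ring).
  assert (E0 : forall p s, p + s * 0 = p) by (intros; ring).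
  split; [|split; [|split]].
  - assert (H := circ_int_derive_line g gx gy phi 0 y 1 0 x Hg Hp).
    rewrite Ex, E0 in H. specialize (H Hd).
    apply is_derive_ext with (2 := H). intros s. now rewrite Ex, E0.
  - assert (H := circ_int_derive_line g gx gy phi x 0 0 1 y Hg Hp).
    rewrite Ex, E0 in H. specialize (H Hd).
    apply is_derive_ext with (2 := H). intros s. now rewrite Ex, E0.
  - apply continuity_2d_pt_plus; apply circ_int_cont; auto using cont_mul_rot_x, cont_mul_rot_y.
  - apply continuity_2d_pt_plus; apply circ_int_cont; auto using cont_mul_rot_x, cont_mul_rot_y.
Qed.

(** * The equation and its maximum principle *)


(* The operator [T_alpha] multiplied by [4 (1-|z|^2)^(alpha+1)]. *)
Definition pde_sol (alpha : R) (g : R -> R -> R) : Prop :=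
  exists gx gy gxx gxy gyx gyy : R -> R -> R,
    C1d g gx gy /\ C1d gx gxx gxy /\ C1d gy gyx gyy /\
    forall x y, disk x y ->
      (1 - (x * x + y * y)) * (gxx x y + gyy x y) + 2 * alpha * (x * gx x y + y * gy x y)
      - alpha * alpha * g x y = 0.

Lemma pde_sol_cont (alpha : R) (g : R -> R -> R) : pde_sol alpha g -> cont_disk g.
Proof. intros (gx & gy & _ & _ & _ & _ & H & _). exact (C1d_cont _ _ _ H). Qed.

Lemma pde_sol_lin (alpha a b : R) (g h : R -> R -> R) :
  pde_sol alpha g -> pde_sol alpha h -> pde_sol alpha (fun x y => a * g x y + b * h x y).
Proof.
  intros (gx & gy & gxx & gxy & gyx & gyy & G1 & G2 & G3 & G4)
         (hx & hy & hxx & hxy & hyx & hyy & H1 & H2 & H3 & H4).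
  do 6 eexists. split; [exact (C1d_lin a b _ _ _ _ _ _ G1 H1)|].
  split; [exact (C1d_lin a b _ _ _ _ _ _ G2 H2)|].
  split; [exact (C1d_lin a b _ _ _ _ _ _ G3 H3)|].
  intros x y Hd. specialize (G4 x y Hd). specialize (H4 x y Hd). simpl.
  transitivity (a * ((1 - (x * x + y * y)) * (gxx x y + gyy x y)
      + 2 * alpha * (x * gx x y + y * gy x y) - alpha * alpha * g x y)
    + b * ((1 - (x * x + y * y)) * (hxx x y + hyy x y)
      + 2 * alpha * (x * hx x y + y * hy x y) - alpha * alpha * h x y)); [ring|].
  rewrite G4, H4. ring.
Qed.

Lemma pde_sol_circ_int (alpha : R) (g : R -> R -> R) (phi : R -> R) :
  pde_sol alpha g -> (forall t, continuous phi t) -> pde_sol alpha (circ_int g phi).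
Proof.
  intros (gx & gy & gxx & gxy & gyx & gyy & G1 & G2 & G3 & G4) Hp.
  assert (Hx := fun a b => cont_mul_rot_x phi a b Hp).
  assert (Hy := fun a b => cont_mul_rot_y phi a b Hp).
  assert (Lin : forall f k fx fy kx ky, C1d f fx fy -> C1d k kx ky ->
    C1d (fun x y => f x y + k x y) (fun x y => fx x y + kx x y) (fun x y => fy x y + ky x y)).
  { intros f k fx fy kx ky A B. assert (L := C1d_lin 1 1 _ _ _ _ _ _ A B).
    revert L. apply C1d_ext; intros; ring. }
  do 6 eexists.
  split; [exact (circ_int_C1d _ _ _ _ G1 Hp)|].
  split; [exact (Lin _ _ _ _ _ _ (circ_int_C1d _ _ _ _ G2 (Hx 1 0)) (circ_int_C1d _ _ _ _ G3 (Hy 1 0)))|].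
  split; [exact (Lin _ _ _ _ _ _ (circ_int_C1d _ _ _ _ G2 (Hx 0 1)) (circ_int_C1d _ _ _ _ G3 (Hy 0 1)))|].
  intros x y Hd. simpl.
  assert (Cg := C1d_cont _ _ _ G1). assert (Cx := C1d_cont _ _ _ G2). assert (Cy := C1d_cont _ _ _ G3).
  assert (Cxx := C1d_cont_x _ _ _ G2). assert (Cxy := C1d_cont_y _ _ _ G2).
  assert (Cyx := C1d_cont_x _ _ _ G3). assert (Cyy := C1d_cont_y _ _ _ G3).
  assert (Hi : forall k psi, cont_disk k -> (forall t, continuous psi t) ->
    is_RInt (fun t => k (rot_x x y t) (rot_y x y t) * psi t) 0 (2 * PI) (circ_int k psi x y)).
  { intros k psi Hk Hps. apply (RInt_correct (V := R_CompleteNormedModule)). now apply circ_int_ex. }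
  assert (P : forall f1 f2 l1 l2, is_RInt f1 0 (2 * PI) l1 -> is_RInt f2 0 (2 * PI) l2 ->
    is_RInt (fun t => f1 t + f2 t) 0 (2 * PI) (l1 + l2))
    by (intros; now apply (is_RInt_plus (V := R_NormedModule))).
  assert (S : forall c f1 l1, is_RInt f1 0 (2 * PI) l1 -> is_RInt (fun t => c * f1 t) 0 (2 * PI) (c * l1))
    by (intros; now apply (is_RInt_scal (V := R_NormedModule))).
  (* By linearity the left-hand side is a single integral over [t]. Its integrand is [phi t] times
     the equation at the rotated point, hence zero: the mixed derivatives cancel and the pure ones
     recombine by [sin^2 + cos^2 = 1]. *)
  match goal with |- ?e = 0 => set (E := e) end.
  assert (HE : is_RInt (fun _ => 0) 0 (2 * PI) E).
  { unfold E, Rminus. rewrite Ropp_mult_distr_l.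
    eapply is_RInt_ext; [|
      apply P; [apply P; [apply S, P; apply P; apply P; apply Hi; eauto using cont_mul_rot_x, cont_mul_rot_y |
                          apply S, P; apply S, P; apply Hi; auto ] | apply S, Hi; auto ]].
    intros t _. simpl.
    assert (Q := G4 _ _ (disk_rot x y t Hd)). rewrite rot_sq in Q.
    assert (Q1 := sin2_cos2 t). unfold Rsqr in Q1.
    set (a := gxx _ _) in *. set (b := gyy _ _) in *. set (c := gx _ _) in *. set (d := gy _ _) in *.
    set (e := g _ _) in *.
    transitivity (phi t * ((1 - (x * x + y * y)) * (a + b) * (sin t * sin t + cos t * cos t)
      + 2 * alpha * (rot_x x y t * c + rot_y x y t * d) - alpha * alpha * e)).
    - unfold rot_x, rot_y. ring.
    - rewrite Q1, Rmult_1_r, Q. ring. }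
  apply (is_RInt_unique (V := R_CompleteNormedModule)) in HE.
  rewrite <- HE. rewrite (RInt_const (V := R_CompleteNormedModule)).
  unfold scal; simpl; unfold mult; simpl. ring.
Qed.

Lemma second_derivative_max (h h1 : R -> R) (s0 h2 d : R) :
  0 < d ->
  (forall s, Rabs (s - s0) < d -> is_derive h s (h1 s)) ->
  is_derive h1 s0 h2 ->
  (forall s, Rabs (s - s0) < d -> h s <= h s0) ->
  h1 s0 = 0 /\ h2 <= 0.
Proof.
  intros Hd Hh Hh1 Hm.
  assert (H0 : h1 s0 = 0).
  { assert (D : derivable_pt_lim h s0 (h1 s0)).
    { apply is_derive_Reals, Hh. replace (s0 - s0) with 0 by ring. now rewrite Rabs_R0. }
    apply (uniqueness_limite h s0); [exact D|].
    set (pr := exist (fun l => derivable_pt_lim h s0 l) (h1 s0) D : derivable_pt h s0).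
    rewrite <- (deriv_maximum h (s0 - d) (s0 + d) s0 pr).
    - exact D.
    - lra.
    - lra.
    - intros x H1 H2. apply Hm, Rabs_def1; lra. }
  split; [exact H0|].
  (* If [h2] were positive, [h1] would be positive just to the right of [s0], and the mean value
     theorem would make [h] exceed its maximum. *)
  destruct (Rle_or_lt h2 0) as [?|Hpos]; [assumption|exfalso].
  apply is_derive_Reals in Hh1.
  destruct (Hh1 (h2 / 2)) as [d1 Hd1]; [lra|].
  set (m := Rmin d d1 / 2).
  assert (Hmin : 0 < Rmin d d1) by (apply Rmin_glb_lt; [exact Hd | apply cond_pos]).
  assert (Hml := Rmin_l d d1). assert (Hmr := Rmin_r d d1).
  assert (Hmpos : 0 < m < Rmin d d1) by (unfold m; lra).
  destruct (MVT_cor2 h h1 s0 (s0 + m)) as [c [Hc1 Hc2]]; [lra| |].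
  { intros c Hc. apply is_derive_Reals, Hh, Rabs_def1; lra. }
  assert (h (s0 + m) <= h s0) by (apply Hm, Rabs_def1; lra).
  assert (Hcp : 0 < h1 c).
  { specialize (Hd1 (c - s0)). replace (s0 + (c - s0)) with c in Hd1 by ring.
    rewrite H0, Rminus_0_r in Hd1.
    assert (HH : Rabs (h1 c / (c - s0) - h2) < h2 / 2) by (apply Hd1; [lra|apply Rabs_def1; lra]).
    apply Rabs_def2 in HH.
    replace (h1 c) with (h1 c / (c - s0) * (c - s0)) by (field; lra).
    apply Rmult_lt_0_compat; lra. }
  nra.
Qed.

(** The quadratic term is the trace on a coordinate line of the perturbation by [e |z|^2] in the
    maximum principle. *)
Lemma second_derivative_max_quad (g g1 : R -> R) (s0 g2 e d : R) :
  0 < d ->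
  (forall s, Rabs (s - s0) < d -> is_derive g s (g1 s)) ->
  is_derive g1 s0 g2 ->
  (forall s, Rabs (s - s0) < d -> g s + e * (s * s) <= g s0 + e * (s0 * s0)) ->
  g1 s0 + 2 * e * s0 = 0 /\ g2 + 2 * e <= 0.
Proof.
  intros Hd Hg Hg1 Hm.
  apply (second_derivative_max (fun s => g s + e * (s * s)) (fun s => g1 s + 2 * e * s) s0 _ d Hd).
  - intros s Hs. apply (is_derive_plus (V := R_NormedModule)); [now apply Hg|].
    auto_derive; [trivial|ring].
  - apply (is_derive_plus (V := R_NormedModule)); [exact Hg1|].
    auto_derive; [trivial|ring].
  - exact Hm.
Qed.

(* For [alpha <> 0] the zeroth order coefficient of the operator is negative and
   an interior positive maximum is impossible; for [alpha = 0] the function is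
   first perturbed by a multiple of [|z|^2]. *)
Lemma max_principle (alpha rho : R) (w : R -> R -> R) :
  0 < rho < 1 -> pde_sol alpha w ->
  (forall x y, x * x + y * y = rho * rho -> w x y = 0) ->
  forall x y, x * x + y * y <= rho * rho -> w x y <= 0.
Proof.
  intros Hr Hw Hb px py Hp.
  destruct (Rle_or_lt (w px py) 0) as [?|Hpos]; [assumption|exfalso].
  (* With half the supposed positive value, the perturbed function is at most [e] on the circle,
     still below its value at the point [px], [py]; so its maximum is attained inside. *)
  set (e := if Req_EM_T alpha 0 then w px py / 2 else 0).
  assert (He : 0 <= e < w px py) by (unfold e; destruct Req_EM_T; lra).
  destruct (max_disk (fun x y => w x y + e * (x * x + y * y)) rho Hr) as [x [y [Hxy Hmax]]].
  { intros x y Hd. apply continuity_2d_pt_plus; [exact (pde_sol_cont _ _ Hw x y Hd)|].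
    apply continuity_2d_pt_mult; [apply continuity_2d_pt_const|].
    apply continuity_2d_pt_plus; apply continuity_2d_pt_mult;
        first [apply continuity_2d_pt_id1 | apply continuity_2d_pt_id2]. }
  assert (Hv : w px py <= w x y + e * (x * x + y * y)).
  { apply Rle_trans with (2 := Hmax px py Hp).
    assert (0 <= e * (px * px + py * py)) by (apply Rmult_le_pos; [lra|nra]). lra. }
  destruct (Req_dec (x * x + y * y) (rho * rho)) as [Heq|Hne].
  { rewrite (Hb x y Heq), Heq in Hv. assert (rho * rho <= 1) by nra. nra. }
  assert (Hd : disk x y) by (apply (disk_of_radius _ _ rho); lra).
  assert (Hloc : exists d : posreal, forall u v, Rabs (u - x) < d -> Rabs (v - y) < d ->
            u * u + v * v <= rho * rho).
  { assert (Hc : continuity_2d_pt (fun u v => u * u + v * v) x y).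
    { apply continuity_2d_pt_plus; apply continuity_2d_pt_mult;
        first [apply continuity_2d_pt_id1 | apply continuity_2d_pt_id2]. }
    assert (He2 : 0 < rho * rho - (x * x + y * y)) by lra.
    destruct (Hc (mkposreal _ He2)) as [d Hdd].
    exists d; intros u v Hu Hv'. specialize (Hdd u v Hu Hv'); simpl in Hdd.
    apply Rabs_def2 in Hdd. lra. }
  destruct Hloc as [d Hloc].
  assert (Hz : forall p, Rabs (p - p) < d)
    by (intros p; replace (p - p) with 0 by ring; rewrite Rabs_R0; apply cond_pos).
  destruct Hw as (gx & gy & gxx & gxy & gyx & gyy & G1 & G2 & G3 & G4).
  destruct (second_derivative_max_quad (fun s => w s y) (fun s => gx s y) x (gxx x y) e d
              (cond_pos d)) as [X1 X2].
  { intros s Hs. apply G1, (disk_of_radius _ _ rho); [lra|]. now apply Hloc. }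
  { now apply G2. }
  { intros s Hs. assert (M := Hmax s y (Hloc s y Hs (Hz y))). simpl in M. lra. }
  destruct (second_derivative_max_quad (fun s => w x s) (fun s => gy x s) y (gyy x y) e d
              (cond_pos d)) as [Y1 Y2].
  { intros s Hs. apply G1, (disk_of_radius _ _ rho); [lra|]. now apply Hloc. }
  { now apply G3. }
  { intros s Hs. assert (M := Hmax x s (Hloc x s (Hz x) Hs)). simpl in M. lra. }
  specialize (G4 x y Hd). unfold disk in Hd.
  unfold e in *. destruct (Req_EM_T alpha 0) as [Ha|Ha].
  - rewrite Ha in G4.
    assert (gxx x y + gyy x y < 0) by lra.
    assert ((1 - (x * x + y * y)) * (gxx x y + gyy x y) = 0) by lra. nra.
  - assert (Hgx : gx x y = 0) by lra. assert (Hgy : gy x y = 0) by lra.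
    rewrite Hgx, Hgy in G4.
    assert (0 < alpha * alpha) by (apply Rlt_0_sqr; exact Ha).
    assert (0 < w x y) by lra.
    assert (0 < alpha * alpha * w x y) by now apply Rmult_lt_0_compat.
    assert ((1 - (x * x + y * y)) * (gxx x y + gyy x y) <= 0) by nra.
    lra.
Qed.

Lemma dirichlet_unique (alpha rho : R) (g h : R -> R -> R) :
  0 < rho < 1 -> pde_sol alpha g -> pde_sol alpha h ->
  (forall x y, x * x + y * y = rho * rho -> g x y = h x y) ->
  forall x y, x * x + y * y <= rho * rho -> g x y = h x y.
Proof.
  intros Hr Hg Hh Hb x y Hp.
  assert (A := max_principle alpha rho _ Hr (pde_sol_lin alpha 1 (-1) _ _ Hg Hh)
    ltac:(intros u v Huv; cbv beta; rewrite (Hb u v Huv); ring) x y Hp).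
  assert (B := max_principle alpha rho _ Hr (pde_sol_lin alpha 1 (-1) _ _ Hh Hg)
    ltac:(intros u v Huv; cbv beta; rewrite (Hb u v Huv); ring) x y Hp).
  simpl in A, B. lra.
Qed.

(** * The kernel *)


(** The kernel without [c_const], as the exponential of logarithms of polynomials in [x] and [y]:
    the power of [|1-z|] becomes half that power of [|1-z|^2], which is easy to differentiate. *)
Definition ker (alpha x y : R) : R :=
  exp ((alpha + 1) * ln (1 - (x * x + y * y))
       - (alpha / 2 + 1) * ln ((1 - x) * (1 - x) + y * y)).

Lemma disk_den_pos (x y : R) : disk x y -> 0 < (1 - x) * (1 - x) + y * y.
Proof. unfold disk; intros H. assert (x < 1) by nra. nra. Qed.

Ltac cont_2d :=
  repeat first
   [ assumption
   | apply continuity_2d_pt_const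
   | apply continuity_2d_pt_id1
   | apply continuity_2d_pt_id2
   | apply continuity_2d_pt_plus
   | apply continuity_2d_pt_minus
   | apply continuity_2d_pt_opp
   | apply continuity_2d_pt_mult
   | apply continuity_2d_pt_inv ].

Lemma ker_cont (alpha : R) : cont_disk (ker alpha).
Proof.
  intros x y Hd. assert (Hq := disk_den_pos x y Hd).
  unfold ker, disk in *.
  apply (continuity_1d_2d_pt_comp exp (fun x y => (alpha + 1) * ln (1 - (x * x + y * y))
       - (alpha / 2 + 1) * ln ((1 - x) * (1 - x) + y * y))).
  { apply derivable_continuous_pt, derivable_pt_exp. }
  cont_2d.
  - apply (continuity_1d_2d_pt_comp ln (fun x y => 1 - (x * x + y * y))); [|cont_2d].
    apply continuity_pt_filterlim, continuous_ln. lra.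
  - apply (continuity_1d_2d_pt_comp ln (fun x y => (1 - x) * (1 - x) + y * y)); [|cont_2d].
    apply continuity_pt_filterlim, continuous_ln. lra.
Qed.

Lemma pde_sol_ker (alpha : R) : pde_sol alpha (ker alpha).
Proof.
  set (p := fun x y : R => 1 - (x * x + y * y)).
  set (q := fun x y : R => (1 - x) * (1 - x) + y * y).
  (* [A] and [B] are the logarithmic derivatives of the kernel in [x] and [y]. Their own derivatives
     are [Ax], [Ay], [By], where [Ay] serves for both mixed ones. *)
  set (A := fun x y => - (2 * (alpha + 1) * x) * / p x y + (alpha + 2) * (1 - x) * / q x y).
  set (B := fun x y => - (2 * (alpha + 1) * y) * / p x y - (alpha + 2) * y * / q x y).
  set (Ax := fun x y => - (2 * (alpha + 1)) * / p x y - 4 * (alpha + 1) * (x * x) * / (p x y * p x y)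
     - (alpha + 2) * / q x y + 2 * (alpha + 2) * ((1 - x) * (1 - x)) * / (q x y * q x y)).
  set (Ay := fun x y => - (4 * (alpha + 1) * (x * y) * / (p x y * p x y))
     - 2 * (alpha + 2) * ((1 - x) * y) * / (q x y * q x y)).
  set (By := fun x y => - (2 * (alpha + 1)) * / p x y - 4 * (alpha + 1) * (y * y) * / (p x y * p x y)
     - (alpha + 2) * / q x y + 2 * (alpha + 2) * (y * y) * / (q x y * q x y)).
  exists (fun x y => ker alpha x y * A x y), (fun x y => ker alpha x y * B x y),
    (fun x y => ker alpha x y * (A x y * A x y + Ax x y)),
    (fun x y => ker alpha x y * (A x y * B x y + Ay x y)),
    (fun x y => ker alpha x y * (A x y * B x y + Ay x y)),
    (fun x y => ker alpha x y * (B x y * B x y + By x y)).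
  assert (Hp : forall x y, disk x y -> 0 < p x y) by (unfold p, disk; intros; lra).
  assert (Hq : forall x y, disk x y -> 0 < q x y) by (intros; now apply disk_den_pos).
  assert (Kx : forall x y, disk x y -> is_derive (fun t => ker alpha t y) x (ker alpha x y * A x y)).
  { intros x y Hd. specialize (Hp x y Hd). specialize (Hq x y Hd). unfold ker, A, p, q in *.
    auto_derive; [repeat split; lra|]. unfold Rminus. set (e := exp _). field. lra. }
  assert (Ky : forall x y, disk x y -> is_derive (fun t => ker alpha x t) y (ker alpha x y * B x y)).
  { intros x y Hd. specialize (Hp x y Hd). specialize (Hq x y Hd). unfold ker, B, p, q in *.
    auto_derive; [repeat split; lra|]. unfold Rminus. set (e := exp _). field. lra. }
  assert (Mul : forall (k a : R -> R) s k1 a1, is_derive k s (k s * k1) -> is_derive a s a1 ->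
     is_derive (fun t => k t * a t) s (k s * (k1 * a s + a1))).
  { intros k a s k1 a1 H1 H2.
    replace (k s * (k1 * a s + a1)) with (k s * k1 * a s + k s * a1) by ring.
    apply (is_derive_mult (K := R_AbsRing)); [assumption|assumption|intros; apply Rmult_comm]. }
  assert (Cp : forall x y, continuity_2d_pt p x y) by (intros; unfold p; cont_2d).
  assert (Cq : forall x y, continuity_2d_pt q x y) by (intros; unfold q; cont_2d).
  assert (Cpi : forall x y, disk x y -> continuity_2d_pt (fun x y => / p x y) x y).
  { intros x y Hd. apply continuity_2d_pt_inv; [apply Cp | apply Rgt_not_eq, Hp, Hd]. }
  assert (Cqi : forall x y, disk x y -> continuity_2d_pt (fun x y => / q x y) x y).
  { intros x y Hd. apply continuity_2d_pt_inv; [apply Cq | apply Rgt_not_eq, Hq, Hd]. }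
  assert (Cp2 : forall x y, disk x y -> continuity_2d_pt (fun x y => / (p x y * p x y)) x y).
  { intros x y Hd. apply continuity_2d_pt_inv; [apply continuity_2d_pt_mult; apply Cp |].
    assert (H := Hp x y Hd). apply Rgt_not_eq. now apply Rmult_lt_0_compat. }
  assert (Cq2 : forall x y, disk x y -> continuity_2d_pt (fun x y => / (q x y * q x y)) x y).
  { intros x y Hd. apply continuity_2d_pt_inv; [apply continuity_2d_pt_mult; apply Cq |].
    assert (H := Hq x y Hd). apply Rgt_not_eq. now apply Rmult_lt_0_compat. }
  assert (CA : cont_disk A).
  { intros x y Hd. specialize (Cpi x y Hd). specialize (Cqi x y Hd). unfold A. cont_2d. }
  assert (CB : cont_disk B).
  { intros x y Hd. specialize (Cpi x y Hd). specialize (Cqi x y Hd). unfold B. cont_2d. }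
  assert (CAx : cont_disk Ax).
  { intros x y Hd. specialize (Cpi x y Hd). specialize (Cqi x y Hd).
    specialize (Cp2 x y Hd). specialize (Cq2 x y Hd). unfold Ax. cont_2d. }
  assert (CAy : cont_disk Ay).
  { intros x y Hd. specialize (Cp2 x y Hd). specialize (Cq2 x y Hd). unfold Ay. cont_2d. }
  assert (CBy : cont_disk By).
  { intros x y Hd. specialize (Cpi x y Hd). specialize (Cqi x y Hd).
    specialize (Cp2 x y Hd). specialize (Cq2 x y Hd). unfold By. cont_2d. }
  assert (CK := ker_cont alpha).
  split; [|split; [|split]].
  - intros x y Hd. split; [now apply Kx|split; [now apply Ky|split]];
      apply continuity_2d_pt_mult; auto.
  - intros x y Hd.
    assert (Hpd := Hp x y Hd). assert (Hqd := Hq x y Hd).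
    split; [|split; [|split]].
    + apply (Mul (fun t => ker alpha t y) (fun t => A t y)); [now apply Kx|].
      unfold A, Ax, p, q in *. auto_derive; [repeat split; lra | field; lra].
    + rewrite (Rmult_comm (A x y)).
      apply (Mul (fun t => ker alpha x t) (fun t => A x t)); [now apply Ky|].
      unfold A, Ay, p, q in *. auto_derive; [repeat split; lra | field; lra].
    + apply continuity_2d_pt_mult; [auto|]. apply continuity_2d_pt_plus; [|auto].
      apply continuity_2d_pt_mult; auto.
    + apply continuity_2d_pt_mult; [auto|]. apply continuity_2d_pt_plus; [|auto].
      apply continuity_2d_pt_mult; auto.
  - intros x y Hd.
    assert (Hpd := Hp x y Hd). assert (Hqd := Hq x y Hd).
    split; [|split; [|split]].
    + apply (Mul (fun t => ker alpha t y) (fun t => B t y)); [now apply Kx|].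
      unfold B, Ay, p, q in *. auto_derive; [repeat split; lra | field; lra].
    + apply (Mul (fun t => ker alpha x t) (fun t => B x t)); [now apply Ky|].
      unfold B, By, p, q in *. auto_derive; [repeat split; lra | field; lra].
    + apply continuity_2d_pt_mult; [auto|]. apply continuity_2d_pt_plus; [|auto].
      apply continuity_2d_pt_mult; auto.
    + apply continuity_2d_pt_mult; [auto|]. apply continuity_2d_pt_plus; [|auto].
      apply continuity_2d_pt_mult; auto.
  - intros x y Hd. assert (Hpd := Hp x y Hd). assert (Hqd := Hq x y Hd).
    (* The kernel factors out of the whole equation and an identity between rational functions
       remains. *)
    set (k := ker alpha x y).
    unfold A, B, Ax, By, p, q in *. field. lra.
Qed.

Lemma ker_pos (alpha x y : R) : 0 < ker alpha x y.
Proof. apply exp_pos. Qed.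

Lemma ker_0 (alpha : R) : ker alpha 0 0 = 1.
Proof.
  unfold ker. replace (1 - (0 * 0 + 0 * 0)) with 1 by ring.
  replace ((1 - 0) * (1 - 0) + 0 * 0) with 1 by ring.
  rewrite ln_1, <- exp_0. f_equal. ring.
Qed.

(** * The Gamma function *)


Notation is_RInt_half_line h l := (is_RInt_gen h (at_right 0) (Rbar_locally p_infty) l).

Lemma half_line_filter (P : R -> R -> Prop) (A B : R) :
  0 < A -> (forall a b, 0 < a < A -> B < b -> P a b) ->
  filter_prod (at_right 0) (Rbar_locally p_infty) (fun ab => P (fst ab) (snd ab)).
Proof.
  intros HA HP.
  apply Filter_prod with (fun a => 0 < a < A) (fun b => B < b).
  - exists (mkposreal _ HA). intros y Hy Hy0. change (Rabs (y - 0) < A) in Hy.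
    rewrite Rminus_0_r in Hy. apply Rabs_def2 in Hy. lra.
  - exists B. auto.
  - simpl. intros a b Ha Hb. now apply HP.
Qed.

Lemma is_RInt_half_line_nonneg (h : R -> R) (l : R) :
  (forall t, 0 < t -> 0 <= h t) -> is_RInt_half_line h l -> 0 <= l.
Proof.
  intros Hh Hl.
  assert (H : norm l <= l).
  { apply (RInt_gen_norm (Fa := at_right 0) (Fb := Rbar_locally p_infty) h h l l).
    - apply (half_line_filter (fun a b => a <= b) 1 1); [lra|]. intros; lra.
    - apply (half_line_filter (fun a b => forall x, a <= x <= b -> norm (h x) <= h x) 1 1); [lra|].
      intros a b Ha Hb x Hx. change (Rabs (h x) <= h x). rewrite Rabs_right; [lra|].
      apply Rle_ge, Hh. lra.
    - exact Hl.
    - exact Hl. }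
  change (Rabs l <= l) in H. assert (H0 := Rabs_pos l). lra.
Qed.

(** For a nonnegative integrand the integrals grow with the interval, so a uniform bound makes them
    converge to their supremum. The second conclusion later gives positivity of Gamma from one
    compact interval. *)
Lemma is_RInt_half_line_bounded (h : R -> R) (B : R) :
  (forall t, 0 < t -> continuous h t) -> (forall t, 0 < t -> 0 <= h t) ->
  (forall a b, 0 < a <= b -> RInt h a b <= B) ->
  exists l, is_RInt_half_line h l /\ forall a b, 0 < a <= b -> RInt h a b <= l.
Proof.
  intros Hc Hp HB.
  assert (Hex : forall a b, 0 < a -> 0 < b -> ex_RInt h a b).
  { intros a b Ha Hb. apply (ex_RInt_continuous (V := R_CompleteNormedModule)).
    intros z [Hz _]. apply Hc. apply Rlt_le_trans with (2 := Hz). now apply Rmin_glb_lt. }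
  destruct (completeness (fun v => exists a b, 0 < a <= b /\ v = RInt h a b)) as [l [Hub Hlub]].
  { exists B. intros v (a & b & Hab & ->). now apply HB. }
  { exists (RInt h 1 1), 1, 1. split; [lra|reflexivity]. }
  exists l. split; [|intros a b Hab; apply Hub; now exists a, b].
  intros P [eps HP].
  assert (Hex0 : exists a0 b0, 0 < a0 <= b0 /\ l - eps < RInt h a0 b0).
  { apply Classical_Prop.NNPP. intros Hn.
    assert (Hl : l <= l - eps).
    { apply Hlub. intros v (a & b & Hab & ->).
      destruct (Rle_or_lt (RInt h a b) (l - eps)) as [?|?]; [assumption|].
      exfalso. apply Hn. now exists a, b. }
    assert (He := cond_pos eps). lra. }
  destruct Hex0 as (a0 & b0 & Hab0 & Hl0).
  unfold filtermapi.
  apply (half_line_filter (fun a b => exists y, is_RInt h a b y /\ P y) a0 b0); [lra|].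
  intros a b Ha Hb. exists (RInt h a b). split.
  - apply (RInt_correct (V := R_CompleteNormedModule)). apply Hex; lra.
  - apply HP. change (Rabs (RInt h a b - l) < eps).
    assert (H1 : RInt h a b <= l) by (apply Hub; exists a, b; split; [lra|reflexivity]).
    assert (H2 : RInt h a0 b0 <= RInt h a b).
    { rewrite <- (RInt_Chasles h a a0 b) by (apply Hex; lra).
      rewrite <- (RInt_Chasles h a0 b0 b) by (apply Hex; lra).
      assert (0 <= RInt h a a0) by (apply RInt_ge_0; [lra|apply Hex; lra|intros; apply Hp; lra]).
      assert (0 <= RInt h b0 b) by (apply RInt_ge_0; [lra|apply Hex; lra|intros; apply Hp; lra]).
      unfold plus; simpl. lra. }
    assert (He := cond_pos eps).
    apply Rabs_def1; lra.
Qed.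

Lemma Rpower_le_exp (p : R) :
  exists K, 0 < K /\ forall t, 1 <= t -> Rpower t p <= K * exp (t / 2).
Proof.
  (* From [1 + y <= exp y] at [y = ln (t / k)] comes [ln t <= t / k + |ln k|]; since [k > 2 |p|],
     multiplying by [|p|] leaves at most [t / 2] from the first term. *)
  set (k := 2 * Rabs p + 1).
  assert (Hp := Rabs_pos p).
  assert (Hk : 0 < k) by (unfold k; lra).
  exists (exp (Rabs p * Rabs (ln k))). split; [apply exp_pos|].
  intros t Ht. unfold Rpower. rewrite <- exp_plus.
  assert (Hln : 0 <= ln t) by (rewrite <- ln_1; apply ln_le; lra).
  assert (H1 : ln t <= t / k + Rabs (ln k)).
  { replace t with (t / k * k) at 1 by (field; lra).
    assert (0 < t / k) by (apply Rdiv_lt_0_compat; lra).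
    rewrite ln_mult by lra.
    assert (L := exp_ineq1_le (ln (t / k))). rewrite exp_ln in L by assumption.
    assert (La := Rle_abs (ln k)). lra. }
  assert (H2 : p * ln t <= Rabs p * ln t) by (assert (L := Rle_abs p); nra).
  assert (H3 : Rabs p * (t / k) <= t / 2).
  { replace (Rabs p * (t / k)) with (Rabs p * t / k) by (field; lra).
    apply Rle_div_l; [exact Hk|]. unfold k. nra. }
  assert (H4 : p * ln t <= Rabs p * Rabs (ln k) + t / 2) by nra.
  destruct H4 as [H4|H4]; [left; now apply exp_increasing | right; now rewrite H4].
Qed.

Lemma cont_Rpower (p t : R) : 0 < t -> continuous (fun t => Rpower t p) t.
Proof.
  intros Ht. unfold Rpower.
  apply (continuous_comp (fun t => p * ln t) exp).
  - apply (continuous_mult (K := R_AbsRing)); [apply continuous_const | now apply continuous_ln].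
  - apply continuous_exp.
Qed.

Lemma cont_exp_opp (t : R) : continuous (fun t => exp (- t)) t.
Proof.
  apply (continuous_comp Ropp exp); [|apply continuous_exp].
  apply (continuous_opp (V := R_NormedModule)), continuous_id.
Qed.

Definition gam (x t : R) : R := Rpower t (x - 1) * exp (- t).

Lemma gam_cont (x t : R) : 0 < t -> continuous (gam x) t.
Proof.
  intros Ht. apply (continuous_mult (K := R_AbsRing)).
  - now apply cont_Rpower.
  - apply cont_exp_opp.
Qed.

Lemma gam_pos (x t : R) : 0 < gam x t.
Proof. apply Rmult_lt_0_compat; apply exp_pos. Qed.

(* [gam x t <= K * t^(x-1) / (1+t)^(x+1)], which has the bounded
   antiderivative [K/x * (t/(1+t))^x]. *)
Lemma gam_RInt_bound (x : R) : 0 < x ->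
  exists B, forall a b, 0 < a <= b -> RInt (gam x) a b <= B.
Proof.
  intros Hx.
  destruct (Rpower_le_exp (x + 1)) as [K [HK0 HK]].
  set (G := fun t => K * exp 1 / x * Rpower (t / (1 + t)) x).
  set (dG := fun t => K * exp 1 * (Rpower t (x - 1) * Rpower (1 + t) (- (x + 1)))).
  assert (HG : forall t, 0 < t -> is_derive G t (dG t)).
  { intros t Ht. unfold G, dG, Rpower.
    assert (Hq : 0 < t / (1 + t)) by (apply Rdiv_lt_0_compat; lra).
    auto_derive.
    { split; [lra|]. split; [exact Hq|trivial]. }
    rewrite <- exp_plus.
    replace (exp ((x - 1) * ln t + - (x + 1) * ln (1 + t)))
      with (exp (x * ln (t / (1 + t))) * / (t * (1 + t))).
    - unfold Rdiv. set (e := exp (x * _)). field. lra.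
    - rewrite ln_div by lra.
      replace (/ (t * (1 + t))) with (exp (- (ln t + ln (1 + t)))).
      + rewrite <- exp_plus. f_equal. ring.
      + rewrite exp_Ropp, exp_plus, !exp_ln by lra. reflexivity. }
  assert (HdG : forall t, 0 < t -> continuous dG t).
  { intros t Ht. unfold dG.
    apply (continuous_mult (K := R_AbsRing)); [apply continuous_const|].
    apply (continuous_mult (K := R_AbsRing)); [now apply cont_Rpower|].
    apply (continuous_comp (fun t => 1 + t) (fun u => Rpower u (- (x + 1)))).
    - apply (continuous_plus (V := R_NormedModule)); [apply continuous_const|apply continuous_id].
    - apply cont_Rpower. lra. }
  exists (K * exp 1 / x). intros a b Hab.
  assert (Hex : ex_RInt (gam x) a b).
  { apply (ex_RInt_continuous (V := R_CompleteNormedModule)).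
    intros z Hz. rewrite Rmin_left, Rmax_right in Hz by lra. apply gam_cont. lra. }
  assert (HI : is_RInt dG a b (G b - G a)).
  { apply (is_RInt_derive (V := R_CompleteNormedModule) G dG).
    - intros t Ht. rewrite Rmin_left, Rmax_right in Ht by lra. apply HG. lra.
    - intros t Ht. rewrite Rmin_left, Rmax_right in Ht by lra. apply HdG. lra. }
  assert (He1 := exp_pos 1).
  assert (HC : 0 < K * exp 1 / x).
  { apply Rdiv_lt_0_compat; [|exact Hx]. now apply Rmult_lt_0_compat. }
  apply Rle_trans with (G b - G a).
  - rewrite <- (is_RInt_unique _ _ _ _ HI).
    apply RInt_le; [lra|exact Hex|now exists (G b - G a)|].
    intros t Ht. unfold gam, dG.
    rewrite <- Rmult_assoc, (Rmult_comm (K * exp 1)), Rmult_assoc.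
    apply Rmult_le_compat_l; [left; apply exp_pos|].
    specialize (HK (1 + t) ltac:(lra)).
    rewrite Rpower_Ropp.
    assert (HR : 0 < Rpower (1 + t) (x + 1)) by apply exp_pos.
    apply Rle_div_r; [apply HR|].
    apply Rle_trans with (exp (- t) * (K * exp ((1 + t) / 2))).
    + apply Rmult_le_compat_l; [left; apply exp_pos | exact HK].
    + replace (exp (- t) * (K * exp ((1 + t) / 2))) with (K * (exp (- t) * exp ((1 + t) / 2))) by ring.
      apply Rmult_le_compat_l; [lra|]. rewrite <- exp_plus.
      (* The combined exponent is [(1 - t) / 2], below 1: this is where the factor [exp 1] in [G]
         comes from. *)
      left. apply exp_increasing. lra.
  - assert (0 <= G a) by (unfold G; left; apply Rmult_lt_0_compat; [exact HC|apply exp_pos]).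
    assert (G b <= K * exp 1 / x).
    { unfold G. rewrite <- (Rmult_1_r (K * exp 1 / x)) at 2.
      apply Rmult_le_compat_l; [lra|].
      unfold Rpower. apply Rle_trans with (exp 0); [|rewrite exp_0; lra].
      assert (Hq : 0 < b / (1 + b)) by (apply Rdiv_lt_0_compat; lra).
      assert (Hq1 : b / (1 + b) <= 1) by (apply Rle_div_l; lra).
      assert (Hl : ln (b / (1 + b)) <= 0) by (rewrite <- ln_1; apply ln_le; assumption).
      assert (Hl2 : x * ln (b / (1 + b)) <= 0)
        by (rewrite <- (Rmult_0_r x); apply Rmult_le_compat_l; lra).
      destruct Hl2 as [Hl2|Hl2]; [left; now apply exp_increasing|rewrite Hl2; right; reflexivity]. }
    lra.
Qed.

Lemma Gamma_is_RInt (x : R) : 0 < x -> is_RInt_half_line (gam x) (Gamma x).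
Proof.
  intros Hx. destruct (gam_RInt_bound x Hx) as [B HB].
  destruct (is_RInt_half_line_bounded (gam x) B) as [l [Hl _]].
  - apply gam_cont.
  - intros; left; apply gam_pos.
  - exact HB.
  - assert (E : Gamma x = l) by exact (is_RInt_gen_unique (V := R_CompleteNormedModule) _ _ Hl).
    now rewrite E.
Qed.

Lemma is_RInt_half_line_unique (h : R -> R) (l1 l2 : R) :
  is_RInt_half_line h l1 -> is_RInt_half_line h l2 -> l1 = l2.
Proof.
  intros H1 H2.
  rewrite <- (is_RInt_gen_unique (V := R_CompleteNormedModule) _ _ H1).
  exact (is_RInt_gen_unique (V := R_CompleteNormedModule) _ _ H2).
Qed.

Lemma is_RInt_half_line_ext (h k : R -> R) (l : R) :
  (forall t, 0 < t -> h t = k t) -> is_RInt_half_line h l -> is_RInt_half_line k l.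
Proof.
  intros E. apply is_RInt_gen_ext; try typeclasses eauto.
  apply (half_line_filter (fun a b => forall x, Rmin a b < x < Rmax a b -> h x = k x) 1 1); [lra|].
  intros a b Ha Hb x Hx. apply E. rewrite Rmin_left in Hx by lra. lra.
Qed.

Lemma Gamma_gt_0 (x : R) : 0 < x -> 0 < Gamma x.
Proof.
  intros Hx. destruct (gam_RInt_bound x Hx) as [B HB].
  destruct (is_RInt_half_line_bounded (gam x) B) as [l [Hl Hl2]].
  - apply gam_cont.
  - intros; left; apply gam_pos.
  - exact HB.
  - rewrite (is_RInt_half_line_unique _ _ _ (Gamma_is_RInt x Hx) Hl).
    apply Rlt_le_trans with (2 := Hl2 1 2 ltac:(lra)).
    apply RInt_gt_0; [lra|intros; apply gam_pos|intros; apply gam_cont; lra].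
Qed.

(** Integration by parts: the derivative of [t^x exp (-t)] is the difference of the two integrands,
    and this function vanishes at both ends. *)
Lemma Gamma_succ (x : R) : 0 < x -> Gamma (x + 1) = x * Gamma x.
Proof.
  intros Hx.
  set (F := fun t => Rpower t x * exp (- t)).
  set (dF := fun t => x * gam x t - gam (x + 1) t).
  assert (HF : forall t, 0 < t -> is_derive F t (dF t)).
  { intros t Ht. unfold F, dF, gam, Rpower. auto_derive; [lra|].
    replace (x + 1 - 1) with x by ring.
    replace (exp ((x - 1) * ln t)) with (exp (x * ln t) * / t).
    - field. lra.
    - rewrite <- (exp_ln t Ht) at 2. rewrite <- exp_Ropp, <- exp_plus. f_equal. ring. }
  assert (HdF : forall t, 0 < t -> continuous dF t).
  { intros t Ht. unfold dF. apply (continuous_minus (V := R_NormedModule)).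
    - apply (continuous_mult (K := R_AbsRing)); [apply continuous_const|now apply gam_cont].
    - now apply gam_cont. }
  assert (Hloc : forall t : R, 0 < t -> locally t (fun u => 0 < u)).
  { intros t Ht. exact (open_gt 0 t Ht). }
  assert (H1 : is_RInt_half_line (Derive F) (0 - 0)).
  { apply is_RInt_gen_Derive; try typeclasses eauto.
    - apply (half_line_filter (fun a b => forall x, Rmin a b <= x <= Rmax a b -> ex_derive F x) 1 1); [lra|].
      intros a b Ha Hb t Ht. rewrite Rmin_left in Ht by lra. exists (dF t). apply HF. lra.
    - apply (half_line_filter (fun a b => forall x, Rmin a b <= x <= Rmax a b -> continuous (Derive F) x) 1 1); [lra|].
      intros a b Ha Hb t Ht. rewrite Rmin_left in Ht by lra.
      apply continuous_ext_loc with (g := dF).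
      + apply filter_imp with (2 := Hloc t ltac:(lra)). intros u Hu. symmetry.
        now apply is_derive_unique, HF.
      + apply HdF. lra.
    - apply filterlim_locally. intros eps.
      (* The radius is [eps^(1/x)], below which [t^x < eps]. *)
      assert (Hd : 0 < exp (ln eps / x)) by apply exp_pos.
      exists (mkposreal _ Hd). intros t Ht Ht0.
      change (Rabs (t - 0) < exp (ln eps / x)) in Ht. rewrite Rminus_0_r, Rabs_right in Ht by lra.
      change (Rabs (F t - 0) < eps). rewrite Rminus_0_r, Rabs_right.
      2:{ apply Rle_ge; left; apply Rmult_lt_0_compat; apply exp_pos. }
      unfold F. apply Rlt_le_trans with (eps * 1); [|lra].
      apply Rmult_le_0_lt_compat; [left; apply exp_pos|left; apply exp_pos| |].
      + unfold Rpower. rewrite <- (exp_ln eps (cond_pos eps)). apply exp_increasing.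
        assert (L : ln t < ln eps / x) by (rewrite <- (ln_exp (ln eps / x)); now apply ln_increasing).
        apply Rlt_div_r in L; lra.
      + rewrite <- exp_0. apply exp_increasing. lra.
    - destruct (Rpower_le_exp x) as [K [HK0 HK]].
      apply filterlim_locally. intros eps.
      (* Beyond this threshold [K exp (-t/2) < eps], and [Rpower_le_exp] bounds [F] by that
         quantity. *)
      exists (Rmax 1 (2 * ln (K / eps))). intros t Ht.
      assert (Ht1 := Rle_lt_trans _ _ _ (Rmax_l _ _) Ht).
      assert (Ht2 := Rle_lt_trans _ _ _ (Rmax_r _ _) Ht).
      change (Rabs (F t - 0) < eps). rewrite Rminus_0_r, Rabs_right.
      2:{ apply Rle_ge; left; apply Rmult_lt_0_compat; apply exp_pos. }
      unfold F. assert (He := cond_pos eps).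
      apply Rle_lt_trans with (K * exp (t / 2) * exp (- t)).
      + apply Rmult_le_compat_r; [left; apply exp_pos|]. apply HK. lra.
      + rewrite Rmult_assoc, <- exp_plus. replace (t / 2 + - t) with (- (t / 2)) by field.
        rewrite exp_Ropp.
        assert (Hlt : K / eps < exp (t / 2)).
        { rewrite <- (exp_ln (K / eps)) by (apply Rdiv_lt_0_compat; lra).
          apply exp_increasing. lra. }
        apply Rlt_div_l in Hlt; [|lra].
        apply Rlt_div_l; [apply exp_pos|]. lra. }
  assert (H2 : is_RInt_half_line dF (x * Gamma x - Gamma (x + 1))).
  { apply (is_RInt_gen_minus (V := R_NormedModule)).
    - apply (is_RInt_gen_scal (V := R_NormedModule)). now apply Gamma_is_RInt.
    - apply Gamma_is_RInt. lra. }
  assert (H3 : is_RInt_half_line dF (0 - 0)).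
  { apply is_RInt_half_line_ext with (2 := H1). intros t Ht. now apply is_derive_unique, HF. }
  assert (E := is_RInt_half_line_unique _ _ _ H2 H3). lra.
Qed.

Lemma Gamma_1 : Gamma 1 = 1.
Proof.
  set (F := fun t => - exp (- t)).
  assert (HF : forall t, is_derive F t (gam 1 t)).
  { intros t. unfold F, gam, Rpower. auto_derive; [trivial|].
    replace ((1 - 1) * ln t) with 0 by ring. rewrite exp_0. ring. }
  assert (HE : forall t, gam 1 t = exp (- t)).
  { intros t. unfold gam, Rpower. replace ((1 - 1) * ln t) with 0 by ring. rewrite exp_0. ring. }
  assert (HD : forall t, Derive F t = gam 1 t) by (intros; now apply is_derive_unique).
  assert (H1 : is_RInt_half_line (Derive F) (0 - (-1))).
  { apply is_RInt_gen_Derive; try typeclasses eauto.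
    - apply (half_line_filter (fun a b => forall x, Rmin a b <= x <= Rmax a b -> ex_derive F x) 1 1); [lra|].
      intros a b Ha Hb t Ht. exists (gam 1 t). apply HF.
    - apply (half_line_filter (fun a b => forall x, Rmin a b <= x <= Rmax a b -> continuous (Derive F) x) 1 1); [lra|].
      intros a b Ha Hb t Ht.
      apply continuous_ext with (fun t => exp (- t)); [|apply cont_exp_opp].
      intros u. now rewrite HD, HE.
    - replace (-1) with (F 0) by (unfold F; rewrite Ropp_0, exp_0; ring).
      apply (filterlim_filter_le_1 (F := locally 0)).
      + intros P [d Hd]. exists d. intros y Hy _. now apply Hd.
      + exact (continuous_opp (V := R_NormedModule) _ _ (cont_exp_opp 0)).
    - apply filterlim_locally. intros eps. exists (- ln eps). intros t Ht.
      change (Rabs (F t - 0) < eps). unfold F. rewrite Rminus_0_r, Rabs_Ropp, Rabs_right.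
      2:{ apply Rle_ge; left; apply exp_pos. }
      rewrite <- (exp_ln eps (cond_pos eps)). apply exp_increasing. lra. }
  replace 1 with (0 - -1) at 2 by ring.
  apply (is_RInt_half_line_unique (gam 1)).
  - apply Gamma_is_RInt. lra.
  - apply is_RInt_half_line_ext with (2 := H1). intros; apply HD.
Qed.

(* With [A^p] the mean of [t^p] for the weight [gam c], integrate
   [(t^p - A^p)(t^q - A^q) >= 0]. *)
Lemma Gamma_correlation (c p q : R) : 0 < c -> 0 < p -> 0 <= q ->
  Gamma (c + p) * Gamma (c + q) <= Gamma c * Gamma (c + p + q).
Proof.
  intros Hc Hp Hq.
  assert (Gc := Gamma_gt_0 c Hc). assert (Gp := Gamma_gt_0 (c + p) ltac:(lra)).
  set (A := Rpower (Gamma (c + p) / Gamma c) (/ p)).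
  assert (HA0 : 0 < A) by apply exp_pos.
  assert (HAp : Rpower A p = Gamma (c + p) / Gamma c).
  { unfold A. rewrite Rpower_mult, Rinv_l by lra. apply Rpower_1. now apply Rdiv_lt_0_compat. }
  set (Aq := Rpower A q).
  assert (HAq : 0 < Aq) by apply exp_pos.
  assert (Hm : forall r, forall t, gam (c + r) t = Rpower t r * gam c t).
  { intros r t. unfold gam. rewrite <- Rmult_assoc, <- Rpower_plus. do 2 f_equal. ring. }
  assert (HI : is_RInt_half_line
     (fun t => gam c t * ((Rpower t p - Rpower A p) * (Rpower t q - Aq)))
     (Gamma (c + p + q) + (- Aq) * Gamma (c + p) + (- Rpower A p) * Gamma (c + q)
       + Rpower A p * Aq * Gamma c)).
  { apply is_RInt_half_line_ext with (fun t => gam (c + (p + q)) t + (- Aq) * gam (c + p) t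
       + (- Rpower A p) * gam (c + q) t + Rpower A p * Aq * gam c t).
    - intros t Ht. rewrite !Hm, Rpower_plus. ring.
    - replace (c + p + q) with (c + (p + q)) by ring.
      assert (S : forall k r, 0 <= r -> is_RInt_half_line (fun t => k * gam (c + r) t) (k * Gamma (c + r))).
      { intros k r Hr. apply (is_RInt_gen_scal (V := R_NormedModule)), Gamma_is_RInt. lra. }
      assert (S0 := S (Rpower A p * Aq) 0 ltac:(lra)). rewrite Rplus_0_r in S0.
      apply (is_RInt_gen_plus (V := R_NormedModule)); [|exact S0].
      apply (is_RInt_gen_plus (V := R_NormedModule)); [|apply S; lra].
      apply (is_RInt_gen_plus (V := R_NormedModule)); [|apply S; lra].
      apply Gamma_is_RInt. lra. }
  apply is_RInt_half_line_nonneg in HI.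
  - rewrite HAp in HI.
    replace (Gamma (c + p) / Gamma c * Aq * Gamma c) with (Gamma (c + p) * Aq) in HI by (field; lra).
    assert (H2 : 0 <= Gamma (c + p + q) - Gamma (c + p) * Gamma (c + q) / Gamma c)
      by (replace (Gamma (c + p) * Gamma (c + q) / Gamma c)
           with (Gamma (c + p) / Gamma c * Gamma (c + q)) by (field; lra); lra).
    assert (H3 : Gamma (c + p) * Gamma (c + q) / Gamma c <= Gamma (c + p + q)) by lra.
    apply Rle_div_l in H3; lra.
  - intros t Ht. apply Rmult_le_pos; [left; apply gam_pos|].
    (* Both powers are nondecreasing in [t], so on either side of [A] the two differences have the
       same sign. *)
    unfold Aq. destruct (Rle_or_lt A t) as [H|H].
    + assert (Rpower A p <= Rpower t p) by (apply Rle_Rpower_l; lra).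
      assert (Rpower A q <= Rpower t q) by (apply Rle_Rpower_l; lra). nra.
    + assert (Rpower t p <= Rpower A p) by (apply Rle_Rpower_l; lra).
      assert (Rpower t q <= Rpower A q) by (apply Rle_Rpower_l; lra). nra.
Qed.

(** * Gauss's summation of the hypergeometric series at 1 *)


(** The terms of [F(a,a;c;1)]. The parameter [c] stays free because the summation moves it to
    infinity, although the kernel only involves [c = 1]. *)
Definition gauss_term (a c : R) (n : nat) : R :=
  pochhammer a n * pochhammer a n / pochhammer c n / INR (fact n).

Lemma pochhammer_pos (c : R) (n : nat) : 0 < c -> 0 < pochhammer c n.
Proof.
  intros Hc. induction n as [|n IH]; simpl; [lra|].
  apply Rmult_lt_0_compat; [exact IH|]. assert (H := pos_INR n). lra.
Qed.

Lemma gauss_term_nonneg (a c : R) (n : nat) : 0 < c -> 0 <= gauss_term a c n.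
Proof.
  intros Hc. unfold gauss_term.
  assert (H1 := pochhammer_pos c n Hc). assert (H2 := INR_fact_lt_0 n).
  apply Rle_div_r; [exact H2|]. rewrite Rmult_0_l.
  apply Rle_div_r; [exact H1|]. rewrite Rmult_0_l.
  apply Rle_0_sqr.
Qed.

Lemma gauss_term_S (a c : R) (n : nat) : 0 < c ->
  gauss_term a c (S n) = gauss_term a c n * ((a + INR n) * (a + INR n)) / ((c + INR n) * (INR n + 1)).
Proof.
  intros Hc. unfold gauss_term. rewrite fact_simpl, mult_INR, S_INR. simpl pochhammer.
  assert (H1 := pochhammer_pos c n Hc). assert (H2 := INR_fact_lt_0 n). assert (H3 := pos_INR n).
  field. repeat split; lra.
Qed.

Lemma pochhammer_shift (c : R) (n : nat) :
  pochhammer (c + 1) n * c = pochhammer c n * (c + INR n).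
Proof.
  induction n as [|n IH]; simpl pochhammer; [simpl; ring|].
  rewrite S_INR. transitivity (pochhammer (c + 1) n * c * (c + 1 + INR n)); [ring|].
  rewrite IH. ring.
Qed.

Lemma gauss_term_shift (a c : R) (n : nat) : 0 < c ->
  gauss_term a (c + 1) n = gauss_term a c n * c / (c + INR n).
Proof.
  intros Hc. unfold gauss_term.
  assert (H1 := pochhammer_pos c n Hc). assert (H2 := INR_fact_lt_0 n). assert (H3 := pos_INR n).
  assert (H4 := pochhammer_pos (c + 1) n ltac:(lra)).
  assert (E := pochhammer_shift c n).
  replace (pochhammer (c + 1) n) with (pochhammer c n * (c + INR n) / c) by (rewrite <- E; field; lra).
  field. repeat split; lra.
Qed.

(* The terms of the contiguous relation
   [c (c-2a) F(a,a;c;1) = (c-a)^2 F(a,a;c+1;1)] telescope. *)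
Lemma gauss_term_telescope (a c : R) (n : nat) : 0 < c ->
  (c - a) * (c - a) * gauss_term a (c + 1) n - c * (c - 2 * a) * gauss_term a c n
  = c * INR (S n) * gauss_term a c (S n) - c * INR n * gauss_term a c n.
Proof.
  intros Hc. rewrite gauss_term_shift, gauss_term_S, S_INR by exact Hc.
  assert (H3 := pos_INR n). field. lra.
Qed.

Lemma sum_n_succ (u : nat -> R) (n : nat) : sum_n u (S n) = sum_n u n + u (S n).
Proof. exact (sum_Sn u n). Qed.

(** An argument in the style of Raabe's test: the telescoping relation shows that [X n = c n u n]
    eventually drops by at least a fixed multiple of [u n], which bounds the partial sums. *)
Lemma gauss_ex_series (a c : R) : 0 < c -> 0 < c - 2 * a -> ex_series (gauss_term a c).
Proof.
  intros Hc Hd. set (d := c - 2 * a) in *. set (u := gauss_term a c).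
  assert (Hu : forall n, 0 <= u n) by (intros; now apply gauss_term_nonneg).
  set (X := fun n => c * INR n * u n).
  assert (HX : forall n, 0 <= X n).
  { intros n. unfold X. apply Rmult_le_pos; [|apply Hu]. assert (H := pos_INR n). nra. }
  set (e := c * d / 4). assert (He : 0 < e) by (unfold e; nra).
  (* The drop is [u n * c (n d - a^2) / (c + n)]. It is at least [e * u n] with [e = c d / 4]
     exactly when [a^2 + c d / 4 <= 3 n d / 4]. *)
  destruct (INR_unbounded ((a * a + c * d / 4) / (3 * d / 4))) as [N HN].
  assert (Hstep : forall n, (N <= n)%nat -> e * u n <= X n - X (S n)).
  { intros n Hn. apply le_INR in Hn.
    unfold X.
    assert (T := gauss_term_telescope a c n Hc). fold u d in T.
    rewrite gauss_term_shift in T by exact Hc. fold u in T.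
    assert (Hn0 := pos_INR n).
    assert (K : (a * a + c * d / 4) < INR n * (3 * d / 4)) by (apply Rlt_div_l; lra).
    replace (c * INR n * u n - c * INR (S n) * u (S n))
      with (u n * (c * (INR n * d - a * a) / (c + INR n))).
    2:{ transitivity (- ((c - a) * (c - a) * (u n * c / (c + INR n)) - c * d * u n)); [|lra].
        unfold d. field. lra. }
    rewrite Rmult_comm. apply Rmult_le_compat_l; [apply Hu|].
    apply -> Rle_div_r; [|lra]. unfold e.
    apply (Rmult_lt_compat_l c) in K; lra. }
  clearbody e X u.
  (* The partial sum plus the remaining potential [X / e] does not increase. *)
  assert (Hb : forall m, sum_n u (N + m) + X (S (N + m)) / e <= sum_n u N + X (S N) / e).
  { induction m as [|m IH]; [rewrite Nat.add_0_r; lra|].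
    rewrite Nat.add_succ_r, sum_Sn. unfold plus; simpl plus.
    apply Rle_trans with (2 := IH).
    assert (H := Hstep (S (N + m)) ltac:(lia)).
    assert (u (S (N + m)) <= (X (S (N + m)) - X (S (S (N + m)))) / e)
      by (apply Rle_div_r; [exact He | lra]).
    simpl. unfold Rdiv in *. lra. }
  assert (Hmono : forall n, sum_n u n <= sum_n u (S n)).
  { intros n. rewrite sum_Sn. unfold plus; simpl. assert (H := Hu (S n)). lra. }
  destruct (ex_finite_lim_seq_incr (sum_n u) (sum_n u N + X (S N) / e) Hmono) as [l Hl].
  { intros n. apply Rle_trans with (sum_n u (N + n)).
    - assert (G : forall k, sum_n u n <= sum_n u (k + n)).
      { induction k; [apply Rle_refl|]. apply Rle_trans with (1 := IHk). apply Hmono. }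
      apply G.
    - assert (H := Hb n). assert (0 <= X (S (N + n)) / e).
      { apply Rle_div_r; [exact He|]. rewrite Rmult_0_l. apply HX. }
      lra. }
  exists l. exact Hl.
Qed.

Lemma is_series_seq (u : nat -> R) (l : R) : is_series u l <-> is_lim_seq (sum_n u) l.
Proof. reflexivity. Qed.

(* Otherwise the blocks from [n] to [2n] would not become small. *)
Lemma lim_of_summable_mult_n (u : nat -> R) (L : R) :
  (forall n, 0 <= u n) -> ex_series u -> is_lim_seq (fun n => INR n * u n) L -> L = 0.
Proof.
  intros Hu [l Hl] HL.
  assert (HL0 : 0 <= L).
  { apply (is_lim_seq_le (fun _ => 0) (fun n => INR n * u n) 0 L).
    - intros n. apply Rmult_le_pos; [apply pos_INR|apply Hu].
    - apply is_lim_seq_const.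
    - exact HL. }
  destruct HL0 as [HLp|HLz]; [exfalso|now symmetry].
  assert (HLh : 0 < L / 2) by lra. assert (HLq : 0 < L / 8) by lra.
  apply is_lim_seq_spec in HL. destruct (HL (mkposreal _ HLh)) as [N1 HN1].
  apply is_series_seq, is_lim_seq_spec in Hl. destruct (Hl (mkposreal _ HLq)) as [N2 HN2].
  simpl in HN1, HN2.
  set (n := S (N1 + N2)).
  assert (Hn : 0 < INR n) by (apply lt_0_INR; unfold n; lia).
  (* For indices [k] up to [2n], [k u k > L/2] forces [u k >= L/(4n)]. The block from [n] to [2n]
     thus weighs at least [L/4], while both partial sums lie strictly within [L/8] of the total. *)
  assert (Hblock : forall m, (m <= n)%nat ->
    sum_n u n + INR m * (L / (4 * INR n)) <= sum_n u (n + m)).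
  { induction m as [|m IH]; intros Hm.
    - rewrite Nat.add_0_r. simpl. lra.
    - rewrite Nat.add_succ_r, sum_Sn, S_INR. unfold plus; simpl plus.
      specialize (IH ltac:(lia)).
      assert (Hk := HN1 (S (n + m)) ltac:(unfold n; lia)). apply Rabs_def2 in Hk.
      assert (Hk1 : INR (S (n + m)) <= 2 * INR n).
      { replace (2 * INR n) with (INR (n + n)) by (rewrite plus_INR; ring). apply le_INR. lia. }
      assert (L / (4 * INR n) <= u (S (n + m))).
      { apply Rle_div_l; [lra|]. assert (H := Hu (S (n + m))). nra. }
      change (sum_n u n + (INR m + 1) * (L / (4 * INR n)) <= sum_n u (n + m) + u (S (n + m))). lra. }
  assert (B := Hblock n ltac:(lia)).
  replace (INR n * (L / (4 * INR n))) with (L / 4) in B by (field; lra).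
  assert (A1 := HN2 n ltac:(unfold n; lia)). assert (A2 := HN2 (n + n)%nat ltac:(unfold n; lia)).
  apply Rabs_def2 in A1. apply Rabs_def2 in A2. lra.
Qed.

(** Summing the telescoped terms leaves the boundary term [c n u n]. It converges because both
    series do, and summability of [u] forces its limit to be 0. *)
Lemma gauss_contiguous (a c : R) : 0 < c -> 0 < c - 2 * a ->
  c * (c - 2 * a) * Series (gauss_term a c) = (c - a) * (c - a) * Series (gauss_term a (c + 1)).
Proof.
  intros Hc Hd.
  assert (E1 := gauss_ex_series a c Hc Hd).
  assert (E2 := gauss_ex_series a (c + 1) ltac:(lra) ltac:(lra)).
  assert (S1 := Series_correct _ E1). assert (S2 := Series_correct _ E2).
  set (L := (c - a) * (c - a) * Series (gauss_term a (c + 1)) - c * (c - 2 * a) * Series (gauss_term a c)).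
  assert (HL : is_lim_seq (fun n => c * INR n * gauss_term a c n) L).
  { apply is_lim_seq_incr_1.
    apply is_lim_seq_ext with (fun n => (c - a) * (c - a) * sum_n (gauss_term a (c + 1)) n
                                       - c * (c - 2 * a) * sum_n (gauss_term a c) n).
    - induction n as [|n IH].
      + rewrite !sum_O. rewrite gauss_term_telescope by exact Hc. simpl INR. ring.
      + rewrite !sum_n_succ.
        assert (T := gauss_term_telescope a c (S n) Hc). lra.
    - apply is_lim_seq_minus'; apply is_lim_seq_mult'; try apply is_lim_seq_const; assumption. }
  assert (HL' : is_lim_seq (fun n => INR n * gauss_term a c n) (/ c * L)).
  { apply is_lim_seq_ext with (fun n => / c * (c * INR n * gauss_term a c n)).
    - intros n. field. lra.
    - apply is_lim_seq_mult'; [apply is_lim_seq_const | exact HL]. }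
  apply lim_of_summable_mult_n in HL'; [|intros; now apply gauss_term_nonneg|exact E1].
  assert (L = 0) by (replace L with (c * (/ c * L)) by (field; lra); rewrite HL'; ring).
  unfold L in *. lra.
Qed.

Lemma pochhammer_1 (n : nat) : pochhammer 1 n = INR (fact n).
Proof.
  induction n as [|n IH]; [reflexivity|].
  rewrite fact_simpl, mult_INR, S_INR. simpl pochhammer. rewrite IH. ring.
Qed.

Lemma gauss_series_bounds (a c : R) : a < 1 / 2 -> 1 <= c ->
  1 <= Series (gauss_term a c) <= 1 + Series (gauss_term a 1) / c.
Proof.
  intros Ha Hc.
  assert (E1 := gauss_ex_series a c ltac:(lra) ltac:(lra)).
  assert (E2 := gauss_ex_series a 1 ltac:(lra) ltac:(lra)).
  assert (H0 : forall c, gauss_term a c 0 = 1) by (intros; unfold gauss_term; simpl; field).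
  assert (N : forall c n, 0 < c -> 0 <= gauss_term a c n) by (intros; now apply gauss_term_nonneg).
  assert (Hnn : forall c, 1 <= c -> 0 < c - 2 * a -> 0 <= Series (fun k => gauss_term a c (S k))).
  { intros c' H1 H2. replace 0 with (Series (fun _ : nat => 0 * 0)).
    - apply Series_le.
      + intros n. split; [lra|]. rewrite Rmult_0_l. apply N. lra.
      + apply (ex_series_incr_1 (gauss_term a c')). apply gauss_ex_series; lra.
    - rewrite Series_scal_l. ring. }
  rewrite (Series_incr_1 (gauss_term a c)) by exact E1.
  rewrite (Series_incr_1 (gauss_term a 1)) by exact E2.
  rewrite !H0. assert (P := Hnn c Hc ltac:(lra)). assert (P1 := Hnn 1 ltac:(lra) ltac:(lra)).
  split; [lra|].
  apply Rplus_le_compat_l.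
  apply Rle_trans with (Series (fun k => / c * gauss_term a 1 (S k))).
  - apply Series_le.
    + intros n. split; [apply N; lra|].
      (* Factor by factor, [c + k >= 1 + k] for [k >= 1]; keeping the first factor [c] gives the
         decay in [1 / c] of all terms but the constant one. *)
      assert (Hpc : c * INR (fact (S n)) <= pochhammer c (S n)).
      { induction n as [|n IH].
        - simpl. lra.
        - rewrite (fact_simpl (S n)), mult_INR.
          change (pochhammer c (S (S n))) with (pochhammer c (S n) * (c + INR (S n))).
          rewrite (S_INR (S n)). assert (Q := INR_fact_lt_0 (S n)). assert (Q2 := pos_INR (S n)).
          apply Rle_trans with (c * INR (fact (S n)) * (INR (S n) + 1)); [lra|].
          apply Rmult_le_compat; try lra. apply Rmult_le_pos; lra. }
      unfold gauss_term. rewrite pochhammer_1.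
      assert (Q := INR_fact_lt_0 (S n)).
      replace (/ c * (pochhammer a (S n) * pochhammer a (S n) / INR (fact (S n)) / INR (fact (S n))))
        with (pochhammer a (S n) * pochhammer a (S n) / (c * INR (fact (S n))) / INR (fact (S n)))
        by (field; lra).
      unfold Rdiv. apply Rmult_le_compat_r; [left; now apply Rinv_0_lt_compat|].
      apply Rmult_le_compat_l; [apply Rle_0_sqr|].
      apply Rinv_le_contravar; [apply Rmult_lt_0_compat; lra | exact Hpc].
    + apply (ex_series_scal (V := R_NormedModule) (/ c) (fun k => gauss_term a 1 (S k))). now apply (ex_series_incr_1 (gauss_term a 1)).
  - rewrite Series_scal_l. rewrite Rmult_comm. unfold Rdiv.
    apply Rmult_le_compat_r; [left; apply Rinv_0_lt_compat; lra|]. lra.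
Qed.

(** Gauss's value of [F(a,a;c;1)]. *)
Definition Gamma_ratio (a c : R) : R := Gamma c * Gamma (c - 2 * a) / (Gamma (c - a) * Gamma (c - a)).

Lemma Gamma_ratio_succ (a c : R) : 0 < c -> 0 < c - 2 * a ->
  c * (c - 2 * a) * Gamma_ratio a c = (c - a) * (c - a) * Gamma_ratio a (c + 1).
Proof.
  intros Hc Hd. unfold Gamma_ratio.
  replace (c + 1 - 2 * a) with (c - 2 * a + 1) by ring.
  replace (c + 1 - a) with (c - a + 1) by ring.
  rewrite !Gamma_succ by lra.
  assert (H := Gamma_gt_0 (c - a) ltac:(lra)). field. lra.
Qed.

(** The lower bound is the correlation inequality with both exponents [s]. For the upper one, the
    correlation with exponents [s] and [K - s] at [m + s] replaces the shift by [s] with an integer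
    shift [K], on which the functional equation can be iterated. *)
Lemma Gamma_ratio_bounds_aux (m s : R) (K : nat) : 0 < m -> 0 <= s <= INR K ->
  1 <= Gamma m * Gamma (m + 2 * s) / (Gamma (m + s) * Gamma (m + s)) <= (1 + s / m) ^ K.
Proof.
  intros Hm Hs.
  assert (G0 := Gamma_gt_0 m Hm). assert (G1 := Gamma_gt_0 (m + s) ltac:(lra)).
  assert (G2 := Gamma_gt_0 (m + 2 * s) ltac:(lra)).
  assert (Hsm : 0 <= s / m) by (apply Rle_div_r; lra).
  destruct (Req_dec s 0) as [->|Hne].
  { rewrite Rmult_0_r, !Rplus_0_r. unfold Rdiv. rewrite Rmult_0_l, Rplus_0_r, pow1, Rinv_r; [lra|].
    apply Rgt_not_eq. now apply Rmult_lt_0_compat. }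
  assert (Hsp : 0 < s) by lra.
  assert (Hsq : 0 < Gamma (m + s) * Gamma (m + s)) by now apply Rmult_lt_0_compat.
  split.
  - apply Rle_div_r; [exact Hsq|].
    assert (C := Gamma_correlation m s s Hm Hsp ltac:(lra)).
    replace (m + 2 * s) with (m + s + s) by ring. lra.
  - apply Rle_div_l; [exact Hsq|].
    assert (C := Gamma_correlation (m + s) s (INR K - s) ltac:(lra) Hsp ltac:(lra)).
    replace (m + s + s) with (m + 2 * s) in C by ring.
    replace (m + s + (INR K - s)) with (m + INR K) in C by ring.
    replace (m + 2 * s + (INR K - s)) with (m + s + INR K) in C by ring.
    assert (GK : 0 < Gamma (m + INR K)) by (apply Gamma_gt_0; lra).
    assert (I : forall k, Gamma m * Gamma (m + s + INR k) <= (1 + s / m) ^ k * Gamma (m + INR k) * Gamma (m + s)).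
    { induction k as [|k IH]; [simpl; rewrite !Rplus_0_r; lra|].
      assert (Hk := pos_INR k).
      rewrite S_INR. replace (m + s + (INR k + 1)) with (m + s + INR k + 1) by ring.
      replace (m + (INR k + 1)) with (m + INR k + 1) by ring.
      rewrite !Gamma_succ by lra.
      assert (Gk := Gamma_gt_0 (m + INR k) ltac:(lra)).
      assert (Gk' := Gamma_gt_0 (m + s + INR k) ltac:(lra)).
      assert (HB : m + s + INR k <= (1 + s / m) * (m + INR k)).
      { replace ((1 + s / m) * (m + INR k)) with (m + s + INR k + s / m * INR k) by (field; lra). nra. }
      simpl pow.
      apply Rle_trans with ((m + s + INR k) * ((1 + s / m) ^ k * Gamma (m + INR k) * Gamma (m + s))).
      - transitivity ((m + s + INR k) * (Gamma m * Gamma (m + s + INR k))); [right; ring|].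
        apply Rmult_le_compat_l; [lra|exact IH].
      - transitivity ((1 + s / m) * (m + INR k) * ((1 + s / m) ^ k * Gamma (m + INR k) * Gamma (m + s)));
          [|right; ring].
        apply Rmult_le_compat_r; [|exact HB].
        apply Rmult_le_pos; [apply Rmult_le_pos|]; try lra. apply pow_le. lra. }
    specialize (I K).
    apply Rmult_le_reg_r with (Gamma (m + INR K)); [exact GK|].
    apply Rle_trans with (Gamma m * (Gamma (m + s) * Gamma (m + s + INR K))).
    + rewrite Rmult_assoc. apply Rmult_le_compat_l; [lra|exact C].
    + transitivity (Gamma (m + s) * (Gamma m * Gamma (m + s + INR K))); [right; ring|].
      transitivity (Gamma (m + s) * ((1 + s / m) ^ K * Gamma (m + INR K) * Gamma (m + s))); [|right; ring].
      apply Rmult_le_compat_l; [lra|exact I].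
Qed.

Lemma Gamma_ratio_lim (a : R) : a < 1 / 2 -> is_lim_seq (fun n => Gamma_ratio a (1 + INR n)) 1.
Proof.
  intros Ha.
  (* [m0 + n] is the smaller of the two arguments [1 + n] and [1 + n - 2a] in the numerator. The
     ratio is symmetric in them, so both signs of [a] reduce to a shift by [|a|]. *)
  set (m0 := 1 - (if Rle_dec a 0 then 0 else 2 * a)).
  assert (Hm0 : 0 < m0) by (unfold m0; destruct Rle_dec; lra).
  set (s := Rabs a).
  destruct (INR_unbounded s) as [K HK].
  assert (B : forall n, 1 <= Gamma_ratio a (1 + INR n) <= (1 + s / (m0 + INR n)) ^ K).
  { intros n. assert (Hn := pos_INR n).
    assert (B := Gamma_ratio_bounds_aux (m0 + INR n) s K ltac:(lra) (conj (Rabs_pos a) (Rlt_le _ _ HK))).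
    unfold Gamma_ratio. unfold m0, s in *. destruct Rle_dec as [H|H].
    - rewrite Rabs_left1 in * by exact H.
      replace (1 + INR n - 2 * a) with (1 - 0 + INR n + 2 * - a) by ring.
      replace (1 + INR n - a) with (1 - 0 + INR n + - a) by ring.
      replace (Gamma (1 + INR n)) with (Gamma (1 - 0 + INR n)) by (f_equal; ring). exact B.
    - rewrite Rabs_right in * by lra.
      replace (1 + INR n - 2 * a) with (1 - 2 * a + INR n) by ring.
      replace (1 + INR n - a) with (1 - 2 * a + INR n + a) by ring.
      replace (Gamma (1 + INR n)) with (Gamma (1 - 2 * a + INR n + 2 * a)) by (f_equal; ring).
      rewrite (Rmult_comm (Gamma (_ + 2 * a))). exact B. }
  apply is_lim_seq_le_le with (1 := B); [apply is_lim_seq_const|].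
  replace (Finite 1) with (Finite ((fun x => (1 + x) ^ K) 0)) by (simpl; now rewrite Rplus_0_r, pow1).
  apply (is_lim_seq_continuous (fun x => (1 + x) ^ K)).
  - apply continuity_pt_filterlim, (ex_derive_continuous (fun x => (1 + x) ^ K)). auto_derive. trivial.
  - apply is_lim_seq_ext with (fun n => s * / (m0 + INR n)); [reflexivity|].
    replace (Finite 0) with (Rbar_mult s (Rbar_inv p_infty)) by (simpl; f_equal; ring).
    apply is_lim_seq_scal_l. apply is_lim_seq_inv; [|discriminate].
    apply is_lim_seq_plus with m0 p_infty; [apply is_lim_seq_const | apply is_lim_seq_INR | reflexivity].
Qed.

(** The series and [Gamma_ratio] obey the same recursion from [c] to [c + 1], so their quotient is
    the same at every [1 + n]; both tend to 1, so the quotient is 1. *)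
Lemma gauss_sum (a : R) : a < 1 / 2 ->
  Series (gauss_term a 1) = Gamma (1 - 2 * a) / (Gamma (1 - a) * Gamma (1 - a)).
Proof.
  intros Ha.
  set (S c := Series (gauss_term a c)).
  assert (Hinv : forall n, S 1 * Gamma_ratio a (1 + INR n) = Gamma_ratio a 1 * S (1 + INR n)).
  { induction n as [|n IH].
    - simpl. rewrite Rplus_0_r. ring.
    - rewrite S_INR. replace (1 + (INR n + 1)) with (1 + INR n + 1) by ring.
      assert (Hn := pos_INR n).
      assert (E1 := gauss_contiguous a (1 + INR n) ltac:(lra) ltac:(lra)).
      assert (E2 := Gamma_ratio_succ a (1 + INR n) ltac:(lra) ltac:(lra)).
      fold (S (1 + INR n)) (S (1 + INR n + 1)) in E1.
      set (q := 1 + INR n) in *.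
      apply Rmult_eq_reg_l with ((q - a) * (q - a)).
      2:{ apply Rgt_not_eq, Rmult_lt_0_compat; unfold q; lra. }
      transitivity (S 1 * ((q - a) * (q - a) * Gamma_ratio a (q + 1))); [ring|].
      rewrite <- E2.
      transitivity (q * (q - 2 * a) * (S 1 * Gamma_ratio a q)); [ring|].
      rewrite IH.
      transitivity (Gamma_ratio a 1 * (q * (q - 2 * a) * S q)); [ring|].
      rewrite E1. ring. }
  assert (HS : is_lim_seq (fun n => S (1 + INR n)) 1).
  { apply is_lim_seq_le_le with (fun _ => 1) (fun n => 1 + S 1 * / (1 + INR n)).
    - intros n. apply gauss_series_bounds; [exact Ha|]. assert (H := pos_INR n). lra.
    - apply is_lim_seq_const.
    - replace (Finite 1) with (Finite (1 + S 1 * 0)) by (f_equal; ring).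
      apply is_lim_seq_plus'; [apply is_lim_seq_const|].
      apply is_lim_seq_mult'; [apply is_lim_seq_const|].
      replace (Finite 0) with (Rbar_inv p_infty) by reflexivity.
      apply is_lim_seq_inv; [|discriminate].
      apply is_lim_seq_plus with 1 p_infty; [apply is_lim_seq_const | apply is_lim_seq_INR | reflexivity]. }
  assert (L1 : is_lim_seq (fun n => S 1 * Gamma_ratio a (1 + INR n)) (S 1 * 1)).
  { apply is_lim_seq_mult'; [apply is_lim_seq_const | now apply Gamma_ratio_lim]. }
  assert (L2 : is_lim_seq (fun n => S 1 * Gamma_ratio a (1 + INR n)) (Gamma_ratio a 1 * 1)).
  { apply is_lim_seq_ext with (fun n => Gamma_ratio a 1 * S (1 + INR n)); [intros; now rewrite Hinv|].
    apply is_lim_seq_mult'; [apply is_lim_seq_const | exact HS]. }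
  apply is_lim_seq_unique in L1. apply is_lim_seq_unique in L2.
  rewrite L1 in L2. injection L2. intros E.
  fold (S 1). rewrite !Rmult_1_r in E. rewrite E. unfold Gamma_ratio. rewrite Gamma_1. f_equal. ring.
Qed.

(** * The mean of the kernel *)


(** The coefficients of [F(-alpha/2, -alpha/2; 1; q)] in the variable [q = |z|^2]. The convergence
    condition at [q = 1] becomes [alpha > -1]. *)
Definition radial_coef (alpha : R) (n : nat) : R := gauss_term (- alpha / 2) 1 n.

Lemma radial_coef_nonneg (alpha : R) (n : nat) : 0 <= radial_coef alpha n.
Proof. apply gauss_term_nonneg; lra. Qed.

Lemma radial_coef_ex_series (alpha : R) : -1 < alpha -> ex_series (radial_coef alpha).
Proof. intros H. apply gauss_ex_series; lra. Qed.

Lemma sum_n_le_Series (u : nat -> R) (n : nat) :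
  (forall k, 0 <= u k) -> ex_series u -> sum_n u n <= Series u.
Proof.
  intros Hu He. apply Series_correct, is_series_seq in He.
  apply (is_lim_seq_incr_compare (sum_n u)); [exact He|].
  intros k. rewrite sum_n_succ. assert (H := Hu (S k)). lra.
Qed.

Lemma term_le_Series (u : nat -> R) (n : nat) :
  (forall k, 0 <= u k) -> ex_series u -> u n <= Series u.
Proof.
  intros Hu He. apply Rle_trans with (2 := sum_n_le_Series u n Hu He).
  destruct n as [|n]; [rewrite sum_O; lra|].
  rewrite sum_n_succ. assert (0 <= sum_n u n); [|lra].
  clear He. induction n as [|n IH]; [rewrite sum_O; apply Hu|].
  rewrite sum_n_succ. assert (H := Hu (S n)). lra.
Qed.

Lemma radial_coef_CV (alpha q : R) : -1 < alpha -> 0 <= q < 1 ->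
  Rbar_lt (Rabs q) (CV_radius (radial_coef alpha)).
Proof.
  intros Ha Hq. apply Rbar_lt_le_trans with 1.
  - simpl. rewrite Rabs_right; lra.
  - apply (proj1 (CV_radius_bounded (radial_coef alpha))).
    exists (Series (radial_coef alpha)). intros n.
    rewrite pow1, Rmult_1_r, Rabs_right by (apply Rle_ge, radial_coef_nonneg).
    apply term_le_Series; [apply radial_coef_nonneg | now apply radial_coef_ex_series].
Qed.

(** The equation for a function [h (|z|^2)]: its Laplacian is [4 h' + 4 q h''] and its radial
    derivative [x g_x + y g_y] is [2 q h']. *)
Lemma radial_ode (alpha q : R) : -1 < alpha -> 0 <= q < 1 ->
  (1 - q) * (4 * PSeries (PS_derive (radial_coef alpha)) q
             + 4 * q * PSeries (PS_derive (PS_derive (radial_coef alpha))) q)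
  + 4 * alpha * q * PSeries (PS_derive (radial_coef alpha)) q
  - alpha * alpha * PSeries (radial_coef alpha) q = 0.
Proof.
  intros Ha Hq. assert (Hcv := radial_coef_CV alpha q Ha Hq).
  set (A := radial_coef alpha) in *.
  assert (S0 : is_pseries A q (PSeries A q)) by (apply PSeries_correct, CV_radius_inside, Hcv).
  assert (S1 : is_pseries (PS_derive A) q (PSeries (PS_derive A) q)).
  { apply PSeries_correct, CV_radius_inside. now rewrite CV_radius_derive. }
  assert (S2 : is_pseries (PS_derive (PS_derive A)) q (PSeries (PS_derive (PS_derive A)) q)).
  { apply PSeries_correct, CV_radius_inside. now rewrite !CV_radius_derive. }
  set (h := PSeries A q) in *. set (h1 := PSeries (PS_derive A) q) in *.
  set (h2 := PSeries (PS_derive (PS_derive A)) q) in *.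
  assert (SD := is_pseries_plus _ _ _ _ _ S1 (is_pseries_incr_1 _ _ _ S2)).
  assert (SQ := is_pseries_incr_1 _ _ _ SD).
  assert (ST := is_pseries_incr_1 _ _ _ S1).
  assert (Sc : forall k a l, is_pseries a q l -> is_pseries (PS_scal k a) q (k * l))
    by (intros; apply (is_pseries_scal (V := R_NormedModule)); [apply Rmult_comm|assumption]).
  assert (T := is_pseries_plus _ _ _ _ _ (is_pseries_plus _ _ _ _ _ (is_pseries_plus _ _ _ _ _
     (Sc 4 _ _ SD) (Sc (-4) _ _ SQ)) (Sc (4 * alpha) _ _ ST)) (Sc (- (alpha * alpha)) _ _ S0)).
  apply is_pseries_unique in T.
  unfold plus, scal in T; simpl in T; unfold mult in T; simpl in T.
  match goal with |- ?e = 0 => transitivity (4 * (h1 + q * h2) + -4 * (q * (h1 + q * h2))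
    + 4 * alpha * (q * h1) + - (alpha * alpha) * h) end; [ring|].
  rewrite <- T. rewrite <- (PSeries_const_0 q). apply PSeries_ext.
  (* The hypergeometric recurrence makes every coefficient vanish, because [4 (n - alpha/2)^2 = 4
     n^2 - 4 alpha n + alpha^2]. *)
  assert (Rec : forall n, (INR n + 1) * (INR n + 1) * A (S n) = (INR n - alpha / 2) * (INR n - alpha / 2) * A n).
  { intros n. unfold A, radial_coef. rewrite gauss_term_S by lra. assert (Hn := pos_INR n). field. lra. }
  assert (I2 : forall n, PS_incr_1 (PS_derive (PS_derive A)) n = INR n * (INR n + 1) * A (S n) :> R).
  { intros [|n]; [simpl; change zero with 0; ring|].
    change (INR (S n) * (INR (S (S n)) * A (S (S n))) = INR (S n) * (INR (S n) + 1) * A (S (S n))).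
    rewrite (S_INR (S n)). ring. }
  assert (I1 : forall n, PS_incr_1 (PS_derive A) n = INR n * A n :> R).
  { intros [|n]; [simpl; change zero with 0; ring|reflexivity]. }
  set (D := PS_plus (PS_derive A) (PS_incr_1 (PS_derive (PS_derive A)))).
  assert (ID : forall n, D n = (INR n + 1) * (INR n + 1) * A (S n) :> R).
  { intros n. change (INR (S n) * A (S n) + PS_incr_1 (PS_derive (PS_derive A)) n
      = (INR n + 1) * (INR n + 1) * A (S n) :> R).
    rewrite I2, S_INR. ring. }
  assert (IQ : forall n, PS_incr_1 D n = INR n * INR n * A n :> R).
  { intros [|n]; [simpl; change zero with 0; ring|].
    change (D n = INR (S n) * INR (S n) * A (S n) :> R). rewrite ID, S_INR. ring. }
  intros n.
  change (4 * D n + -4 * PS_incr_1 D n + 4 * alpha * PS_incr_1 (PS_derive A) n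
          + - (alpha * alpha) * A n = 0 :> R).
  rewrite IQ, I1, ID, Rec. field.
Qed.

Definition radial_sol (alpha x y : R) : R := PSeries (radial_coef alpha) (x * x + y * y).

Lemma pde_sol_radial (alpha : R) : -1 < alpha -> pde_sol alpha (radial_sol alpha).
Proof.
  intros Ha. set (A := radial_coef alpha).
  set (h1 := fun x y => PSeries (PS_derive A) (x * x + y * y)).
  set (h2 := fun x y => PSeries (PS_derive (PS_derive A)) (x * x + y * y)).
  assert (Hcv : forall x y, disk x y -> Rbar_lt (Rabs (x * x + y * y)) (CV_radius A)).
  { intros x y Hd. apply radial_coef_CV; [exact Ha|]. unfold disk in Hd. nra. }
  assert (Dx : forall a x y, Rbar_lt (Rabs (x * x + y * y)) (CV_radius a) ->
     is_derive (fun t => PSeries a (t * t + y * y)) x (2 * x * PSeries (PS_derive a) (x * x + y * y))).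
  { intros a x y H. apply (is_derive_comp (PSeries a) (fun t => t * t + y * y)).
    - now apply is_derive_PSeries.
    - auto_derive; [trivial|ring]. }
  assert (Dy : forall a x y, Rbar_lt (Rabs (x * x + y * y)) (CV_radius a) ->
     is_derive (fun t => PSeries a (x * x + t * t)) y (2 * y * PSeries (PS_derive a) (x * x + y * y))).
  { intros a x y H. apply (is_derive_comp (PSeries a) (fun t => x * x + t * t)).
    - now apply is_derive_PSeries.
    - auto_derive; [trivial|ring]. }
  assert (Co : forall a x y, Rbar_lt (Rabs (x * x + y * y)) (CV_radius a) ->
     continuity_2d_pt (fun x y => PSeries a (x * x + y * y)) x y).
  { intros a x y H. apply (continuity_1d_2d_pt_comp (PSeries a) (fun x y => x * x + y * y)); [|cont_2d].
    now apply PSeries_continuity. }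
  assert (Hcv1 : forall x y, disk x y -> Rbar_lt (Rabs (x * x + y * y)) (CV_radius (PS_derive A)))
    by (intros; rewrite CV_radius_derive; auto).
  assert (Hcv2 : forall x y, disk x y -> Rbar_lt (Rabs (x * x + y * y)) (CV_radius (PS_derive (PS_derive A))))
    by (intros; rewrite !CV_radius_derive; auto).
  assert (C1 : cont_disk h1) by (intros x y Hd; apply Co; auto).
  assert (C2 : cont_disk h2) by (intros x y Hd; apply Co; auto).
  assert (Mul : forall (k b : R -> R) s b1, is_derive b s b1 -> k = (fun t => 2 * t) ->
     is_derive (fun t => k t * b t) s (2 * b s + 2 * s * b1)).
  { intros k b s b1 H ->.
    apply (is_derive_mult (K := R_AbsRing) (fun t => 2 * t) b);
      [auto_derive; [trivial|ring]|assumption|intros; apply Rmult_comm]. }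
  exists (fun x y => 2 * x * h1 x y), (fun x y => 2 * y * h1 x y),
    (fun x y => 2 * h1 x y + 2 * x * (2 * x * h2 x y)),
    (fun x y => 2 * x * (2 * y * h2 x y)),
    (fun x y => 2 * y * (2 * x * h2 x y)),
    (fun x y => 2 * h1 x y + 2 * y * (2 * y * h2 x y)).
  split; [|split; [|split]]; intros x y Hd;
    assert (K1 := C1 x y Hd); assert (K2 := C2 x y Hd).
  - split; [apply Dx; auto|split; [apply Dy; auto|split; cont_2d]].
  - split; [|split; [|split; cont_2d]].
    + apply (Mul (fun t => 2 * t) (fun t => h1 t y)); [apply Dx; auto|reflexivity].
    + apply (is_derive_scal (fun t => h1 x t)). apply Dy; auto.
  - split; [|split; [|split; cont_2d]].
    + apply (is_derive_scal (fun t => h1 t y)). apply Dx; auto.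
    + apply (Mul (fun t => 2 * t) (fun t => h1 x t)); [apply Dy; auto|reflexivity].
  - assert (O := radial_ode alpha (x * x + y * y) Ha ltac:(unfold disk in Hd; nra)).
    fold A (h1 x y) (h2 x y) in O. unfold radial_sol. fold A. rewrite <- O. ring.
Qed.

(** * Polar coordinates and convolution on circles *)

Lemma polar_angle (x y : R) : x * x + y * y = 1 -> exists th, x = cos th /\ y = sin th.
Proof.
  intros H. assert (Hx : -1 <= x <= 1) by nra.
  assert (Hs : sqrt (1 - x²) = Rabs y).
  { replace (1 - x²) with (y²) by (unfold Rsqr; lra). apply sqrt_Rsqr_abs. }
  destruct (Rle_or_lt 0 y) as [Hy|Hy].
  - exists (acos x). rewrite cos_acos, sin_acos, Hs, Rabs_right by lra. split; reflexivity.
  - exists (- acos x). rewrite cos_neg, sin_neg, cos_acos, sin_acos, Hs, Rabs_left by lra.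
    split; ring.
Qed.

Lemma polar_coord (x y rho : R) : 0 <= rho -> x * x + y * y = rho * rho ->
  exists th, x = rho * cos th /\ y = rho * sin th.
Proof.
  intros [Hr|<-] H.
  - destruct (polar_angle (x / rho) (y / rho)) as [th [H1 H2]].
    + transitivity ((x * x + y * y) / (rho * rho)); [field; lra|]. rewrite H. field. lra.
    + exists th. rewrite <- H1, <- H2. split; field; lra.
  - exists 0. split; nra.
Qed.

Lemma RInt_congr (f g : R -> R) (a b : R) : (forall t, f t = g t) -> RInt f a b = RInt g a b.
Proof. intros H. apply (RInt_ext (V := R_CompleteNormedModule)). intros; apply H. Qed.

(** The substitution moves the interval to the one from [th - 2 PI] to [th]; cutting at 0,
    periodicity shifts the first piece to the one from [th] to [2 PI]. *)
Lemma RInt_periodic_reflect (F : R -> R) (th : R) :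
  (forall t, continuous F t) -> (forall t, F (t + 2 * PI) = F t) ->
  RInt (fun t => F (th - t)) 0 (2 * PI) = RInt F 0 (2 * PI).
Proof.
  intros Hc Hp.
  assert (Hex : forall a b, ex_RInt F a b)
    by (intros; apply (ex_RInt_continuous (V := R_CompleteNormedModule)); auto).
  assert (E1 : RInt (fun t => F (th - t)) 0 (2 * PI) = RInt F (th - 2 * PI) th).
  { transitivity (- RInt (fun t => scal (-1) (F (-1 * t + th))) 0 (2 * PI)).
    - rewrite <- (RInt_opp (V := R_CompleteNormedModule)).
      + apply RInt_congr. intros t.
        change (F (th - t) = - (-1 * F (-1 * t + th)) :> R).
        assert (Et : -1 * t + th = th - t :> R) by ring. rewrite Et. ring.
      + apply (ex_RInt_comp_lin F). apply Hex.
    - rewrite (RInt_comp_lin (V := R_CompleteNormedModule) F) by apply Hex.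
      rewrite <- (opp_RInt_swap (V := R_CompleteNormedModule)) by apply Hex.
      unfold opp; simpl. rewrite Ropp_involutive. f_equal; ring. }
  rewrite E1.
  rewrite <- (RInt_Chasles F (th - 2 * PI) 0 th) by apply Hex.
  assert (E2 : RInt F (th - 2 * PI) 0 = RInt F th (2 * PI)).
  { transitivity (RInt (fun t => scal 1 (F (1 * t + 2 * PI))) (th - 2 * PI) 0).
    - apply RInt_congr. intros t. change (F t = 1 * F (1 * t + 2 * PI) :> R).
      rewrite !Rmult_1_l. symmetry. apply Hp.
    - rewrite (RInt_comp_lin (V := R_CompleteNormedModule) F) by apply Hex. f_equal; ring. }
  rewrite E2. unfold plus; simpl. rewrite Rplus_comm. apply (RInt_Chasles F 0 th (2 * PI)); apply Hex.
Qed.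

Lemma rot_polar (rho th t : R) :
  rot_x (rho * cos th) (rho * sin th) t = rho * cos (th - t) /\
  rot_y (rho * cos th) (rho * sin th) t = rho * sin (th - t).
Proof. unfold rot_x, rot_y. rewrite cos_minus, sin_minus. split; ring. Qed.

Lemma polar_sq (rho t : R) : rho * cos t * (rho * cos t) + rho * sin t * (rho * sin t) = rho * rho.
Proof.
  assert (H := sin2_cos2 t). unfold Rsqr in H.
  transitivity (rho * rho * (sin t * sin t + cos t * cos t)); [ring|]. rewrite H. ring.
Qed.

Lemma disk_polar (rho t : R) : 0 <= rho < 1 -> disk (rho * cos t) (rho * sin t).
Proof. intros H. unfold disk. rewrite polar_sq. nra. Qed.

Lemma cont_polar (g : R -> R -> R) (rho : R) : cont_disk g -> 0 <= rho < 1 ->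
  forall t, continuous (fun t => g (rho * cos t) (rho * sin t)) t.
Proof.
  intros Hg Hr t. apply (continuous_comp_2d g (fun t => rho * cos t) (fun t => rho * sin t)).
  - now apply Hg, disk_polar.
  - apply (continuous_mult (K := R_AbsRing)); [apply continuous_const|apply cont_cos].
  - apply (continuous_mult (K := R_AbsRing)); [apply continuous_const|apply cont_sin].
Qed.

(** Commutativity of convolution on the circle. The two radii are independent: one use below takes
    the second radius 0, the other takes them equal. *)
Lemma circ_int_swap (g k : R -> R -> R) (rho rho' th : R) :
  cont_disk g -> cont_disk k -> 0 <= rho < 1 -> 0 <= rho' < 1 ->
  circ_int g (fun t => k (rho' * cos t) (rho' * sin t)) (rho * cos th) (rho * sin th) =
  circ_int k (fun t => g (rho * cos t) (rho * sin t)) (rho' * cos th) (rho' * sin th).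
Proof.
  intros Hg Hk Hr Hr'. unfold circ_int.
  set (F := fun t => k (rho' * cos (th - t)) (rho' * sin (th - t)) * g (rho * cos t) (rho * sin t)).
  transitivity (RInt (fun t => F (th - t)) 0 (2 * PI)).
  - apply RInt_congr. intros t. destruct (rot_polar rho th t) as [-> ->]. unfold F.
    replace (th - (th - t)) with t by ring. ring.
  - rewrite RInt_periodic_reflect.
    + apply RInt_congr. intros t. destruct (rot_polar rho' th t) as [-> ->]. reflexivity.
    + intros t. unfold F. apply (continuous_mult (K := R_AbsRing)); [|now apply cont_polar].
      apply (continuous_comp (fun t => th - t) (fun t => k (rho' * cos t) (rho' * sin t))).
      * apply (continuous_minus (V := R_NormedModule)); [apply continuous_const|apply continuous_id].
      * now apply cont_polar.
    + intros t. unfold F.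
      replace (th - (t + 2 * PI)) with (th - t - 2 * PI) by ring.
      assert (C := cos_period (th - t - 2 * PI) 1). assert (S := sin_period (th - t - 2 * PI) 1).
      simpl in C, S. replace (th - t - 2 * PI + 2 * 1 * PI) with (th - t) in C, S by ring.
      rewrite <- C, <- S.
      assert (C' := cos_period t 1). assert (S' := sin_period t 1).
      simpl in C', S'. replace (t + 2 * 1 * PI) with (t + 2 * PI) in C', S' by ring.
      now rewrite C', S'.
Qed.

Lemma circ_int_1_polar (g : R -> R -> R) (rho th : R) :
  cont_disk g -> 0 <= rho < 1 ->
  circ_int g (fun _ => 1) (rho * cos th) (rho * sin th) =
  RInt (fun t => g (rho * cos t) (rho * sin t)) 0 (2 * PI).
Proof.
  intros Hg Hr.
  assert (H1 : cont_disk (fun _ _ => 1)) by (intros x y _; apply continuity_2d_pt_const).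
  (* Exchanging with the constant 1 removes [th]: the mean over rotations depends on the radius
     alone. *)
  assert (E := circ_int_swap g (fun _ _ => 1) rho 0 th Hg H1 Hr ltac:(lra)).
  simpl in E. rewrite E. unfold circ_int. apply RInt_congr. intros; apply Rmult_1_l.
Qed.

Lemma radial_sol_0 (alpha : R) : radial_sol alpha 0 0 = 1.
Proof.
  unfold radial_sol. replace (0 * 0 + 0 * 0) with 0 by ring. rewrite PSeries_0.
  unfold radial_coef, gauss_term. simpl. field.
Qed.

(* The mean of the kernel over rotations and the radial series both solve the
   equation and are constant on circles, so they are proportional. *)
Lemma circ_int_ker_1 (alpha x y : R) : -1 < alpha -> disk x y ->
  circ_int (ker alpha) (fun _ => 1) x y = 2 * PI * PSeries (radial_coef alpha) (x * x + y * y).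
Proof.
  intros Ha Hd. set (rho := sqrt (x * x + y * y)).
  assert (Hrr : rho * rho = x * x + y * y) by (apply sqrt_sqrt; nra).
  assert (Hr0 : 0 <= rho) by apply sqrt_pos.
  assert (Hr1 : rho < 1) by (unfold disk in Hd; nra).
  set (W := circ_int (ker alpha) (fun _ => 1)). set (H := radial_sol alpha).
  change (W x y = 2 * PI * H x y).
  assert (HW : pde_sol alpha W) by (apply pde_sol_circ_int; [apply pde_sol_ker|intros; apply continuous_const]).
  assert (HH : pde_sol alpha H) by now apply pde_sol_radial.
  assert (W0 : W 0 0 = 2 * PI).
  { unfold W, circ_int, rot_x, rot_y.
    rewrite (RInt_congr _ (fun _ => 1)).
    - rewrite (RInt_const (V := R_CompleteNormedModule)). unfold scal; simpl; unfold mult; simpl. ring.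
    - intros t. replace (0 * cos t + 0 * sin t) with 0 by ring.
      replace (0 * cos t - 0 * sin t) with 0 by ring. rewrite ker_0. ring. }
  assert (Wc : forall u v, u * u + v * v = rho * rho -> W u v = W x y).
  { assert (P : forall u v, u * u + v * v = rho * rho ->
       W u v = RInt (fun t => ker alpha (rho * cos t) (rho * sin t)) 0 (2 * PI)).
    { intros u v Huv. destruct (polar_coord u v rho Hr0 Huv) as [th [-> ->]].
      apply circ_int_1_polar; [apply ker_cont|lra]. }
    intros u v Huv. rewrite (P u v Huv). symmetry. apply P. lra. }
  assert (Hc : forall u v, u * u + v * v = rho * rho -> H u v = H x y).
  { intros u v Huv. unfold H, radial_sol. now rewrite Huv, Hrr. }
  destruct Hr0 as [Hr0|Hr0].
  (* The cross multiples [H (x,y) * W] and [W (x,y) * H] agree on the circle, hence at the origin,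
     where [W = 2 PI] and [H = 1]. Radius 0 is treated apart, since uniqueness needs a positive
     one. *)
  - assert (E := dirichlet_unique alpha rho _ _ (conj Hr0 Hr1)
      (pde_sol_lin alpha (H x y) 0 _ _ HW HW) (pde_sol_lin alpha (W x y) 0 _ _ HH HH)
      ltac:(intros u v Huv; cbv beta; rewrite (Wc u v Huv), (Hc u v Huv); ring) 0 0 ltac:(nra)).
    cbv beta in E. unfold H in E at 2 3. rewrite W0, radial_sol_0 in E. lra.
  - rewrite <- Hr0 in Hrr. assert (x = 0) by nra. assert (y = 0) by nra. subst x y.
    rewrite W0. unfold H. rewrite radial_sol_0. ring.
Qed.

(** * Poisson representation of bounded solutions *)


Lemma radial_series_terms (alpha q : R) (n : nat) : 0 <= q -> 0 <= radial_coef alpha n * q ^ n.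
Proof. intros Hq. apply Rmult_le_pos; [apply radial_coef_nonneg|now apply pow_le]. Qed.

Lemma radial_PSeries_bounds (alpha q : R) : -1 < alpha -> 0 <= q < 1 ->
  0 <= PSeries (radial_coef alpha) q <= Series (radial_coef alpha).
Proof.
  intros Ha Hq.
  assert (E : ex_series (fun n => radial_coef alpha n * q ^ n)).
  { apply (ex_series_ext (fun n => scal (q ^ n) (radial_coef alpha n))); [intros; apply Rmult_comm|].
    exact (CV_radius_inside _ _ (radial_coef_CV alpha q Ha Hq)). }
  split.
  - apply Rle_trans with (2 := term_le_Series _ 0 (fun n => radial_series_terms alpha q n (proj1 Hq)) E).
    apply radial_series_terms. lra.
  - apply Series_le; [|now apply radial_coef_ex_series].
    intros n. split; [apply radial_series_terms; lra|].
    rewrite <- (Rmult_1_r (radial_coef alpha n)) at 2.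
    apply Rmult_le_compat_l; [apply radial_coef_nonneg|].
    rewrite <- (pow1 n). apply pow_incr. lra.
Qed.

(** Abel's theorem for nonnegative coefficients: a partial sum close to the total is a polynomial,
    close to its value at 1 when [q] is, and it lies below the power series. *)
Lemma radial_PSeries_lim (alpha eps : R) : -1 < alpha -> 0 < eps ->
  exists d, 0 < d /\ forall q, 0 <= q < 1 -> 1 - d < q ->
    Series (radial_coef alpha) - eps < PSeries (radial_coef alpha) q.
Proof.
  intros Ha He. set (A := radial_coef alpha).
  assert (EA := radial_coef_ex_series alpha Ha). fold A in EA.
  assert (He2 : 0 < eps / 2) by lra.
  assert (HS := Series_correct _ EA). apply is_series_seq, is_lim_seq_spec in HS.
  destruct (HS (mkposreal _ He2)) as [N HN]. specialize (HN N (le_n N)). simpl in HN.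
  apply Rabs_def2 in HN.
  set (p := fun q => sum_n (fun k => A k * q ^ k) N).
  assert (Hp : continuous p 1).
  { unfold p. generalize N. induction N0 as [|n IH].
    - apply continuous_ext with (fun q => A 0%nat * q ^ 0); [intros; now rewrite sum_O|].
      apply continuity_pt_filterlim, derivable_continuous_pt. apply derivable_pt_mult.
      + apply derivable_pt_const.
      + apply (derivable_pt_pow 0).
    - apply continuous_ext with (fun q => sum_n (fun k => A k * q ^ k) n + A (S n) * q ^ S n);
        [intros; now rewrite sum_n_succ|].
      apply (continuous_plus (V := R_NormedModule)); [exact IH|].
      apply continuity_pt_filterlim, derivable_continuous_pt. apply derivable_pt_mult.
      + apply derivable_pt_const.
      + apply derivable_pt_pow. }
  assert (p1 : p 1 = sum_n A N).
  { unfold p. apply sum_n_ext. intros k. rewrite pow1. apply Rmult_1_r. }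
  assert (Hp' := proj1 (filterlim_locally p (p 1)) Hp (mkposreal _ He2)).
  destruct Hp' as [d Hd]. exists d. split; [apply cond_pos|].
  intros q Hq Hqd.
  assert (B : Rabs (p q - p 1) < eps / 2) by (apply Hd; change (Rabs (q - 1) < d); apply Rabs_def1; lra).
  apply Rabs_def2 in B. rewrite p1 in B.
  assert (p q <= PSeries A q); [|lra].
  apply sum_n_le_Series; [intros; apply radial_series_terms; lra|].
  apply (ex_series_ext (fun n => scal (q ^ n) (A n))); [intros; apply Rmult_comm|].
  exact (CV_radius_inside _ _ (radial_coef_CV alpha q Ha Hq)).
Qed.

Definition ker_circ (alpha rho t : R) : R := ker alpha (rho * cos t) (rho * sin t).

Lemma ker_circ_cont (alpha rho t : R) : 0 <= rho < 1 -> continuous (ker_circ alpha rho) t.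
Proof. intros H. apply (cont_polar (ker alpha) rho); [apply ker_cont|exact H]. Qed.

Lemma RInt_ker_circ (alpha rho : R) : -1 < alpha -> 0 <= rho < 1 ->
  RInt (ker_circ alpha rho) 0 (2 * PI) = 2 * PI * PSeries (radial_coef alpha) (rho * rho).
Proof.
  intros Ha Hr. rewrite <- (polar_sq rho 0).
  rewrite <- circ_int_ker_1; [|exact Ha|now apply disk_polar].
  symmetry. apply circ_int_1_polar; [apply ker_cont|exact Hr].
Qed.

(** * Concentration of the kernel near the point 1 *)

Lemma exp_mult_ln_small (b e : R) : 0 < b -> 0 < e ->
  exists d, 0 < d /\ forall p, 0 < p < d -> exp (b * ln p) < e.
Proof.
  intros Hb He. exists (exp (ln e / b)). split; [apply exp_pos|].
  intros p Hp. rewrite <- (exp_ln e He). apply exp_increasing.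
  assert (L : ln p < ln e / b) by (rewrite <- (ln_exp (ln e / b)); apply ln_increasing; lra).
  apply Rlt_div_r in L; lra.
Qed.

(** Away from angle 0 the denominator is bounded below while the numerator tends to 0. Measuring the
    distance by [1 - cos t] treats both ends of the interval from 0 to [2 PI] alike. *)
Lemma ker_circ_small (alpha d e : R) : -1 < alpha -> 0 < d -> 0 < e ->
  exists r0, 1 / 2 <= r0 < 1 /\ forall rho t, r0 < rho < 1 -> cos t <= 1 - d -> ker_circ alpha rho t < e.
Proof.
  intros Ha Hd He.
  set (C := exp ((alpha / 2 + 1) * ln d)). assert (HC : 0 < C) by apply exp_pos.
  destruct (exp_mult_ln_small (alpha + 1) (e * C)) as [m [Hm Hsm]]; [lra|now apply Rmult_lt_0_compat|].
  (* [rho > 1/2] gives [|1 - rho e^(it)|^2 >= 1 - cos t >= d], and [rho > 1 - m/2] gives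
     [1 - rho^2 < m]. *)
  exists (Rmax (1 / 2) (1 - m / 2)).
  split; [split; [apply Rmax_l|apply Rmax_lub_lt; lra]|].
  intros rho t [Hr1 Hr2] Ht.
  assert (R1 := Rle_lt_trans _ _ _ (Rmax_l _ _) Hr1).
  assert (R2 := Rle_lt_trans _ _ _ (Rmax_r _ _) Hr1).
  unfold ker_circ, ker. rewrite polar_sq.
  assert (Hs := sin2_cos2 t). unfold Rsqr in Hs.
  replace ((1 - rho * cos t) * (1 - rho * cos t) + rho * sin t * (rho * sin t))
    with ((1 - rho) * (1 - rho) + 2 * rho * (1 - cos t)).
  2:{ replace (rho * sin t * (rho * sin t)) with (rho * rho * (1 - cos t * cos t)) by (rewrite <- Hs; ring). ring. }
  set (q := (1 - rho) * (1 - rho) + 2 * rho * (1 - cos t)).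
  assert (Hq : d <= q) by (unfold q; nra).
  assert (Hlq : ln d <= ln q) by (apply ln_le; lra).
  apply Rle_lt_trans with (exp ((alpha + 1) * ln (1 - rho * rho)) / C).
  - unfold C, Rdiv. rewrite <- exp_Ropp, <- exp_plus.
    assert (L : (alpha + 1) * ln (1 - rho * rho) - (alpha * / 2 + 1) * ln q
      <= (alpha + 1) * ln (1 - rho * rho) + - ((alpha * / 2 + 1) * ln d)) by nra.
    destruct L as [L|L]; [left; now apply exp_increasing|right; now rewrite L].
  - apply Rlt_div_l; [exact HC|]. apply Hsm. split; nra.
Qed.

Lemma rot_near (x y d : R) : x * x + y * y < 1 -> 0 < d ->
  exists m, 0 < m /\ forall t, 1 - m < cos t ->
    Rabs (rot_x x y t - x) < d /\ Rabs (rot_y x y t - y) < d.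
Proof.
  intros Hxy Hd. set (k := Rmin d 1).
  assert (Hk : 0 < k <= 1) by (unfold k; split; [apply Rmin_glb_lt; lra|apply Rmin_r]).
  assert (Hkd : k <= d) by apply Rmin_l.
  (* Then [1 - cos t < k^2 / 8], so [sin^2 t = (1 - cos t)(1 + cos t) <= k^2 / 4]; the displacement
     is at most [k/8 + k/2 < d]. *)
  exists (k * k / 8). split; [nra|].
  intros t Ht.
  assert (Hs := sin2_cos2 t). unfold Rsqr in Hs. assert (Hc := COS_bound t).
  assert (Hsin : Rabs (sin t) <= k / 2).
  { apply Rabs_le. nra. }
  assert (Hcos : Rabs (cos t - 1) <= k / 8) by (apply Rabs_le; nra).
  assert (Hx : Rabs x <= 1) by (apply Rabs_le; nra).
  assert (Hy : Rabs y <= 1) by (apply Rabs_le; nra).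
  assert (P : forall a b c, Rabs a <= 1 -> Rabs b <= c -> Rabs (a * b) <= c).
  { intros a b c H1 H2. rewrite Rabs_mult. assert (H3 := Rabs_pos a). assert (H4 := Rabs_pos b). nra. }
  unfold rot_x, rot_y. split.
  - replace (x * cos t + y * sin t - x) with (x * (cos t - 1) + y * sin t) by ring.
    eapply Rle_lt_trans; [apply Rabs_triang|].
    assert (A1 := P _ _ _ Hx Hcos). assert (A2 := P _ _ _ Hy Hsin). lra.
  - replace (y * cos t - x * sin t - y) with (y * (cos t - 1) + - (x * sin t)) by ring.
    eapply Rle_lt_trans; [apply Rabs_triang|]. rewrite Rabs_Ropp.
    assert (A1 := P _ _ _ Hy Hcos). assert (A2 := P _ _ _ Hx Hsin). lra.
Qed.

(* [ker_circ alpha rho] is an approximate identity as [rho] tends to 1. *)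
Lemma circ_int_ker_circ_lim (alpha M : R) (u : R -> R -> R) (x y eps : R) :
  -1 < alpha -> cont_disk u -> (forall x y, disk x y -> Rabs (u x y) <= M) ->
  disk x y -> 0 < eps ->
  exists r0, 1 / 2 <= r0 < 1 /\ forall rho, r0 < rho < 1 ->
    Rabs (circ_int u (ker_circ alpha rho) x y
          - 2 * PI * Series (radial_coef alpha) * u x y) < eps.
Proof.
  intros Ha Hu HM Hd He. assert (Hpi := two_PI_pos).
  assert (HM0 : 0 <= M) by (apply Rle_trans with (2 := HM x y Hd); apply Rabs_pos).
  set (S1 := Series (radial_coef alpha)).
  assert (HS1 : 0 <= S1).
  { apply Rle_trans with (1 := radial_coef_nonneg alpha 0).
    apply term_le_Series; [apply radial_coef_nonneg|now apply radial_coef_ex_series]. }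
  (* [e1], [e2] and [e3] control three errors, each by [eps/4]: the oscillation of [u] near the
     point, the kernel far from angle 0, and the missing mass. The added 1s keep the denominators
     positive. *)
  set (e1 := eps / (4 * (2 * PI * (S1 + 1)))).
  assert (He1 : 0 < e1) by (apply Rdiv_lt_0_compat; [lra|]; apply Rmult_lt_0_compat; [lra|]; apply Rmult_lt_0_compat; lra).
  destruct (Hu x y Hd (mkposreal _ He1)) as [d Hdc]. simpl in Hdc.
  destruct (rot_near x y d Hd (cond_pos d)) as [m [Hm Hrot]].
  set (e2 := eps / (4 * (2 * PI * (2 * M + 1)))).
  assert (He2 : 0 < e2) by (apply Rdiv_lt_0_compat; [lra|]; apply Rmult_lt_0_compat; [lra|]; apply Rmult_lt_0_compat; lra).
  destruct (ker_circ_small alpha m e2 Ha Hm He2) as [r1 [Hr1 Hsm]].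
  set (e3 := eps / (4 * (2 * PI * (M + 1)))).
  assert (He3 : 0 < e3) by (apply Rdiv_lt_0_compat; [lra|]; apply Rmult_lt_0_compat; [lra|]; apply Rmult_lt_0_compat; lra).
  destruct (radial_PSeries_lim alpha e3 Ha He3) as [d3 [Hd3 Hlim]]. fold S1 in Hlim.
  exists (Rmax r1 (1 - d3 / 2)).
  split; [split; [apply Rle_trans with r1; [lra|apply Rmax_l]|apply Rmax_lub_lt; lra]|].
  intros rho [Hrho Hrho1].
  assert (R1 := Rle_lt_trans _ _ _ (Rmax_l _ _) Hrho).
  assert (R2 := Rle_lt_trans _ _ _ (Rmax_r _ _) Hrho).
  assert (Hr : 0 <= rho < 1) by lra.
  set (P := PSeries (radial_coef alpha) (rho * rho)).
  assert (HP : 0 <= P <= S1) by (apply radial_PSeries_bounds; [exact Ha|split; nra]).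
  assert (HPl : S1 - e3 < P) by (apply Hlim; [split; nra|nra]).
  assert (HI : RInt (ker_circ alpha rho) 0 (2 * PI) = 2 * PI * P) by now apply RInt_ker_circ.
  assert (Hkc : forall t, continuous (ker_circ alpha rho) t) by (intros; now apply ker_circ_cont).
  assert (Hkex : ex_RInt (ker_circ alpha rho) 0 (2 * PI))
    by (apply (ex_RInt_continuous (V := R_CompleteNormedModule)); auto).
  assert (Hex := circ_int_ex u _ x y Hu Hkc Hd).
  assert (Hex2 : ex_RInt (fun t => u x y * ker_circ alpha rho t) 0 (2 * PI))
    by now apply (ex_RInt_scal (V := R_NormedModule)).
  set (D := fun t => u (rot_x x y t) (rot_y x y t) * ker_circ alpha rho t - u x y * ker_circ alpha rho t).
  assert (HDex : ex_RInt D 0 (2 * PI)) by now apply (ex_RInt_minus (V := R_NormedModule)).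
  assert (HD : RInt D 0 (2 * PI) = circ_int u (ker_circ alpha rho) x y - u x y * (2 * PI * P)).
  { unfold D. rewrite (RInt_minus (V := R_CompleteNormedModule)) by assumption.
    rewrite (RInt_scal (V := R_CompleteNormedModule)) by assumption. rewrite HI. reflexivity. }
  assert (HDb : Rabs (RInt D 0 (2 * PI)) <= e1 * (2 * PI * P) + 2 * PI * (2 * M * e2)).
  { apply Rle_trans with (1 := abs_RInt_le D 0 (2 * PI) ltac:(lra) HDex).
    (* The sum of the near and far bounds dominates the integrand at every [t], so the integral need
       not be split. *)
    assert (HI2 : is_RInt (fun t => e1 * ker_circ alpha rho t + 2 * M * e2) 0 (2 * PI)
       (e1 * (2 * PI * P) + 2 * PI * (2 * M * e2))).
    { apply (is_RInt_plus (V := R_NormedModule)).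
      - apply (is_RInt_scal (V := R_NormedModule)). rewrite <- HI.
        now apply (RInt_correct (V := R_CompleteNormedModule)).
      - assert (K := is_RInt_const (V := R_NormedModule) 0 (2 * PI) (2 * M * e2)).
        unfold scal in K; simpl in K; unfold mult in K; simpl in K. rewrite Rminus_0_r in K. exact K. }
    rewrite <- (is_RInt_unique _ _ _ _ HI2).
    apply RInt_le; [lra| |now exists (e1 * (2 * PI * P) + 2 * PI * (2 * M * e2))|].
    - apply (ex_RInt_norm D), HDex.
    - intros t _. unfold D. rewrite <- Rmult_minus_distr_r, Rabs_mult.
      assert (Kp : 0 < ker_circ alpha rho t) by apply ker_pos.
      rewrite (Rabs_right (ker_circ alpha rho t)) by lra.
      destruct (Rlt_or_le (1 - m) (cos t)) as [Hc|Hc].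
      + destruct (Hrot t Hc) as [A1 A2].
        assert (B := Hdc _ _ A1 A2).
        assert (0 <= 2 * M * e2) by (apply Rmult_le_pos; lra). nra.
      + assert (B := Hsm rho t ltac:(lra) Hc).
        assert (U1 := HM _ _ (disk_rot x y t Hd)). assert (U2 := HM x y Hd).
        assert (U3 := Rabs_triang (u (rot_x x y t) (rot_y x y t)) (- u x y)).
        rewrite Rabs_Ropp in U3.
        assert (U4 : Rabs (u (rot_x x y t) (rot_y x y t) - u x y) <= 2 * M) by (unfold Rminus; lra).
        apply Rle_trans with (2 * M * e2).
        * apply Rmult_le_compat; [apply Rabs_pos|lra|exact U4|lra].
        * assert (0 <= e1 * ker_circ alpha rho t) by (apply Rmult_le_pos; lra). lra. }
  replace (circ_int u (ker_circ alpha rho) x y - 2 * PI * S1 * u x y)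
    with (RInt D 0 (2 * PI) + - (u x y * (2 * PI * (S1 - P)))) by (rewrite HD; ring).
  eapply Rle_lt_trans; [apply Rabs_triang|]. rewrite Rabs_Ropp.
  assert (T1 : e1 * (2 * PI * P) <= eps / 4).
  { apply Rle_trans with (e1 * (2 * PI * (S1 + 1))).
    - apply Rmult_le_compat_l; [lra|]. apply Rmult_le_compat_l; lra.
    - right. unfold e1. field. split; [lra|]. assert (Hq := PI_RGT_0). lra. }
  assert (T2 : 2 * PI * (2 * M * e2) <= eps / 4).
  { apply Rle_trans with (2 * PI * ((2 * M + 1) * e2)).
    - apply Rmult_le_compat_l; [lra|]. apply Rmult_le_compat_r; lra.
    - right. unfold e2. field. split; [lra|]. assert (Hq := PI_RGT_0). lra. }
  assert (T3 : Rabs (u x y * (2 * PI * (S1 - P))) <= eps / 4).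
  { rewrite Rabs_mult. rewrite (Rabs_right (2 * PI * (S1 - P))) by (apply Rle_ge, Rmult_le_pos; lra).
    apply Rle_trans with ((M + 1) * (2 * PI * e3)).
    - apply Rmult_le_compat; [apply Rabs_pos|apply Rmult_le_pos; lra| |].
      + assert (U2 := HM x y Hd). lra.
      + apply Rmult_le_compat_l; lra.
    - right. unfold e3. field. split; [lra|]. assert (Hq := PI_RGT_0). lra. }
  lra.
Qed.

(* Both convolutions solve the equation in the disk; on the circle of radius
   [rho] they agree by [circ_int_swap], hence they agree inside. *)
Lemma circ_int_ker_exchange (alpha rho : R) (u : R -> R -> R) (x y : R) :
  pde_sol alpha u -> 0 < rho < 1 -> x * x + y * y <= rho * rho ->
  circ_int (ker alpha) (fun t => u (rho * cos t) (rho * sin t)) x y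
  = circ_int u (ker_circ alpha rho) x y.
Proof.
  intros Hu Hr. assert (Hc := pde_sol_cont _ _ Hu).
  apply (dirichlet_unique alpha rho); [exact Hr| | |].
  - apply pde_sol_circ_int; [apply pde_sol_ker|]. apply cont_polar; [exact Hc|lra].
  - apply pde_sol_circ_int; [exact Hu|]. intros; apply ker_circ_cont; lra.
  - intros a b Hab. destruct (polar_coord a b rho ltac:(lra) Hab) as [th [-> ->]].
    apply circ_int_swap; [apply ker_cont|exact Hc|lra|lra].
Qed.

(** At a fixed radius [rho] both points are represented by the same function bounded by [M].
    Bounding it away leaves an integral of kernels in which [rho] does not occur, so no limit of the
    representing functions is needed. *)
Lemma two_point_bound (alpha M l : R) (u : R -> R -> R) (x1 y1 x2 y2 : R) :
  -1 < alpha -> pde_sol alpha u -> (forall x y, disk x y -> Rabs (u x y) <= M) ->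
  disk x1 y1 -> disk x2 y2 ->
  2 * PI * Series (radial_coef alpha) * Rabs (u x1 y1 - l * u x2 y2) <=
  M * RInt (fun t => Rabs (ker alpha (rot_x x1 y1 t) (rot_y x1 y1 t)
                           - l * ker alpha (rot_x x2 y2 t) (rot_y x2 y2 t))) 0 (2 * PI).
Proof.
  intros Ha Hu HM H1 H2. assert (Hpi := two_PI_pos).
  assert (Hc := pde_sol_cont _ _ Hu).
  assert (HM0 : 0 <= M) by (apply Rle_trans with (2 := HM x1 y1 H1); apply Rabs_pos).
  set (S1 := Series (radial_coef alpha)).
  assert (HS1 : 0 <= S1).
  { apply Rle_trans with (1 := radial_coef_nonneg alpha 0).
    apply term_le_Series; [apply radial_coef_nonneg|now apply radial_coef_ex_series]. }
  apply Rle_trans with (Rabs (2 * PI * S1 * u x1 y1 - l * (2 * PI * S1 * u x2 y2))).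
  { right. replace (2 * PI * S1 * u x1 y1 - l * (2 * PI * S1 * u x2 y2))
      with (2 * PI * S1 * (u x1 y1 - l * u x2 y2)) by ring.
    rewrite Rabs_mult, (Rabs_right (2 * PI * S1)); [reflexivity|]. apply Rle_ge, Rmult_le_pos; lra. }
  apply le_epsilon. intros eps He.
  set (e := eps / (Rabs l + 1)).
  assert (Hl := Rabs_pos l).
  assert (He0 : 0 < e) by (apply Rdiv_lt_0_compat; lra).
  destruct (circ_int_ker_circ_lim alpha M u x1 y1 e Ha Hc HM H1 He0) as [r1 [Hr1 L1]].
  destruct (circ_int_ker_circ_lim alpha M u x2 y2 e Ha Hc HM H2 He0) as [r2 [Hr2 L2]].
  fold S1 in L1, L2.
  set (q1 := sqrt (x1 * x1 + y1 * y1)). set (q2 := sqrt (x2 * x2 + y2 * y2)).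
  assert (Q1 : q1 * q1 = x1 * x1 + y1 * y1) by (apply sqrt_sqrt; nra).
  assert (Q2 : q2 * q2 = x2 * x2 + y2 * y2) by (apply sqrt_sqrt; nra).
  assert (Q1p : 0 <= q1) by apply sqrt_pos. assert (Q2p : 0 <= q2) by apply sqrt_pos.
  assert (Q1l : q1 < 1) by (unfold disk in H1; nra). assert (Q2l : q2 < 1) by (unfold disk in H2; nra).
  (* The radius must exceed both thresholds of the approximate identity, and both moduli for the
     exchange to apply. *)
  set (m := Rmax (Rmax r1 r2) (Rmax q1 q2)).
  assert (Hm1 : m < 1) by (unfold m; repeat apply Rmax_lub_lt; lra).
  assert (Hmr1 : r1 <= m) by (apply Rle_trans with (2 := Rmax_l _ _), Rmax_l).
  assert (Hmr2 : r2 <= m) by (apply Rle_trans with (2 := Rmax_l _ _), Rmax_r).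
  assert (Hmq1 : q1 <= m) by (apply Rle_trans with (2 := Rmax_r _ _), Rmax_l).
  assert (Hmq2 : q2 <= m) by (apply Rle_trans with (2 := Rmax_r _ _), Rmax_r).
  set (rho := (m + 1) / 2).
  assert (Hrho : m < rho < 1) by (unfold rho; lra).
  specialize (L1 rho ltac:(lra)). specialize (L2 rho ltac:(lra)).
  rewrite <- circ_int_ker_exchange in L1 by (try assumption; try lra; nra).
  rewrite <- circ_int_ker_exchange in L2 by (try assumption; try lra; nra).
  set (ur := fun t => u (rho * cos t) (rho * sin t)) in *.
  assert (Hur : forall t, continuous ur t) by (apply cont_polar; [exact Hc|lra]).
  assert (Hurb : forall t, Rabs (ur t) <= M) by (intros; apply HM, disk_polar; lra).
  set (I1 := circ_int (ker alpha) ur x1 y1) in *. set (I2 := circ_int (ker alpha) ur x2 y2) in *.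
  assert (HI : Rabs (I1 - l * I2) <= M * RInt (fun t => Rabs (ker alpha (rot_x x1 y1 t) (rot_y x1 y1 t)
                           - l * ker alpha (rot_x x2 y2 t) (rot_y x2 y2 t))) 0 (2 * PI)).
  { set (k1 := fun t => ker alpha (rot_x x1 y1 t) (rot_y x1 y1 t)).
    set (k2 := fun t => ker alpha (rot_x x2 y2 t) (rot_y x2 y2 t)).
    assert (C1 : forall t, continuous k1 t) by (intros; apply cont_disk_rot; [apply ker_cont|exact H1]).
    assert (C2 : forall t, continuous k2 t) by (intros; apply cont_disk_rot; [apply ker_cont|exact H2]).
    assert (CD : forall t, continuous (fun t => k1 t - l * k2 t) t).
    { intros t. apply (continuous_minus (V := R_NormedModule)); [apply C1|].
      apply (continuous_mult (K := R_AbsRing)); [apply continuous_const|apply C2]. }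
    assert (CDu : forall t, continuous (fun t => (k1 t - l * k2 t) * ur t) t).
    { intros t. apply (continuous_mult (K := R_AbsRing)); [apply CD|apply Hur]. }
    assert (Ex : forall h : R -> R, (forall t, continuous h t) -> ex_RInt h 0 (2 * PI)).
    { intros h Hh. apply (ex_RInt_continuous (V := R_CompleteNormedModule)); auto. }
    assert (E : I1 - l * I2 = RInt (fun t => (k1 t - l * k2 t) * ur t) 0 (2 * PI)).
    { assert (J1 : is_RInt (fun t => k1 t * ur t) 0 (2 * PI) I1)
        by (apply (RInt_correct (V := R_CompleteNormedModule)), circ_int_ex; [apply ker_cont|exact Hur|exact H1]).
      assert (J2 : is_RInt (fun t => k2 t * ur t) 0 (2 * PI) I2)
        by (apply (RInt_correct (V := R_CompleteNormedModule)), circ_int_ex; [apply ker_cont|exact Hur|exact H2]).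
      assert (J := is_RInt_minus (V := R_NormedModule) _ _ _ _ _ _ J1 (is_RInt_scal (V := R_NormedModule) _ _ _ l _ J2)).
      symmetry. apply (is_RInt_unique (V := R_CompleteNormedModule)).
      apply is_RInt_ext with (2 := J). intros t _.
      change (k1 t * ur t - l * (k2 t * ur t) = (k1 t - l * k2 t) * ur t :> R). ring. }
    rewrite E.
    apply Rle_trans with (1 := abs_RInt_le _ 0 (2 * PI) ltac:(lra) (Ex _ CDu)).
    assert (CA : forall t, continuous (fun t => Rabs (k1 t - l * k2 t)) t).
    { intros t. apply (continuous_comp (fun t => k1 t - l * k2 t) Rabs); [apply CD|].
      apply continuity_pt_filterlim, Rcontinuity_abs. }
    apply Rle_trans with (RInt (fun t => M * Rabs (k1 t - l * k2 t)) 0 (2 * PI)).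
    - apply RInt_le; [lra|exact (ex_RInt_norm _ _ _ (Ex _ CDu))| |].
      + apply Ex. intros t. apply (continuous_mult (K := R_AbsRing)); [apply continuous_const|apply CA].
      + intros t _. rewrite Rabs_mult, Rmult_comm. apply Rmult_le_compat_r; [apply Rabs_pos|apply Hurb].
    - right. apply (RInt_scal (V := R_CompleteNormedModule) (fun t => Rabs (k1 t - l * k2 t)) 0 (2 * PI) M).
      now apply Ex. }
  set (RR := M * RInt _ 0 (2 * PI)) in *.
  (* The estimated part plus the two approximation errors, which together weigh at most
     [e (|l| + 1) = eps]. *)
  replace (2 * PI * S1 * u x1 y1 - l * (2 * PI * S1 * u x2 y2))
    with ((I1 - l * I2) + (- (I1 - 2 * PI * S1 * u x1 y1) + l * (I2 - 2 * PI * S1 * u x2 y2))) by ring.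
  eapply Rle_trans; [apply Rabs_triang|]. apply Rplus_le_compat; [exact HI|].
  eapply Rle_trans; [apply Rabs_triang|]. rewrite Rabs_Ropp, Rabs_mult.
  apply Rle_trans with (e * (Rabs l + 1)).
  - assert (Rabs l * Rabs (I2 - 2 * PI * S1 * u x2 y2) <= Rabs l * e) by (apply Rmult_le_compat_l; lra). lra.
  - unfold e. right. field. lra.
Qed.

(** * Estimates for real solutions *)


Lemma Cmod_sqr (x y : R) : Cmod (x, y) * Cmod (x, y) = x * x + y * y.
Proof. unfold Cmod; simpl fst; simpl snd. rewrite sqrt_sqrt; [ring|nra]. Qed.

Lemma in_disk_disk (x y : R) : in_disk (x, y) <-> disk x y.
Proof.
  unfold in_disk, disk. assert (H := Cmod_sqr x y). assert (H0 := Cmod_ge_0 (x, y)).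
  split; intros; nra.
Qed.

Lemma c_const_pos (alpha : R) : -1 < alpha -> 0 < c_const alpha.
Proof.
  intros Ha. unfold c_const. apply Rdiv_lt_0_compat; [apply pow_lt|]; apply Gamma_gt_0; lra.
Qed.

Lemma c_const_Series (alpha : R) : -1 < alpha -> c_const alpha * Series (radial_coef alpha) = 1.
Proof.
  intros Ha.
  assert (G := gauss_sum (- alpha / 2) ltac:(lra)).
  replace (Series (radial_coef alpha)) with (Series (gauss_term (- alpha / 2) 1)) by reflexivity.
  rewrite G. unfold c_const.
  replace (1 - 2 * (- alpha / 2)) with (1 + alpha) by field.
  replace (1 - - alpha / 2) with (alpha / 2 + 1) by field.
  assert (G1 := Gamma_gt_0 (1 + alpha) ltac:(lra)). assert (G2 := Gamma_gt_0 (alpha / 2 + 1) ltac:(lra)).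
  field. lra.
Qed.

Lemma K_kernel_ker (alpha x y : R) : disk x y -> K_kernel alpha (x, y) = c_const alpha * ker alpha x y.
Proof.
  intros Hd. unfold K_kernel, ker. f_equal.
  replace (Cmod (x, y) ^ 2) with (x * x + y * y) by (rewrite <- Cmod_sqr; ring).
  assert (Hq := disk_den_pos x y Hd).
  replace (Cmod (1 - (x, y))%C) with (sqrt ((1 - x) * (1 - x) + y * y)).
  2:{ unfold Cmod. f_equal. simpl. ring. }
  unfold Rpower at 2. assert (Lq : ln (sqrt ((1 - x) * (1 - x) + y * y)) = ln ((1 - x) * (1 - x) + y * y) / 2).
  { rewrite <- (sqrt_sqrt ((1 - x) * (1 - x) + y * y)) at 2 by lra.
    assert (Hs := sqrt_lt_R0 _ Hq). rewrite ln_mult by exact Hs. field. }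
  rewrite Lq.
  set (q := ln ((1 - x) * (1 - x) + y * y)). set (p := 1 - (x * x + y * y)).
  unfold Rminus, Rpower. rewrite exp_plus, exp_Ropp. unfold Rdiv. do 3 f_equal. field.
Qed.

Lemma K_kernel_0 (alpha : R) : K_kernel alpha (RtoC 0) = c_const alpha.
Proof.
  unfold RtoC. rewrite K_kernel_ker by (unfold disk; lra). rewrite ker_0. ring.
Qed.

Lemma M_mean_PSeries (alpha r : R) : -1 < alpha -> 0 <= r < 1 ->
  M_mean alpha r = c_const alpha * PSeries (radial_coef alpha) (r * r).
Proof.
  intros Ha Hr. unfold M_mean.
  rewrite (RInt_congr _ (fun t => c_const alpha * ker_circ alpha r t)).
  - rewrite (RInt_scal (V := R_CompleteNormedModule) (ker_circ alpha r)).
    + rewrite RInt_ker_circ by assumption. unfold scal; simpl; unfold mult; simpl.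
      field. apply PI_neq0.
    + apply (ex_RInt_continuous (V := R_CompleteNormedModule)). intros; now apply ker_circ_cont.
  - intros t. replace (RtoC r * cis t)%C with (r * cos t, r * sin t).
    + rewrite K_kernel_ker by now apply disk_polar. reflexivity.
    + unfold cis, RtoC, Cmult; simpl. f_equal; ring.
Qed.

Lemma mean_K_kernel_rot (alpha x y : R) : -1 < alpha -> disk x y ->
  1 / (2 * PI) * RInt (fun t => K_kernel alpha ((x, y) * cis (- t))%C) 0 (2 * PI)
  = c_const alpha * PSeries (radial_coef alpha) (x * x + y * y).
Proof.
  intros Ha Hd.
  rewrite (RInt_congr _ (fun t => c_const alpha * (ker alpha (rot_x x y t) (rot_y x y t) * 1))).
  - rewrite (RInt_scal (V := R_CompleteNormedModule) (fun t => ker alpha (rot_x x y t) (rot_y x y t) * 1)).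
    + assert (E := circ_int_ker_1 alpha x y Ha Hd). unfold circ_int in E. rewrite E.
      unfold scal; simpl; unfold mult; simpl. field. apply PI_neq0.
    + apply circ_int_ex; [apply ker_cont|intros; apply continuous_const|exact Hd].
  - intros t. replace ((x, y) * cis (- t))%C with (rot_x x y t, rot_y x y t).
    + rewrite K_kernel_ker by now apply disk_rot. ring.
    + unfold cis, Cmult, rot_x, rot_y; simpl. rewrite cos_neg, sin_neg. f_equal; ring.
Qed.

(** On the circle [|1 - z| <= 1 + r], and [(1 - r^2)^(alpha+1) / (1 + r)^(alpha+2)] simplifies to
    the left-hand side. *)
Lemma ker_lower (alpha x y r : R) : -1 < alpha -> 0 <= r < 1 -> x * x + y * y = r * r ->
  Rpower (1 - r) (alpha + 1) / (1 + r) <= ker alpha x y.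
Proof.
  intros Ha Hr Hxy. assert (Hd : disk x y) by (apply (disk_of_radius _ _ r); lra).
  assert (Hq := disk_den_pos x y Hd).
  unfold ker, Rpower, Rdiv. rewrite Hxy.
  replace (1 - r * r) with ((1 - r) * (1 + r)) by ring. rewrite ln_mult by lra.
  replace (/ (1 + r)) with (exp (- ln (1 + r))) by (rewrite exp_Ropp, exp_ln by lra; reflexivity).
  rewrite <- exp_plus.
  assert (L : ln ((1 - x) * (1 - x) + y * y) <= ln (1 + r) + ln (1 + r)).
  { rewrite <- ln_mult by lra. apply ln_le; [exact Hq|]. assert (- r <= x) by nra. nra. }
  assert (E : (alpha + 1) * ln (1 - r) + - ln (1 + r) <=
    (alpha + 1) * (ln (1 - r) + ln (1 + r)) - (alpha * / 2 + 1) * ln ((1 - x) * (1 - x) + y * y)) by nra.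
  destruct E as [E|E]; [left; now apply exp_increasing|right; now rewrite E].
Qed.

(** The first summand bounds the gradient of [(alpha+1) ln (1 - |z|^2)], the second that of
    [(alpha+2) ln |1 - z|]. Times [1 - r^2], the sum is the bracket of the theorem. *)
Definition log_slope (alpha r : R) : R := 2 * (alpha + 1) * r / (1 - r * r) + (alpha + 2) / (1 - r).

Lemma ln_diff_le (a b : R) : 0 < a -> 0 < b -> ln b - ln a <= (b - a) / a.
Proof.
  intros Ha Hb. rewrite <- ln_div by assumption.
  assert (H : 0 < b / a) by now apply Rdiv_lt_0_compat.
  assert (L := exp_ineq1_le (ln (b / a))). rewrite exp_ln in L by exact H.
  replace ((b - a) / a) with (b / a - 1) by (field; lra). lra.
Qed.

(* Harnack inequality: the logarithm of the kernel has gradient at most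
   [log_slope alpha r] on the disk of radius [r]. *)
Lemma ker_harnack (alpha r s a1 a2 b1 b2 : R) :
  -1 < alpha -> r < 1 -> Cmod (a1, a2) <= r -> Cmod (b1, b2) <= r ->
  Cmod (b1 - a1, b2 - a2) <= s ->
  ker alpha b1 b2 <= ker alpha a1 a2 * exp (log_slope alpha r * s).
Proof.
  intros Ha Hr HA HB HS.
  assert (A0 := Cmod_ge_0 (a1, a2)). assert (B0 := Cmod_ge_0 (b1, b2)).
  assert (S0 := Cmod_ge_0 (b1 - a1, b2 - a2)).
  assert (A2 := Cmod_sqr a1 a2). assert (B2 := Cmod_sqr b1 b2).
  assert (T1 : Cmod (a1, a2) <= Cmod (b1, b2) + s).
  { replace (a1, a2) with (Cplus (b1, b2) (Copp (b1 - a1, b2 - a2)))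
      by (unfold Cplus, Copp; simpl; f_equal; ring).
    eapply Rle_trans; [apply Cmod_triangle|]. rewrite Cmod_opp. lra. }
  set (qa := Cmod (1 - a1, a2)). set (qb := Cmod (1 - b1, b2)).
  assert (QA : qa * qa = (1 - a1) * (1 - a1) + a2 * a2) by apply Cmod_sqr.
  assert (QB : qb * qb = (1 - b1) * (1 - b1) + b2 * b2) by apply Cmod_sqr.
  assert (T2 : qa <= qb + s).
  { unfold qa, qb. replace (1 - a1, a2) with (Cplus (1 - b1, b2) (b1 - a1, - (b2 - a2)))
      by (unfold Cplus; simpl; f_equal; ring).
    eapply Rle_trans; [apply Cmod_triangle|]. apply Rplus_le_compat_l.
    apply Rle_trans with (2 := HS). right. unfold Cmod; simpl. f_equal. ring. }
  assert (Qpos : forall u v, Cmod (u, v) <= r -> 1 - r <= Cmod (1 - u, v)).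
  { intros u v Huv. assert (K : Cmod (1, 0) <= Cmod (1 - u, v) + Cmod (u, - v)).
    { replace (1, 0) with (Cplus (1 - u, v) (u, - v)) by (unfold Cplus; simpl; f_equal; ring).
      apply Cmod_triangle. }
    replace (Cmod (1, 0)) with 1 in K by (symmetry; exact Cmod_1).
    replace (Cmod (u, - v)) with (Cmod (u, v)) in K by (unfold Cmod; simpl; f_equal; ring). lra. }
  assert (QApos := Qpos _ _ HA). assert (QBpos := Qpos _ _ HB). fold qa in QApos. fold qb in QBpos.
  assert (Pa : 1 - r * r <= 1 - (a1 * a1 + a2 * a2)) by nra.
  assert (Pb : 1 - r * r <= 1 - (b1 * b1 + b2 * b2)) by nra.
  assert (Hr0 : 0 <= r) by lra. assert (Hrr : 0 < 1 - r * r) by nra.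
  assert (L1 : ln (1 - (b1 * b1 + b2 * b2)) - ln (1 - (a1 * a1 + a2 * a2)) <= 2 * r * s / (1 - r * r)).
  { eapply Rle_trans; [apply ln_diff_le; lra|].
    assert (N : 1 - (b1 * b1 + b2 * b2) - (1 - (a1 * a1 + a2 * a2)) <= 2 * r * s).
    { rewrite <- A2, <- B2.
      assert ((Cmod (a1, a2) - Cmod (b1, b2)) * (Cmod (a1, a2) + Cmod (b1, b2))
              <= s * (Cmod (a1, a2) + Cmod (b1, b2))) by (apply Rmult_le_compat_r; lra).
      assert (s * (Cmod (a1, a2) + Cmod (b1, b2)) <= s * (2 * r)) by (apply Rmult_le_compat_l; lra).
      lra. }
    apply Rle_trans with (2 * r * s / (1 - (a1 * a1 + a2 * a2))).
    - apply Rmult_le_compat_r; [left; apply Rinv_0_lt_compat; lra|exact N].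
    - apply Rmult_le_compat_l; [|apply Rinv_le_contravar; lra].
      apply Rmult_le_pos; lra. }
  assert (L2 : ln qa - ln qb <= s / (1 - r)).
  { eapply Rle_trans; [apply ln_diff_le; lra|].
    apply Rle_trans with (s / qb).
    - apply Rmult_le_compat_r; [left; apply Rinv_0_lt_compat; lra|lra].
    - apply Rmult_le_compat_l; [lra|]. apply Rinv_le_contravar; lra. }
  unfold ker. rewrite <- QA, <- QB, !ln_mult by lra. rewrite <- exp_plus.
  assert (E : (alpha + 1) * ln (1 - (b1 * b1 + b2 * b2)) - (alpha / 2 + 1) * (ln qb + ln qb) <=
    (alpha + 1) * ln (1 - (a1 * a1 + a2 * a2)) - (alpha / 2 + 1) * (ln qa + ln qa) + log_slope alpha r * s).
  { replace (log_slope alpha r * s) with ((alpha + 1) * (2 * r * s / (1 - r * r)) + (alpha + 2) * (s / (1 - r)))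
      by (unfold log_slope; field; lra).
    nra. }
  destruct E as [E|E]; [left; now apply exp_increasing|right; now rewrite E].
Qed.

Lemma Cmod_rot (x y t : R) : Cmod (rot_x x y t, rot_y x y t) = Cmod (x, y).
Proof.
  unfold Cmod; simpl. f_equal. assert (H := rot_sq x y t). lra.
Qed.

Lemma bound_nonneg (M : R) (u : R -> R -> R) :
  (forall x y, disk x y -> Rabs (u x y) <= M) -> 0 <= M.
Proof. intros HM. apply Rle_trans with (2 := HM 0 0 ltac:(unfold disk; lra)). apply Rabs_pos. Qed.

(** Multiplication by [c_const] turns the limit mass of the kernel into 1 and produces the
    normalised kernel on the right. *)
Lemma normalized_two_point (alpha M : R) (u : R -> R -> R) (l x1 y1 x2 y2 I : R) :
  -1 < alpha -> pde_sol alpha u -> (forall x y, disk x y -> Rabs (u x y) <= M) ->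
  disk x1 y1 -> disk x2 y2 ->
  RInt (fun t => Rabs (ker alpha (rot_x x1 y1 t) (rot_y x1 y1 t)
                       - l * ker alpha (rot_x x2 y2 t) (rot_y x2 y2 t))) 0 (2 * PI) <= 2 * PI * I ->
  Rabs (u x1 y1 - l * u x2 y2) <= M * (c_const alpha * I).
Proof.
  intros Ha Hu HM H1 H2 HI. assert (Hpi := two_PI_pos).
  assert (B := two_point_bound alpha M l u x1 y1 x2 y2 Ha Hu HM H1 H2).
  assert (C := c_const_Series alpha Ha). assert (Cp := c_const_pos alpha Ha).
  set (S1 := Series (radial_coef alpha)) in *. set (d := Rabs (u x1 y1 - l * u x2 y2)) in *.
  assert (B2 : 2 * PI * S1 * d <= M * (2 * PI * I)).
  { apply Rle_trans with (1 := B). apply Rmult_le_compat_l; [apply (bound_nonneg M u HM)|exact HI]. }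
  assert (B3 : S1 * d <= M * I).
  { apply Rmult_le_reg_l with (2 * PI); [exact Hpi|]. lra. }
  apply (Rmult_le_compat_l (c_const alpha)) in B3; [|lra].
  rewrite <- Rmult_assoc, C in B3. lra.
Qed.

(** The weight [l] is the lower bound of the kernel on the circle and the kernel at the origin is 1,
    so the difference of kernels is nonnegative and its absolute value integrates exactly. *)
Lemma schwarz_estimate (alpha M : R) (u : R -> R -> R) (x y : R) :
  -1 < alpha -> pde_sol alpha u -> (forall x y, disk x y -> Rabs (u x y) <= M) ->
  disk x y ->
  let r := Cmod (x, y) in
  let l := Rpower (1 - r) (alpha + 1) / (1 + r) in
  Rabs (u x y - l * u 0 0)
  <= M * (c_const alpha * PSeries (radial_coef alpha) (x * x + y * y) - l * c_const alpha).
Proof.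
  intros Ha Hu HM Hd r l. assert (Hpi := two_PI_pos).
  assert (Hr : 0 <= r < 1) by (split; [apply Cmod_ge_0|now apply in_disk_disk]).
  assert (Hrr : x * x + y * y = r * r) by (symmetry; apply Cmod_sqr).
  replace (c_const alpha * PSeries (radial_coef alpha) (x * x + y * y) - l * c_const alpha)
    with (c_const alpha * (PSeries (radial_coef alpha) (x * x + y * y) - l)) by ring.
  assert (H0 : disk 0 0) by (unfold disk; lra).
  apply normalized_two_point; [exact Ha|exact Hu|exact HM|exact Hd|exact H0|].
  assert (Ex : ex_RInt (fun t => ker alpha (rot_x x y t) (rot_y x y t) * 1) 0 (2 * PI))
    by (apply circ_int_ex; [apply ker_cont|intros; apply continuous_const|exact Hd]).
  right. rewrite (RInt_congr _ (fun t => ker alpha (rot_x x y t) (rot_y x y t) * 1 - l)).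
  - rewrite (RInt_minus (V := R_CompleteNormedModule)); [|exact Ex|apply ex_RInt_const].
    rewrite (RInt_const (V := R_CompleteNormedModule)).
    assert (E := circ_int_ker_1 alpha x y Ha Hd). unfold circ_int in E. rewrite E.
    unfold minus, plus, opp, scal; simpl; unfold mult; simpl. ring.
  - intros t. unfold rot_x at 2, rot_y at 2.
    replace (0 * cos t + 0 * sin t) with 0 by ring. replace (0 * cos t - 0 * sin t) with 0 by ring.
    rewrite ker_0, !Rmult_1_r. apply Rabs_right, Rge_minus, Rle_ge.
    apply ker_lower; [exact Ha|exact Hr|]. rewrite rot_sq. exact Hrr.
Qed.

(** Harnack's inequality in both directions gives [|kb - ka| <= (E - 1) ka] at every angle;
    integration turns [ka] into the mean of the kernel at the base point. *)
Lemma increment_estimate (alpha M : R) (u : R -> R -> R) (x y e1 e2 s : R) :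
  -1 < alpha -> pde_sol alpha u -> (forall x y, disk x y -> Rabs (u x y) <= M) ->
  disk x y -> e1 * e1 + e2 * e2 = 1 ->
  0 <= s -> Cmod (x, y) + s < 1 ->
  Rabs (u (x + s * e1) (y + s * e2) - u x y)
  <= M * (c_const alpha * (PSeries (radial_coef alpha) (x * x + y * y)
            * (exp (log_slope alpha (Cmod (x, y) + s) * s) - 1))).
Proof.
  intros Ha Hu HM Hd He Hs Hr. set (r := Cmod (x, y) + s) in *.
  assert (Hse : Cmod (s * e1, s * e2) = s).
  { assert (Q := Cmod_sqr (s * e1) (s * e2)). assert (Q0 := Cmod_ge_0 (s * e1, s * e2)).
    replace (s * e1 * (s * e1) + s * e2 * (s * e2)) with (s * s) in Q
      by (transitivity (s * s * (e1 * e1 + e2 * e2)); [rewrite He; ring|ring]).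
    nra. }
  assert (Hz : Cmod (x + s * e1, y + s * e2) <= r).
  { replace (x + s * e1, y + s * e2) with (Cplus (x, y) (s * e1, s * e2)) by reflexivity.
    eapply Rle_trans; [apply Cmod_triangle|]. rewrite Hse. apply Rle_refl. }
  assert (Hz0 : Cmod (x, y) <= r) by (unfold r; lra).
  assert (Hd' : disk (x + s * e1) (y + s * e2)) by (apply in_disk_disk; unfold in_disk; lra).
  set (E := exp (log_slope alpha r * s)).
  assert (HE0 : 0 < E) by apply exp_pos.
  assert (Hslope : 0 <= log_slope alpha r * s).
  { apply Rmult_le_pos; [|exact Hs]. unfold log_slope.
    assert (0 <= r) by (assert (K := Cmod_ge_0 (x, y)); lra).
    apply Rplus_le_le_0_compat; (apply Rmult_le_pos; [nra|left; apply Rinv_0_lt_compat; nra]). }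
  assert (HE1 : 1 <= E).
  { unfold E. assert (K := exp_ineq1_le (log_slope alpha r * s)). lra. }
  replace (u x y) with (1 * u x y) by ring.
  apply normalized_two_point; [exact Ha|exact Hu|exact HM|exact Hd'|exact Hd|].
  assert (Ex : ex_RInt (fun t => ker alpha (rot_x x y t) (rot_y x y t) * 1) 0 (2 * PI))
    by (apply circ_int_ex; [apply ker_cont|intros; apply continuous_const|exact Hd]).
  assert (C1 : forall t, continuous (fun t => ker alpha (rot_x x y t) (rot_y x y t)) t)
    by (intros; apply cont_disk_rot; [apply ker_cont|exact Hd]).
  assert (C2 : forall t, continuous (fun t => ker alpha (rot_x (x + s * e1) (y + s * e2) t)
      (rot_y (x + s * e1) (y + s * e2) t)) t)
    by (intros; apply cont_disk_rot; [apply ker_cont|exact Hd']).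
  apply Rle_trans with (RInt (fun t => (E - 1) * (ker alpha (rot_x x y t) (rot_y x y t) * 1)) 0 (2 * PI)).
  - apply RInt_le; [assert (K := two_PI_pos); lra| | |].
    + apply (ex_RInt_continuous (V := R_CompleteNormedModule)). intros t _.
      apply (continuous_Rabs_comp (fun t => ker alpha (rot_x (x + s * e1) (y + s * e2) t)
        (rot_y (x + s * e1) (y + s * e2) t) - 1 * ker alpha (rot_x x y t) (rot_y x y t))).
      apply (continuous_minus (V := R_NormedModule)); [apply C2|].
      apply (continuous_mult (K := R_AbsRing)); [apply continuous_const|apply C1].
    + now apply (ex_RInt_scal (V := R_NormedModule)).
    + intros t _. rewrite Rmult_1_l, Rmult_1_r.
      set (ka := ker alpha (rot_x x y t) (rot_y x y t)).
      set (kb := ker alpha (rot_x (x + s * e1) _ t) _).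
      assert (Ka : 0 < ka) by apply ker_pos. assert (Kb : 0 < kb) by apply ker_pos.
      destruct (rot_line x y e1 e2 s t) as [R1 R2].
      assert (Rs : Cmod (s * rot_x e1 e2 t, s * rot_y e1 e2 t) = s).
      { rewrite <- Hse at 3. rewrite <- (Cmod_rot (s * e1) (s * e2) t).
        unfold rot_x, rot_y. do 2 f_equal; ring. }
      assert (H1 : kb <= ka * E).
      { apply ker_harnack; [exact Ha|exact Hr|rewrite Cmod_rot; exact Hz0|rewrite Cmod_rot; exact Hz|].
        rewrite R1, R2. right. rewrite <- Rs at 3. do 2 f_equal; ring. }
      assert (H2 : ka <= kb * E).
      { apply ker_harnack; [exact Ha|exact Hr|rewrite Cmod_rot; exact Hz|rewrite Cmod_rot; exact Hz0|].
        rewrite R1, R2. right. rewrite <- Rs at 3. rewrite <- Cmod_opp. unfold Copp; simpl.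
        do 2 f_equal; ring. }
      apply Rabs_le. split; [|lra].
      assert (0 <= (kb - ka) + (E - 1) * ka); [|lra].
      (* If [kb < ka], then [ka - kb <= (E - 1) kb <= (E - 1) ka]. *)
      destruct (Rle_or_lt ka kb) as [Hab|Hab]; [nra|].
      assert ((E - 1) * kb <= (E - 1) * ka) by (apply Rmult_le_compat_l; lra). lra.
  - rewrite (RInt_scal (V := R_CompleteNormedModule)) by exact Ex.
    assert (Q := circ_int_ker_1 alpha x y Ha Hd). unfold circ_int in Q. rewrite Q.
    right. unfold scal; simpl; unfold mult; simpl. fold E. ring.
Qed.

(** The bound minus the increment of [u] is at least its value at [s = 0] for small positive [s], so
    its derivative at 0 cannot be negative. At [s = 0] the bound has derivative
    [N * log_slope alpha r]. *)
Lemma directional_estimate (alpha M : R) (u ux uy : R -> R -> R) (x y e1 e2 : R) :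
  -1 < alpha -> pde_sol alpha u -> (forall x y, disk x y -> Rabs (u x y) <= M) ->
  C1d u ux uy -> disk x y -> e1 * e1 + e2 * e2 = 1 ->
  ux x y * e1 + uy x y * e2
  <= M * (c_const alpha * PSeries (radial_coef alpha) (x * x + y * y)) * log_slope alpha (Cmod (x, y)).
Proof.
  intros Ha Hu HM HC Hd He. set (r := Cmod (x, y)).
  assert (Hr : 0 <= r < 1) by (split; [apply Cmod_ge_0|now apply in_disk_disk]).
  set (N := M * (c_const alpha * PSeries (radial_coef alpha) (x * x + y * y))).
  set (b := fun s => N * (exp (log_slope alpha (r + s) * s) - 1)).
  set (h := fun s => b s - u (x + s * e1) (y + s * e2)).
  assert (Db : is_derive b 0 (N * log_slope alpha r)).
  { unfold b, log_slope. auto_derive.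
    - rewrite Rplus_0_r. repeat split; nra.
    - rewrite !Rplus_0_r, !Rmult_0_r, exp_0. field. split; nra. }
  assert (Du : is_derive (fun s => u (x + s * e1) (y + s * e2)) 0 (ux x y * e1 + uy x y * e2)).
  { assert (K := C1d_derive_line u ux uy x y e1 e2 0 HC).
    rewrite !Rmult_0_l, !Rplus_0_r in K. exact (K Hd). }
  assert (Dh : is_derive h 0 (N * log_slope alpha r - (ux x y * e1 + uy x y * e2)))
    by (apply (is_derive_minus (V := R_NormedModule)); assumption).
  destruct (Rle_or_lt (ux x y * e1 + uy x y * e2) (N * log_slope alpha r)) as [?|Hlt]; [assumption|exfalso].
  apply is_derive_Reals in Dh.
  set (g := ux x y * e1 + uy x y * e2 - N * log_slope alpha r) in *.
  destruct (Dh g) as [d Hdd]; [unfold g; lra|].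
  assert (Hm : 0 < Rmin d (1 - r)) by (apply Rmin_glb_lt; [apply cond_pos|lra]).
  set (s := Rmin d (1 - r) / 2).
  assert (S1 := Rmin_l d (1 - r)). assert (S2 := Rmin_r d (1 - r)).
  assert (Hs : 0 < s) by (unfold s; lra).
  specialize (Hdd s ltac:(lra) ltac:(rewrite Rabs_right; unfold s; lra)).
  apply Rabs_def2 in Hdd. rewrite Rplus_0_l in Hdd.
  assert (HH : h s - h 0 < 0).
  { replace (h s - h 0) with ((h s - h 0) / s * s) by (field; lra).
    assert ((h s - h 0) / s < 0) by (unfold g in *; lra). nra. }
  assert (I := increment_estimate alpha M u x y e1 e2 s Ha Hu HM Hd He ltac:(lra) ltac:(fold r; unfold s; lra)).
  fold r in I. apply Rabs_le_between in I.
  unfold h, b in HH. rewrite !Rmult_0_r, !Rmult_0_l, exp_0, !Rplus_0_r in HH.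
  unfold N in HH. lra.
Qed.

(** * Complex solutions *)


Definition re_part (f : C -> C) (x y : R) : R := Re (f (x, y)).
Definition im_part (f : C -> C) (x y : R) : R := Im (f (x, y)).

Lemma continuous_re_im (f : C -> C) (x y : R) : continuous f (x, y) ->
  continuity_2d_pt (re_part f) x y /\ continuity_2d_pt (im_part f) x y.
Proof.
  intros H. split.
  - apply (continuous_2d (fun p => fst (f p))).
    apply (continuous_comp f fst); [exact H|apply continuous_fst].
  - apply (continuous_2d (fun p => snd (f p))).
    apply (continuous_comp f snd); [exact H|apply continuous_snd].
Qed.

Lemma Ck_disk_C1d (k : nat) (f : C -> C) : Ck_disk (S k) f ->
  C1d (re_part f) (re_part (partial_x f)) (re_part (partial_y f)) /\
  C1d (im_part f) (im_part (partial_x f)) (im_part (partial_y f)).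
Proof.
  intros [Hc [Hd [Hx Hy]]].
  assert (Cx : forall z, in_disk z -> continuous (partial_x f) z) by (destruct k; apply Hx).
  assert (Cy : forall z, in_disk z -> continuous (partial_y f) z) by (destruct k; apply Hy).
  split; intros x y H; apply in_disk_disk in H;
    destruct (Hd _ H) as [[X1 X2] [Y1 Y2]];
    destruct (continuous_re_im _ _ _ (Cx _ H)) as [CX1 CX2];
    destruct (continuous_re_im _ _ _ (Cy _ H)) as [CY1 CY2].
  - split; [exact (Derive_correct _ _ X1)|split; [exact (Derive_correct _ _ Y1)|now split]].
  - split; [exact (Derive_correct _ _ X2)|split; [exact (Derive_correct _ _ Y2)|now split]].
Qed.

Lemma C1d_schwarz (g gx gy gxx gxy gyx gyy : R -> R -> R) (x y : R) :
  C1d g gx gy -> C1d gx gxx gxy -> C1d gy gyx gyy -> disk x y -> gxy x y = gyx x y.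
Proof.
  intros H Hx Hy Hd. destruct (disk_locally x y Hd) as [d Hl].
  assert (Dx : forall u v, disk u v -> Derive (fun t => g t v) u = gx u v)
    by (intros u v K; apply is_derive_unique; now apply H).
  assert (Dy : forall u v, disk u v -> Derive (fun t => g u t) v = gy u v)
    by (intros u v K; apply is_derive_unique; now apply H).
  assert (Lx : forall u v, disk u v -> locally u (fun t => disk t v)) by exact disk_locally_x.
  assert (Ly : forall u v, disk u v -> locally v (fun t => disk u t)).
  { intros u v K. destruct (disk_locally_x v u) as [e He]; [unfold disk in *; lra|].
    exists e. intros t Ht. specialize (He t Ht). unfold disk in *; lra. }
  assert (Dyx : forall u v, disk u v -> is_derive (fun z => Derive (fun t => g z t) v) u (gyx u v)).
  { intros u v K. apply is_derive_ext_loc with (fun z => gy z v); [|now apply Hy].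
    apply filter_imp with (2 := Lx u v K). intros z Hz. symmetry. now apply Dy. }
  assert (Dxy : forall u v, disk u v -> is_derive (fun z => Derive (fun t => g t z) u) v (gxy u v)).
  { intros u v K. apply is_derive_ext_loc with (fun z => gx u z); [|now apply Hx].
    apply filter_imp with (2 := Ly u v K). intros z Hz. symmetry. now apply Dx. }
  assert (S : Derive (fun z => Derive (fun t => g z t) y) x = Derive (fun z => Derive (fun t => g t z) x) y).
  { apply Schwarz.
    - exists d. intros u v Hu Hv. assert (K := Hl u v Hu Hv).
      split; [exists (gx u v); now apply H|]. split; [exists (gy u v); now apply H|].
      split; [exists (gyx u v); now apply Dyx|exists (gxy u v); now apply Dxy].
    - apply continuity_2d_pt_ext_loc with gyx; [|now apply Hy].
      exists d. intros u v Hu Hv. symmetry. now apply is_derive_unique, Dyx, Hl.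
    - apply continuity_2d_pt_ext_loc with gxy; [|now apply Hx].
      exists d. intros u v Hu Hv. symmetry. now apply is_derive_unique, Dxy, Hl. }
  rewrite <- (is_derive_unique _ _ _ (Dyx x y Hd)), <- (is_derive_unique _ _ _ (Dxy x y Hd)).
  now symmetry.
Qed.

Lemma d_z_pair (f : C -> C) (x y : R) :
  d_z f (x, y) = (/ 2 * (re_part (partial_x f) x y + im_part (partial_y f) x y),
                  / 2 * (im_part (partial_x f) x y - re_part (partial_y f) x y)).
Proof.
  unfold d_z, re_part, im_part.
  destruct (partial_x f (x, y)) as [a1 a2]. destruct (partial_y f (x, y)) as [b1 b2].
  unfold RtoC, Ci, Cmult, Cminus, Cplus, Copp, Re, Im; simpl. f_equal; field.
Qed.

Lemma d_zbar_pair (f : C -> C) (x y : R) :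
  d_zbar f (x, y) = (/ 2 * (re_part (partial_x f) x y - im_part (partial_y f) x y),
                     / 2 * (im_part (partial_x f) x y + re_part (partial_y f) x y)).
Proof.
  unfold d_zbar, re_part, im_part.
  destruct (partial_x f (x, y)) as [a1 a2]. destruct (partial_y f (x, y)) as [b1 b2].
  unfold RtoC, Ci, Cmult, Cminus, Cplus, Copp, Re, Im; simpl. f_equal; field.
Qed.

(** Expanding [4 d_z d_zbar] leaves [i] times the commutator of the real partial derivatives, which
    vanishes by [C1d_schwarz]. *)
Lemma laplacian_pair (f : C -> C) (x y : R) : Ck_disk 2 f -> disk x y ->
  laplacian f (x, y) =
   (re_part (partial_x (partial_x f)) x y + re_part (partial_y (partial_y f)) x y,
    im_part (partial_x (partial_x f)) x y + im_part (partial_y (partial_y f)) x y).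
Proof.
  intros Hf Hd.
  destruct (Ck_disk_C1d 1 f Hf) as [F1 F2].
  destruct Hf as [_ [_ [Hx Hy]]].
  destruct (Ck_disk_C1d 0 _ Hx) as [X1 X2]. destruct (Ck_disk_C1d 0 _ Hy) as [Y1 Y2].
  assert (S1 := C1d_schwarz _ _ _ _ _ _ _ x y F1 X1 Y1 Hd).
  assert (S2 := C1d_schwarz _ _ _ _ _ _ _ x y F2 X2 Y2 Hd).
  destruct (X1 x y Hd) as [X1x [X1y _]]. destruct (X2 x y Hd) as [X2x [X2y _]].
  destruct (Y1 x y Hd) as [Y1x [Y1y _]]. destruct (Y2 x y Hd) as [Y2x [Y2y _]].
  assert (Lin : forall (a b : R -> R) s a1 b1 c d, is_derive a s a1 -> is_derive b s b1 ->
     Derive (fun t => c * (a t + d * b t)) s = c * (a1 + d * b1)).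
  { intros a b s a1 b1 c d A B. apply is_derive_unique.
    apply (is_derive_scal (fun t => a t + d * b t)).
    apply (is_derive_plus (V := R_NormedModule)); [exact A|].
    now apply (is_derive_scal b). }
  assert (Z : forall u v, d_zbar f (u, v) =
     (/ 2 * (re_part (partial_x f) u v + -1 * im_part (partial_y f) u v),
      / 2 * (im_part (partial_x f) u v + 1 * re_part (partial_y f) u v))).
  { intros u v. rewrite d_zbar_pair. f_equal; ring. }
  unfold laplacian. rewrite d_z_pair.
  assert (V : forall (h : R -> R) (a b : R -> R) s a1 b1 d,
     (forall t, h t = / 2 * (a t + d * b t)) -> is_derive a s a1 -> is_derive b s b1 ->
     Derive h s = / 2 * (a1 + d * b1)).
  { intros h a b s a1 b1 d Hh A B. rewrite (Derive_ext _ _ _ Hh). now apply Lin. }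
  assert (V1 := V _ _ _ _ _ _ (-1) (fun t => f_equal fst (Z t y)) X1x Y2x).
  assert (V2 := V _ _ _ _ _ _ 1 (fun t => f_equal snd (Z t y)) X2x Y1x).
  assert (V3 := V _ _ _ _ _ _ (-1) (fun t => f_equal fst (Z x t)) X1y Y2y).
  assert (V4 := V _ _ _ _ _ _ 1 (fun t => f_equal snd (Z x t)) X2y Y1y).
  change (re_part (partial_x (d_zbar f)) x y = / 2 * (re_part (partial_x (partial_x f)) x y
    + -1 * im_part (partial_x (partial_y f)) x y)) in V1.
  change (im_part (partial_x (d_zbar f)) x y = / 2 * (im_part (partial_x (partial_x f)) x y
    + 1 * re_part (partial_x (partial_y f)) x y)) in V2.
  change (re_part (partial_y (d_zbar f)) x y = / 2 * (re_part (partial_y (partial_x f)) x y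
    + -1 * im_part (partial_y (partial_y f)) x y)) in V3.
  change (im_part (partial_y (d_zbar f)) x y = / 2 * (im_part (partial_y (partial_x f)) x y
    + 1 * re_part (partial_y (partial_y f)) x y)) in V4.
  rewrite V1, V2, V3, V4.
  rewrite S1, S2. unfold RtoC, Cmult; simpl. f_equal; field.
Qed.

Lemma pde_sol_re_im (alpha : R) (f : C -> C) : Ck_disk 2 f ->
  (forall z, in_disk z -> T_op alpha f z = RtoC 0) ->
  pde_sol alpha (re_part f) /\ pde_sol alpha (im_part f).
Proof.
  intros Hf HT.
  destruct (Ck_disk_C1d 1 f Hf) as [F1 F2].
  assert (Hf' := Hf). destruct Hf' as [_ [_ [Hx Hy]]].
  destruct (Ck_disk_C1d 0 _ Hx) as [X1 X2]. destruct (Ck_disk_C1d 0 _ Hy) as [Y1 Y2].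
  assert (E : forall x y, disk x y ->
    (1 - (x * x + y * y)) * (re_part (partial_x (partial_x f)) x y + re_part (partial_y (partial_y f)) x y)
     + 2 * alpha * (x * re_part (partial_x f) x y + y * re_part (partial_y f) x y)
     - alpha * alpha * re_part f x y = 0 /\
    (1 - (x * x + y * y)) * (im_part (partial_x (partial_x f)) x y + im_part (partial_y (partial_y f)) x y)
     + 2 * alpha * (x * im_part (partial_x f) x y + y * im_part (partial_y f) x y)
     - alpha * alpha * im_part f x y = 0).
  { intros x y Hd. assert (T := HT (x, y) (proj2 (in_disk_disk x y) Hd)).
    unfold T_op in T. rewrite laplacian_pair, d_z_pair, d_zbar_pair in T by assumption.
    replace (Cmod (x, y) ^ 2) with (x * x + y * y) in T by (rewrite <- Cmod_sqr; ring).
    set (w := 1 - (x * x + y * y)) in *.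
    assert (Hw : 0 < w) by (unfold w, disk in *; lra).
    (* With [w^(-alpha) = w * w^(-alpha-1)] the factor [W / 4] is common to all terms. The
       coefficients then being real, the real and imaginary parts separate, and
       [z d_z + zbar d_zbar] becomes [x d_x + y d_y]. *)
    replace (Rpower w (- alpha)) with (w * Rpower w (- alpha - 1)) in T.
    2:{ rewrite <- (Rpower_1 w Hw) at 1. rewrite <- Rpower_plus. f_equal. ring. }
    assert (Hp : 0 < Rpower w (- alpha - 1)) by apply exp_pos.
    set (W := Rpower w (- alpha - 1)) in *.
    replace (f (x, y)) with (re_part f x y, im_part f x y) in T by (unfold re_part, im_part, Re, Im; now destruct (f (x, y))).
    assert (T1 := f_equal fst T). assert (T2 := f_equal snd T).
    unfold RtoC, Cmult, Cplus, Cconj in T1, T2. simpl in T1, T2.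
    split; apply Rmult_eq_reg_l with (W / 4); lra. }
  split.
  - do 6 eexists. split; [exact F1|]. split; [exact X1|]. split; [exact Y1|]. intros; now apply E.
  - do 6 eexists. split; [exact F2|]. split; [exact X2|]. split; [exact Y2|]. intros; now apply E.
Qed.

(** * Moduli as real parts after rotation *)

Lemma Cmod_polar (z : C) : exists th, z = (Cmod z * cos th, Cmod z * sin th).
Proof.
  destruct z as [a b].
  destruct (polar_coord a b (Cmod (a, b)) (Cmod_ge_0 _)) as [th [H1 H2]].
  - symmetry. apply Cmod_sqr.
  - exists th. now f_equal.
Qed.

Lemma Cmod_rotate (z : C) : exists phi, Cmod z = cos phi * fst z + - sin phi * snd z.
Proof.
  destruct (Cmod_polar z) as [th Hth]. exists (- th). rewrite cos_neg, sin_neg.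
  generalize dependent (Cmod z). intros m ->. simpl.
  assert (S := sin2_cos2 th). unfold Rsqr in S.
  transitivity (m * (sin th * sin th + cos th * cos th)); [rewrite S|]; ring.
Qed.

Lemma rotated_part_bound (a b phi : R) : Rabs (cos phi * a + - sin phi * b) <= Cmod (a, b).
Proof.
  assert (S := sin2_cos2 phi). unfold Rsqr in S.
  assert (Q := Cmod_sqr a b). assert (Q0 := Cmod_ge_0 (a, b)).
  assert (E : (cos phi * a + - sin phi * b) * (cos phi * a + - sin phi * b)
    + (sin phi * a + cos phi * b) * (sin phi * a + cos phi * b) = Cmod (a, b) * Cmod (a, b)).
  { rewrite Q. transitivity ((sin phi * sin phi + cos phi * cos phi) * (a * a + b * b)); [ring|].
    rewrite S. ring. }
  assert (B := Rle_0_sqr (sin phi * a + cos phi * b)). unfold Rsqr in B.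
  rewrite <- (Rabs_right (Cmod (a, b))) by lra. apply Rsqr_le_abs_0. unfold Rsqr. lra.
Qed.

Lemma gradient_bracket_nonneg (alpha r : R) : -1 < alpha -> 0 <= r < 1 ->
  0 <= 2 + alpha + (4 + 3 * alpha) * r.
Proof. intros Ha Hr. assert (0 <= (1 + alpha) * r) by (apply Rmult_le_pos; lra). nra. Qed.

Theorem theorem1 (alpha M : R) (f : C -> C) (fstar : (R -> C) -> C)
  (halpha : -1 < alpha) (hM : 0 < M)
  (hf : Ck_disk 2 f)
  (hfstar : is_distribution fstar)
  (hsol : dirichlet_solution alpha f fstar)
  (hbound : forall z : C, in_disk z -> Cmod (f z) <= M) :
  (forall z : C, in_disk z ->
     Cmod (f z
           - RtoC (Rpower (1 - Cmod z) (alpha + 1) / (1 + Cmod z)) * f (RtoC 0))%C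
     <= M * (1 / (2 * PI)
               * RInt (fun t => K_kernel alpha (z * cis (- t))%C) 0 (2 * PI)
             - Rpower (1 - Cmod z) (alpha + 1) / (1 + Cmod z)
               * K_kernel alpha (RtoC 0))) /\
  (forall z : C, in_disk z ->
     norm_D f z
       <= M * M_mean alpha (Cmod z) * (2 + alpha + (4 + 3 * alpha) * Cmod z)
          / (1 - Cmod z ^ 2) /\
     M * M_mean alpha (Cmod z) * (2 + alpha + (4 + 3 * alpha) * Cmod z)
          / (1 - Cmod z ^ 2)
       <= M * (2 + alpha + (4 + 3 * alpha) * Cmod z) / (1 - Cmod z ^ 2)) /\
  (forall r : R, 0 <= r < 1 ->
     M_mean alpha r
     = Gamma (1 + alpha / 2) ^ 2 / Gamma (1 + alpha)
       * hypergeom (- alpha / 2) (- alpha / 2) 1 (r ^ 2)).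
Proof.
  destruct hsol as [hT _].
  destruct (pde_sol_re_im alpha f hf hT) as [Hre Him].
  destruct (Ck_disk_C1d 1 f hf) as [F1 F2].
  (* The real part of [e^(i phi) f]. *)
  set (u := fun phi x y => cos phi * re_part f x y + - sin phi * im_part f x y).
  assert (Hu : forall phi, pde_sol alpha (u phi)) by (intros; now apply pde_sol_lin).
  assert (Hub : forall phi x y, disk x y -> Rabs (u phi x y) <= M).
  { intros phi x y Hd. apply in_disk_disk in Hd. apply Rle_trans with (2 := hbound _ Hd).
    unfold u, re_part, im_part, Re, Im. destruct (f (x, y)) as [a b]. apply rotated_part_bound. }
  split; [|split].
  - intros [x y] Hz. assert (Hd := proj1 (in_disk_disk x y) Hz).
    rewrite mean_K_kernel_rot, K_kernel_0 by assumption.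
    set (l := Rpower (1 - Cmod (x, y)) (alpha + 1) / (1 + Cmod (x, y))).
    set (X := (f (x, y) - RtoC l * f (RtoC 0))%C).
    (* The angle depends on the point, which is harmless because the real estimate is uniform in
       [phi]. *)
    destruct (Cmod_rotate X) as [phi Hphi].
    assert (E : Cmod X = u phi x y - l * u phi 0 0).
    { rewrite Hphi. unfold u, re_part, im_part, X, Re, Im. change (0, 0) with (RtoC 0).
      destruct (f (x, y)) as [a b]. destruct (f (RtoC 0)) as [a0 b0].
      unfold Cminus, Cplus, Copp, Cmult, RtoC; simpl. ring. }
    rewrite E. eapply Rle_trans; [apply Rle_abs|].
    exact (schwarz_estimate alpha M (u phi) x y halpha (Hu _) (Hub _) Hd).
  - intros [x y] Hz. assert (Hd := proj1 (in_disk_disk x y) Hz).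
    assert (Hr : 0 <= Cmod (x, y) < 1) by (split; [apply Cmod_ge_0|exact Hz]).
    rewrite M_mean_PSeries by assumption. rewrite Cmod_sqr.
    assert (Hrr := Cmod_sqr x y).
    set (r := Cmod (x, y)) in *.
    assert (Hw : 0 < 1 - r ^ 2) by nra.
    assert (Hbr := gradient_bracket_nonneg alpha r halpha Hr).
    split.
    + destruct (Cmod_polar (d_z f (x, y))) as [t1 P1].
      destruct (Cmod_polar (d_zbar f (x, y))) as [t2 P2].
      unfold norm_D. set (p := Cmod (d_z f (x, y))) in *. set (q := Cmod (d_zbar f (x, y))) in *.
      rewrite d_z_pair in P1. rewrite d_zbar_pair in P2.
      injection P1 as P11 P12. injection P2 as P21 P22.
      (* The derivative of [u phi] in the direction [e^(i psi)] is the real part of [e^(i phi) (e^(i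
         psi) f_z + e^(-i psi) f_zbar)]. With [phi + psi = -t1] and [phi - psi = -t2] both terms are
         positive reals or zero, and their sum is [norm_D]. *)
      set (phi := - ((t1 + t2) / 2)). set (psi := (t2 - t1) / 2).
      assert (G := directional_estimate alpha M (u phi) _ _ x y (cos psi) (sin psi)
        halpha (Hu phi) (Hub phi) (C1d_lin (cos phi) (- sin phi) _ _ _ _ _ _ F1 F2) Hd).
      simpl in G.
      assert (Sp := sin2_cos2 psi). unfold Rsqr in Sp. specialize (G ltac:(lra)).
      fold r in G.
      replace (M * (c_const alpha * PSeries (radial_coef alpha) (x * x + y * y))
        * (2 + alpha + (4 + 3 * alpha) * r) / (1 - r ^ 2))
        with (M * (c_const alpha * PSeries (radial_coef alpha) (x * x + y * y)) * log_slope alpha r).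
      2:{ unfold log_slope. field. split; nra. }
      apply Rle_trans with (2 := G). right.
      set (a1 := re_part (partial_x f) x y) in *. set (a2 := im_part (partial_x f) x y) in *.
      set (b1 := re_part (partial_y f) x y) in *. set (b2 := im_part (partial_y f) x y) in *.
      replace a1 with (p * cos t1 + q * cos t2) by lra.
      replace b2 with (p * cos t1 - q * cos t2) by lra.
      replace a2 with (p * sin t1 + q * sin t2) by lra.
      replace b1 with (q * sin t2 - p * sin t1) by lra.
      transitivity (p * cos (phi + psi + t1) + q * cos (phi - psi + t2)).
      * replace (phi + psi + t1) with 0 by (unfold phi, psi; field).
        replace (phi - psi + t2) with 0 by (unfold phi, psi; field). rewrite cos_0. ring.
      * rewrite !cos_plus, !sin_plus, cos_minus, sin_minus. ring.
    + apply Rmult_le_compat_r; [left; now apply Rinv_0_lt_compat|].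
      apply Rmult_le_compat_r; [exact Hbr|].
      rewrite <- (Rmult_1_r M) at 2. apply Rmult_le_compat_l; [lra|].
      (* Here 1 is the value at [q = 1] of the mean of the kernel, which is a power series in [q]
         with nonnegative coefficients. *)
      rewrite <- (c_const_Series alpha halpha). apply Rmult_le_compat_l.
      * left. now apply c_const_pos.
      * apply radial_PSeries_bounds; [exact halpha|]. unfold disk in Hd. nra.
  - intros r Hr. rewrite M_mean_PSeries by assumption.
    unfold c_const. replace (alpha / 2 + 1) with (1 + alpha / 2) by ring. f_equal.
    unfold PSeries, hypergeom. apply Series_ext. intros n.
    unfold radial_coef, gauss_term. replace (r * r) with (r ^ 2) by ring.
    unfold Rdiv. ring.
Qed.
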